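(* Let $(\Sigma,\mu)$ be a measure space with a ball-basis $\mathscr{B}$ such that $A_{1,\mathscr{B}}\subset\bigcup_{s>1}RH_{s,\mathscr{B}}$. Let $T$ be a $\mathbb{B}$-valued multilinear bounded oscillation operator with respect to $\mathscr{B}$ and $r\in[1,\infty)$ such that $T$ is bounded from $L^r(\Sigma,\mu)\times\cdots\times L^r(\Sigma,\mu)$ to $L^{\frac rm,\infty}(\Sigma,\mu)$. If $w\in A_{1,\mathscr{B}}$ and $v^{\frac rm}\in A_{\infty,\mathscr{B}}$, then there is a constant $C>0$ such that for all $\vec f=(f_1,\ldots,f_m)\in L^r(\Sigma,\mu)^m$, $$\bigg\|\frac{T(\vec f)}{v}\bigg\|_{L^{\frac rm,\infty}(\Sigma,\,wv^{\frac rm})}\le C\bigg\|\frac{\mathcal{M}_{\mathscr{B},r}(\vec f)}{v}\bigg\|_{L^{\frac rm,\infty}(\Sigma,\,wv^{\frac rm})}.$$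
   Context: Ball-basis. A family $\mathscr{B}$ of measurable subsets of a measure space $(\Sigma,\mu)$ is a ball-basis if: (B1) $0<\mu(B)<\infty$ for all $B\in\mathscr{B}$; (B2) for all $x,y\in\Sigma$ some $B\in\mathscr{B}$ contains both; (B3) for every $\varepsilon>0$ and measurable $E$ there is a finite or infinite sequence $\{B_k\}\subset\mathscr{B}$ with $\mu(E\Delta\bigcup_kB_k)<\varepsilon$; (B4) there is a universal constant $\mathfrak{C}_0\ge1$ and for each $B\in\mathscr{B}$ a set $B^*\in\mathscr{B}$ (fixed once and for all) with $\mu(B^* )\le\mathfrak{C}_0\mu(B)$, $\bigcup\{B'\in\mathscr{B}:B'\cap B\ne\emptyset,\ \mu(B')\le2\mu(B)\}\subset B^*$, and $A\subset B\Rightarrow A^*\subset B^*$. Notation. $\vec f\mathbf{1}_E=(f_1\mathbf{1}_E,\ldots,f_m\mathbf{1}_E)$, $\langle f\rangle_{B,r}:=(\frac1{\mu(B)}\int_B|f|^rd\mu)^{1/r}$, $\lfloor f\rfloor_{B,r}:=\sup_{B'\in\mathscr{B},\,B'\supset B}\langle f\rangle_{B',r}$. An operator $T$ is $m$-sublinear if in each entry $|T(\ldots,\lambda f_i,\ldots)|=|\lambda||T(\ldots,f_i,\ldots)|$ and $|T(\ldots,f_i+g_i,\ldots)|\le|T(\ldots,f_i,\ldots)|+|T(\ldots,g_i,\ldots)|$. Bounded oscillation operators. Let $\mathbb{B}$ be a Banach space. $T$ is a $\mathbb{B}$-valued multilinear bounded oscillation operator with respect to $\mathscr{B}$ and $r\in[1,\infty)$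 if there are constants $\mathfrak{C}_1(T),\mathfrak{C}_2(T)\in(0,\infty)$ and a $\mathbb{B}$-valued $m$-linear operator $\mathcal{T}$ with $T(\vec f)(x)=\|\mathcal{T}(\vec f)(x)\|_{\mathbb{B}}$ for every $x\in\Sigma$ (or, when $\mathbb{B}=\mathbb{R}$, $\mathcal{T}=T$ is a real-valued $m$-linear or $m$-sublinear operator) such that: (T1) for every $B_0\in\mathscr{B}$ with $B_0^*\subsetneq\Sigma$ there is $B\in\mathscr{B}$ with $B\supsetneq B_0$ such that for all $\vec f\in L^r(\Sigma,\mu)^m$, $\sup_{x\in B_0}\|\mathcal{T}(\vec f\mathbf{1}_{B^*})(x)-\mathcal{T}(\vec f\mathbf{1}_{B_0^*})(x)\|_{\mathbb{B}}\le\mathfrak{C}_1(T)\prod_{i=1}^m\langle f_i\rangle_{B^*,r}$; (T2) for every $B\in\mathscr{B}$ and all $\vec f\in L^r(\Sigma,\mu)^m$, $\sup_{x,x'\in B}\|(\mathcal{T}(\vec f)-\mathcal{T}(\vec f\mathbf{1}_{B^*}))(x)-(\mathcal{T}(\vec f)-\mathcal{T}(\vec f\mathbf{1}_{B^*}))(x')\|_{\mathbb{B}}\le\mathfrak{C}_2(T)\prod_{i=1}^m\lfloor f_i\rfloor_{B,r}$. Maximal operators. $\mathcal{M}_{\mathscr{B},r}(\vec f)(x):=\sup_{B\in\mathscr{B}:x\in B}\prod_{i=1}^m\langle f_i\rangle_{B,r}$ if $x\in\bigcup_{B\in\mathscr{B}}B$ and $0$ otherwise; $M_{\mathscr{B}}$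 is the case $m=1$, $r=1$. Weights. A weight is a measurable function $w$ with $0<w<\infty$ a.e. For $1<p<\infty$, $[w]_{A_{p,\mathscr{B}}}:=\sup_{B\in\mathscr{B}}(\frac1{\mu(B)}\int_Bw\,d\mu)(\frac1{\mu(B)}\int_Bw^{1-p'}d\mu)^{p-1}$; $[w]_{A_{1,\mathscr{B}}}:=\|(M_{\mathscr{B}}w)w^{-1}\|_{L^\infty(\Sigma,\mu)}$; $A_{p,\mathscr{B}}$ is the class of weights where this is finite; $A_{\infty,\mathscr{B}}:=\bigcup_{p\ge1}A_{p,\mathscr{B}}$. For $1<s<\infty$, $w\in RH_{s,\mathscr{B}}$ means $\sup_{B\in\mathscr{B}}(\frac1{\mu(B)}\int_Bw^sd\mu)^{1/s}(\frac1{\mu(B)}\int_Bw\,d\mu)^{-1}<\infty$. $L^{p,\infty}(\Sigma,\sigma)$ is the weak Lebesgue space with respect to the measure $\sigma\,d\mu$. *)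

(* Defs.v *)
From HB Require Import structures.
From mathcomp Require Import all_boot all_order all_algebra.
From mathcomp Require Import all_classical all_reals all_analysis.
From mathcomp Require Import measurable_realfun ess_sup_inf.

Set Implicit Arguments.
Unset Strict Implicit.
Unset Printing Implicit Defensive.

Import Order.TTheory GRing.Theory Num.Theory.
Import numFieldNormedType.Exports.

Local Open Scope classical_set_scope.
Local Open Scope ring_scope.
Local Open Scope ereal_scope.

Section ball_basis.
Context {d : measure_display} {X : measurableType d} {R : realType}.
Variable mu : {measure set X -> \bar R}.

(* [star] is the enlargement B |-> B^*, part of the data. The index set [D]
   makes the approximating sequence finite (possibly empty) or infinite. *)
Record ball_basis (BB : set (set X)) (star : set X -> set X) : Prop := {
  bb_measurable : forall B, BB B -> measurable B ;
  bb_B1 : forall B, BB B -> 0 < mu B < +oo ;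
  bb_B2 : forall x y, exists B, [/\ BB B, B x & B y] ;
  bb_B3 : forall (e : R) (E : set X), (0 < e)%R -> measurable E ->
    exists (D : set nat) (B_ : nat -> set X),
      (forall k, D k -> BB (B_ k)) /\
      mu (E `+` \bigcup_(k in D) B_ k) < e%:E ;
  bb_B4 : exists C0 : R, (1 <= C0)%R /\
    [/\ forall B, BB B -> BB (star B),
        forall B, BB B -> mu (star B) <= C0%:E * mu B,
        forall B, BB B ->
          \bigcup_(B' in [set B' | [/\ BB B', B' `&` B !=set0 &
                                      mu B' <= 2%:E * mu B]]) B'
            `<=` star B
      & forall A B, BB A -> BB B -> A `<=` B -> star A `<=` star B]
}.

Definition mean (B : set X) (f : X -> \bar R) : \bar R :=
  (mu B)^-1 * \int[mu]_(x in B) f x.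

Definition avg (r : R) (B : set X) (f : X -> \bar R) : \bar R :=
  mean B (fun x => `|f x| `^ r) `^ r^-1.

Variable BB : set (set X).

Definition sup_avg (r : R) (B : set X) (f : X -> \bar R) : \bar R :=
  ereal_sup [set avg r B' f | B' in [set B' | BB B' /\ B `<=` B']].

Definition maximal (r : R) (m : nat) (f : 'I_m -> X -> \bar R) (x : X)
    : \bar R :=
  if `[< (\bigcup_(B in BB) B) x >]
  then ereal_sup [set \prod_(i < m) avg r B (f i)
                 | B in [set B | BB B /\ B x]]
  else 0.

Definition maximal1 (f : X -> \bar R) : X -> \bar R :=
  maximal 1 (fun _ : 'I_1 => f).

(* Off the full-measure set where 0 < w < +oo, the values of powers and
   inverses of w are library conventions and play no role. *)
Definition weight (w : X -> \bar R) : Prop :=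
  measurable_fun [set: X] w /\ {ae mu, forall x, 0 < w x < +oo}.

(* 1 - p' = 1 - p / (p - 1). *)
Definition Ap_const (p : R) (w : X -> \bar R) : \bar R :=
  ereal_sup [set mean B w *
      mean B (fun x => w x `^ (1 - p / (p - 1))%R) `^ (p - 1)%R | B in BB].

Definition A1_const (w : X -> \bar R) : \bar R :=
  Lnorm mu +oo (fun x => maximal1 w x / w x).

Definition Ap (p : R) (w : X -> \bar R) : Prop :=
  weight w /\ Ap_const p w < +oo.

Definition A1 (w : X -> \bar R) : Prop :=
  weight w /\ A1_const w < +oo.

Definition Ainf (w : X -> \bar R) : Prop :=
  A1 w \/ exists p : R, (1 < p)%R /\ Ap p w.

(* The ratio of means is not meaningful when [mean B w = +oo] (it evaluates to
   0); this does not happen for A_1 weights, since maximal1 w would then be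
   infinite on B. *)
Definition RH (s : R) (w : X -> \bar R) : Prop :=
  weight w /\
  ereal_sup [set (mean B (fun x => w x `^ s)) `^ s^-1 / mean B w | B in BB]
    < +oo.

(* Quasi-norm of L^{p,oo} over the set function nu. The outer measure nu^*
   agrees with nu on measurable sets; it is needed because maximal functions
   over an uncountable ball-basis need not be measurable. *)
Definition weak_norm (p : R) (nu : set X -> \bar R) (f : X -> \bar R)
    : \bar R :=
  ereal_sup [set l%:E * ((nu^*)%mu [set x | l%:E < `|f x|]) `^ p^-1
            | l in [set l : R | (0 < l)%R]].

Definition weighted (s : X -> \bar R) (E : set X) : \bar R :=
  \int[mu]_(x in E) s x.

Section operators.
Variables (m : nat) (r : R).

Definition Lr (f : 'I_m -> X -> R) : Prop :=
  forall i, f i \in Lfun mu r%:E.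

Definition restr (f : 'I_m -> X -> R) (E : set X) : 'I_m -> X -> R :=
  fun i => (f i \* \1_E)%R.

Definition subst_entry (f : 'I_m -> X -> R) (i : 'I_m) (g : X -> R) :
  'I_m -> X -> R := @dfwith 'I_m (fun=> X -> R) f i g.

Definition mlinear (V : completeNormedModType R)
    (cT : ('I_m -> X -> R) -> X -> V) : Prop :=
  forall (f : 'I_m -> X -> R) (i : 'I_m) (g h : X -> R) (a : R) (x : X),
    Lr f -> g \in Lfun mu r%:E -> h \in Lfun mu r%:E ->
    (cT (subst_entry f i (fun y => a * g y)%R) x
       = a *: cT (subst_entry f i g) x)%R /\
    (cT (subst_entry f i (fun y => g y + h y)%R) x
       = cT (subst_entry f i g) x + cT (subst_entry f i h) x)%R.

Definition msublinear (T : ('I_m -> X -> R) -> X -> R) : Prop :=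
  forall (f : 'I_m -> X -> R) (i : 'I_m) (g h : X -> R) (a : R) (x : X),
    Lr f -> g \in Lfun mu r%:E -> h \in Lfun mu r%:E ->
    (`|T (subst_entry f i (fun y => a * g y)) x|
       = `|a| * `|T (subst_entry f i g) x|)%R /\
    (`|T (subst_entry f i (fun y => g y + h y)) x|
       <= `|T (subst_entry f i g) x| + `|T (subst_entry f i h) x|)%R.

Variable star : set X -> set X.

Definition osc_T1 (V : completeNormedModType R)
    (cT : ('I_m -> X -> R) -> X -> V) (C1 : R) : Prop :=
  forall B0, BB B0 -> star B0 `<` [set: X] ->
  exists B, [/\ BB B, B0 `<` B & forall f, Lr f ->
    ereal_sup [set (`|cT (restr f (star B)) x
                      - cT (restr f (star B0)) x|%R)%:E | x in B0]
    <= C1%:E * \prod_(i < m) avg r (star B) (EFin \o f i)].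

Definition osc_T2 (V : completeNormedModType R)
    (cT : ('I_m -> X -> R) -> X -> V) (C2 : R) : Prop :=
  forall B, BB B -> forall f, Lr f ->
    ereal_sup [set (`|(cT f x - cT (restr f (star B)) x)
                      - (cT f x' - cT (restr f (star B)) x')|%R)%:E
              | x in B & x' in B]
    <= C2%:E * \prod_(i < m) sup_avg r B (EFin \o f i).

Definition oscillation (V : completeNormedModType R)
    (cT : ('I_m -> X -> R) -> X -> V) : Prop :=
  exists C1 C2 : R,
    [/\ (0 < C1)%R, (0 < C2)%R, osc_T1 cT C1 & osc_T2 cT C2].

(* Operators are total functions, constrained only on L^r x ... x L^r. *)
Inductive bounded_oscillation :
    completeNormedModType R -> (('I_m -> X -> R) -> X -> R) -> Prop :=
| BO_norm (V : completeNormedModType R)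
    (cT : ('I_m -> X -> R) -> X -> V) (T : ('I_m -> X -> R) -> X -> R) :
    mlinear cT ->
    (forall f x, Lr f -> T f x = `|cT f x|%R) ->
    oscillation cT ->
    bounded_oscillation V T
| BO_real (T : ('I_m -> X -> R) -> X -> R) :
    mlinear (V := R) T \/ msublinear T ->
    oscillation (V := R) T ->
    bounded_oscillation R T.

Definition weak_bounded (T : ('I_m -> X -> R) -> X -> R) : Prop :=
  exists C : R, (0 < C)%R /\ forall f, Lr f ->
    measurable_fun [set: X] (T f) /\
    weak_norm (r / m%:R)%R mu (EFin \o T f)
      <= C%:E * \prod_(i < m) 'N[mu]_(r%:E) [EFin \o f i].

End operators.
End ball_basis.

(* Main.v *)
Require Import Defs.
From HB Require Import structures.
From mathcomp Require Import all_boot all_order all_algebra.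
From mathcomp Require Import all_classical all_reals all_analysis.
From mathcomp Require Import measurable_realfun ess_sup_inf.
From mathcomp Require Import ring lra.
Set Implicit Arguments.
Unset Strict Implicit.
Unset Printing Implicit Defensive.
Import Order.TTheory GRing.Theory Num.Theory.
Import numFieldNormedType.Exports.
Local Open Scope classical_set_scope.
Local Open Scope ring_scope.
Local Open Scope ereal_scope.

(** Write [q = r / m], [nu = v ^ q] and [rho = w nu].  The operator is used
    only through a comparison with the maximal function, valid for every
    measure [sg] that is doubling on the balls and gives small mass to the
    small parts of balls:
      [int_(|T f| > t0) |T f| ^ dl dsg <= C int (max f) ^ dl dsg],
    for [0 < dl <= q] ([coifman_fefferman]).  It comes from a good-lambda
    inequality for the union [Omega f l] of the balls [B] on which
    [T f - T (f 1_(star B))] exceeds [l] somewhere.  The condition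
    [osc_T2] and the weak type of [T] bound the measure of this union
    ([Omega_weak]); the condition [osc_T1] leads from a nearly maximal ball of
    the family to a larger one that no longer belongs to it ([stopping_ball]);
    and a.e. outside [Omega f l] the function [|T f|] is controlled by [l] and
    the maximal function ([control_off_Omega]).

    Let now [E] be a part of the level set [|T f| > l v], contained in a ball
    and on which [w], [v] are bounded and [v] is bounded away from 0
    ([truncation]).  The comparison is applied to
      [sg = nu ^ (1 - theta) w'],   [w' = (M ((w 1_E) ^ s)) ^ (1 / s)],
    with [M] the maximal operator, [theta < 1] close to 1 and [s > 1] close
    to 1.  The function [w'] replaces [w 1_E]:
    - [w <= C w'] a.e. on [E] ([le_wlift]);
    - [w' <= C w] a.e., as [w] is in [A_1] and satisfies a reverse Holder
      inequality ([wlift_dominated]);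
    - [w' ^ s'] is an [A_1] weight for [1 < s' < s], by the theorem of
      Coifman and Rochberg ([A1_power_gmax]); with [nu] in [A_infty] and
      truncated from above, this makes [sg] doubling, with constants independent of [E] and of the
      truncation ([product_doubling], [product_small]);
    - [int (w' / w) ^ p drho <= C rho E] for some [p > 1], because [M] is
      bounded on [L ^ (p / s)] of the measure [w ^ (1 - p) nu]
      ([dual_weight_strong]).
    Then
      [l ^ (q theta) rho E <= int_E |T f| ^ (q theta) nu ^ (1 - theta) w
         <= C int (max f) ^ (q theta) nu ^ (1 - theta) w'
          = C int ((max f) ^ q / nu) ^ theta (w' / w) drho].
    If [K] is the weak [L ^ 1 (rho)] quasi-norm of [(max f) ^ q / nu], the last
    integral is at most [C K ^ theta (rho E) ^ (1 - theta)], as [w' / w] is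
    bounded and belongs to [L ^ p (rho)] with [p (1 - theta) < 1]
    ([weak_product]).  Since [rho E] is finite it can be absorbed, which gives
    [l ^ q rho E <= C K] ([weighted_weak]), and the truncation is removed by
    monotone limits.

    A ball-basis may be uncountable, so maximal functions over all balls need
    not be measurable.  The maximal functions used below run over a countable
    family of balls that contains, for every ball, a comparable larger one
    ([grid]); they are measurable, and the one that appears in the comparison
    is smaller than the maximal function of the statement
    ([multimax_le_maximal]). *)

(** * Measures with a density and Holder inequalities *)

Lemma eqle {disp} {T : porderType disp} (x y : T) : x = y -> (x <= y)%O.
Proof. by move=> ->. Qed.

Section density_measure.
Import HBNNSimple.
Context {d : measure_display} {X : measurableType d} {R : realType}.
Variables (mu : {measure set X -> \bar R}) (w : X -> R).
Hypothesis w0 : forall x, (0 <= w x)%R.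
Hypothesis mw : measurable_fun [set: X] w.
Let mwE : measurable_fun [set: X] (EFin \o w).
Proof. exact/measurable_EFinP. Qed.
Let wE0 x : 0 <= (w x)%:E. Proof. by rewrite lee_fin. Qed.

(** The proofs of nonnegativity and measurability are arguments of the set
    function so that its measure structure can be inferred. *)
Definition dens (w0' : forall x, (0 <= w x)%R) (mw' : measurable_fun [set: X] w)
  (A : set X) : \bar R := \int[mu]_(x in A) (w x)%:E.

Let dens0 : dens w0 mw set0 = 0. Proof. by rewrite /dens integral_set0. Qed.

Let dens_ge0 A : 0 <= dens w0 mw A. Proof. exact: integral_ge0. Qed.

Let dens_sigma_additive : semi_sigma_additive (dens w0 mw).
Proof.
move=> F mF tF mUF; rewrite /dens ge0_integral_bigcup//; last first.
  exact: measurable_funTS.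
by apply: is_cvg_nneseries => n _ _; exact: integral_ge0.
Qed.

HB.instance Definition _ := isMeasure.Build _ _ _ (dens w0 mw)
  dens0 dens_ge0 dens_sigma_additive.

(** Both sides agree on simple functions and pass to monotone limits. *)
Lemma integral_dens (D : set X) (f : X -> \bar R) : measurable D ->
  measurable_fun D f -> (forall x, D x -> 0 <= f x) ->
  \int[dens w0 mw]_(x in D) f x = \int[mu]_(x in D) (f x * (w x)%:E).
Proof.
move=> mD mf f0.
pose g := nnsfun_approx mD mf.
have cvg_g x : D x -> (g n x)%:E @[n --> \oo] --> f x.
  by move=> Dx; exact: cvg_nnsfun_approx.
have ndgx x : {homo (fun n => (g n x)%:E) : m n / (m <= n)%N >-> m <= n}.
  by move=> m n mn; rewrite lee_fin; exact/lefP/nd_nnsfun_approx.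
have step n : \int[dens w0 mw]_(x in D) (g n x)%:E =
              \int[mu]_(x in D) ((g n x)%:E * (w x)%:E).
  pose h r x : \bar R := (r * \1_(g n @^-1` [set r]) x)%:E.
  have h0 r x : 0 <= h r x by rewrite /h EFinM nnfun_muleindic_ge0.
  have mh r E : measurable_fun E (h r).
    by apply: measurable_funTS; exact/measurable_EFinP/measurableT_comp.
  have gE x : (g n x)%:E = \sum_(r \in range (g n)) h r x.
    by rewrite fimfunE -fsumEFin.
  under [LHS]eq_integral do rewrite gE.
  rewrite [LHS]ge0_integral_fsum//.
  under [RHS]eq_integral do rewrite gE ge0_mule_fsuml//.
  rewrite [RHS]ge0_integral_fsum//; last 2 first.
    - move=> r; apply: emeasurable_funM; last exact: measurable_funTS.
      exact: mh.
    - by move=> r x _; rewrite mule_ge0.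
  apply: eq_fsbigr => r _.
  have mgr : measurable (g n @^-1` [set r]) by exact: measurable_funPTI.
  rewrite /h; have -> : \int[dens w0 mw]_(x in D) (r * \1_(g n @^-1` [set r]) x)%:E =
         r%:E * dens w0 mw (g n @^-1` [set r] `&` D).
    by rewrite integralZl_indic_nnsfun// integral_indic.
  have [r0|r0] := leP 0%R r; last first.
    rewrite preimage_nnfun0// set0I measure0 mule0.
    by rewrite integral0_eq// => x _; rewrite indic0 mulr0 mul0e.
  under eq_integral do rewrite EFinM -muleA.
  rewrite ge0_integralZl//; last 2 first.
    - apply: emeasurable_funM; last exact: measurable_funTS.
      exact/measurable_EFinP.
    - by move=> x _; rewrite mule_ge0// lee_fin.
  congr (_ * _); rewrite /dens setIC integral_mkcondr.
  by apply: eq_integral => x _; rewrite epatch_indic/= muleC.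
have mgE n : measurable_fun D (fun x => (g n x)%:E).
  exact/measurable_EFinP/measurable_funTS.
have g0 n x : 0 <= (g n x)%:E by rewrite lee_fin.
have c1 := @cvg_monotone_convergence _ _ _ (dens w0 mw) D mD
  (fun n x => (g n x)%:E) mgE (fun n x _ => g0 n x) (fun x _ => ndgx x).
have mgw n : measurable_fun D (fun x => (g n x)%:E * (w x)%:E).
  by apply: emeasurable_funM => //; exact: measurable_funTS.
have gw0 n x : D x -> 0 <= (g n x)%:E * (w x)%:E by move=> _; rewrite mule_ge0.
have ndgw x : D x -> {homo (fun n => (g n x)%:E * (w x)%:E) : m n / (m <= n)%N >-> m <= n}.
  by move=> _ m n mn; apply: lee_wpmul2r => //; exact: ndgx.
have c2 := @cvg_monotone_convergence _ _ _ mu D mD _ mgw gw0 ndgw.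
transitivity (\int[dens w0 mw]_(x in D) limn (fun n => (g n x)%:E)).
  by apply: eq_integral => x /set_mem Dx; apply/esym/cvg_lim => //; exact: cvg_g.
transitivity (\int[mu]_(x in D) limn (fun n => (g n x)%:E * (w x)%:E)); last first.
  apply: eq_integral => x /set_mem Dx; apply/cvg_lim => //.
  by apply: cvgeZr => //; exact: cvg_g.
have stepE : (fun n => \int[dens w0 mw]_(x in D) (g n x)%:E) =
             (fun n => \int[mu]_(x in D) ((g n x)%:E * (w x)%:E)).
  by apply/funext => n; exact: step.
by apply: (cvg_unique _ c1) => //; rewrite stepE.
Qed.
End density_measure.

Lemma poweR_le {R : realType} (x y : \bar R) (a : R) : (0 <= a)%R -> 0 <= x ->
  x <= y -> x `^ a <= y `^ a.
Proof.
by move=> a0 x0 xy; apply: gt0_ler_poweR => //;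
  rewrite in_itv/= leey andbT// (le_trans x0).
Qed.

Section holder.
Context {d : measure_display} {X : measurableType d} {R : realType}.
Variable mu : {measure set X -> \bar R}.

Lemma holder_two (A : set X) (f g : X -> R) (a b : R) : measurable A ->
  measurable_fun [set: X] f -> measurable_fun [set: X] g ->
  (forall x, (0 <= f x)%R) -> (forall x, (0 <= g x)%R) ->
  (0 < a)%R -> (0 < b)%R -> (a + b = 1)%R ->
  \int[mu]_(x in A) (f x `^ a * g x `^ b)%:E <=
  (\int[mu]_(x in A) (f x)%:E) `^ a * (\int[mu]_(x in A) (g x)%:E) `^ b.
Proof.
move=> mA mf mg f0 g0 a0 b0 ab1.
pose F (h : X -> R) (c : R) x := ((h x * \1_A x) `^ c)%R.
have mF h c : measurable_fun [set: X] h -> measurable_fun [set: X] (F h c).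
  move=> mh; apply: (@measurableT_comp _ _ _ _ _ _ (fun x => x `^ c)%R) => //.
  by apply: measurable_funM => //; exact: measurable_indic.
have NF (h : X -> R) c : (forall x, (0 <= h x)%R) -> (0 < c)%R ->
    'N[mu]_((c^-1)%:E)[EFin \o F h c] = (\int[mu]_(x in A) (h x)%:E) `^ c.
  move=> h0 c0; rewrite unlock invrK; congr (_ `^ _).
  rewrite [RHS]integral_mkcond; apply: eq_integral => x _ /=.
  rewrite ger0_norm ?powR_ge0// -powRrM mulfV ?gt_eqF//.
  by rewrite powRr1 ?mulr_ge0// epatch_indic.
have := @hoelder _ _ _ mu (F f a) (F g b) a^-1 b^-1 (mF _ _ mf) (mF _ _ mg).
rewrite !invr_gt0 !invrK => /(_ a0 b0 ab1); rewrite !NF// => H.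
apply: le_trans H; rewrite Lnorm1 [leLHS]integral_mkcond.
apply: eqle; apply: eq_integral => x _ /=.
rewrite ger0_norm ?mulr_ge0 ?powR_ge0// /F epatch_indic/= indicE.
case: (x \in A); rewrite ?mulr1 ?mule1// mulr0 mule0 powR0 ?gt_eqF//.
by rewrite mul0r.
Qed.

(** Two applications of the inequality with two factors, the last two
    functions being first grouped with exponents [b / (b + c)] and
    [c / (b + c)]. *)
Lemma holder_three (A : set X) (f g h : X -> R) (a b c : R) : measurable A ->
  measurable_fun [set: X] f -> measurable_fun [set: X] g ->
  measurable_fun [set: X] h ->
  (forall x, (0 <= f x)%R) -> (forall x, (0 <= g x)%R) ->
  (forall x, (0 <= h x)%R) ->
  (0 < a)%R -> (0 < b)%R -> (0 < c)%R -> (a + b + c = 1)%R ->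
  \int[mu]_(x in A) (f x `^ a * g x `^ b * h x `^ c)%:E <=
  (\int[mu]_(x in A) (f x)%:E) `^ a * (\int[mu]_(x in A) (g x)%:E) `^ b
   * (\int[mu]_(x in A) (h x)%:E) `^ c.
Proof.
move=> mA mf mg mh f0 g0 h0 a0 b0 c0 abc1.
pose e : R := (b + c)%R.
have e0 : (0 < e)%R by rewrite addr_gt0.
pose k x := (g x `^ (b / e) * h x `^ (c / e))%R.
have mk : measurable_fun [set: X] k.
  by apply: measurable_funM;
    apply: (@measurableT_comp _ _ _ _ _ _ (fun x => x `^ _)%R).
have k0 x : (0 <= k x)%R by rewrite mulr_ge0 ?powR_ge0.
have kE x : (k x `^ e = g x `^ b * h x `^ c)%R.
  by rewrite powRM ?powR_ge0// -!powRrM !divfK ?gt_eqF.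
under eq_integral do rewrite -mulrA -kE.
apply: (le_trans (@holder_two A f k a e mA mf mk f0 k0 a0 e0 _)).
  by rewrite addrA.
rewrite -muleA; apply: lee_wpmul2l; first exact: poweR_ge0.
have bc1 : (b / e + c / e = 1)%R by rewrite -mulrDl divff ?gt_eqF.
have HI := @holder_two A g h _ _ mA mg mh g0 h0 (divr_gt0 b0 e0)
  (divr_gt0 c0 e0) bc1.
pose I := \int[mu]_(x in A) (k x)%:E.
have I0 : 0 <= I by apply: integral_ge0 => x _; rewrite lee_fin.
have : I `^ e <= ((\int[mu]_(x in A) (g x)%:E) `^ (b / e) *
   (\int[mu]_(x in A) (h x)%:E) `^ (c / e)) `^ e.
  by apply: poweR_le => //; exact: ltW.
by rewrite poweRM ?poweR_ge0// -!poweRrM !divfK ?gt_eqF.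
Qed.

End holder.

(** * Dyadic sums *)
Section dyadic.
Context {R : realType}.
Implicit Types (al c r : R) (F : \bar R).

Lemma nneseries_le (u : nat -> \bar R) (C : \bar R) : (forall k, 0 <= u k) ->
  (forall n, \sum_(0 <= k < n) u k <= C) -> \sum_(k <oo) u k <= C.
Proof.
move=> u0 uC; apply: lime_le; first exact: is_cvg_nneseries.
exact: nearW.
Qed.

Lemma nneseries_ge (u : nat -> \bar R) (k : nat) : (forall k, 0 <= u k) ->
  u k <= \sum_(k <oo) u k.
Proof.
move=> u0; apply: (@le_trans _ _ (\sum_(0 <= i < k.+1) u i)).
  by rewrite big_nat_recr//= leeDr// sume_ge0.
by apply: lime_ge; [exact: is_cvg_nneseries|exists k.+1 => // n /= kn;
  apply: lee_sum_nneg_natr].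
Qed.

Lemma geometric_le c r : (0 <= c)%R -> (0 <= r < 1)%R ->
  \sum_(k <oo) (c * r ^+ k)%:E <= (c / (1 - r))%:E.
Proof.
move=> c0 /andP[r0 r1]; apply: nneseries_le => [k|n].
  by rewrite lee_fin mulr_ge0// exprn_ge0.
rewrite sumEFin lee_fin -mulr_sumr ler_wpM2l//.
have r1' : (0 < 1 - r)%R by rewrite subr_gt0.
rewrite -div1r ler_pdivlMr//.
have -> : ((\sum_(0 <= i < n) r ^+ i) * (1 - r) = 1 - r ^+ n)%R.
  elim: n => [|n IH]; first by rewrite big_nil mul0r expr0 subrr.
  by rewrite big_nat_recr//= mulrDl IH exprS; ring.
by rewrite gerBl exprn_ge0.
Qed.

Lemma dyadic_bracket (x t0 : R) : (0 < t0)%R -> (t0 < x)%R ->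
  exists k, (2 ^+ k * t0 < x <= 2 ^+ k.+1 * t0)%R.
Proof.
move=> t00 tx.
have ex : exists n, (x <= 2 ^+ n * t0)%R.
  exists (Num.bound (x / t0)); rewrite -ler_pdivrMr//.
  apply: ltW; apply: (lt_le_trans (archi_boundP _)).
    by rewrite divr_ge0// ?ltW// (lt_trans t00).
  by rewrite -natrX ler_nat ltnW// ltn_expl.
case: (ex_minnP ex) => -[|k] xk mink.
  by move: xk; rewrite expr0 mul1r leNgt tx.
exists k; rewrite xk andbT ltNge; apply/negP => /mink.
by rewrite ltnn.
Qed.

(** For finite [F] the term of the largest [k] with [2 ^ k t0 < F] is already
    an upper bound, as then [F <= 2 ^ (k + 1) t0]. *)
Lemma dyadic_upper F (t0 : R) al : (0 < t0)%R -> (0 < al)%R -> t0%:E < F ->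
  F `^ al <= \sum_(k <oo) (((2 ^+ k.+1 * t0) `^ al)%:E *
                            (((2 ^+ k * t0)%:E < F)%E%:R : R)%:E).
Proof.
move=> t00 al0 tF.
pose u k : \bar R := (((2 ^+ k.+1 * t0) `^ al)%:E *
                            (((2 ^+ k * t0)%:E < F)%E%:R : R)%:E).
change (F `^ al <= \sum_(k <oo) u k).
have u0 k : 0 <= u k by rewrite mule_ge0// lee_fin ?powR_ge0.
case: F tF @u u0 => [x| |//] tx u u0.
  rewrite lte_fin in tx.
  have x0 : (0 <= x)%R by rewrite ltW// (lt_trans t00).
  have [k /andP[kx xk]] := dyadic_bracket t00 tx.
  apply: (le_trans _ (nneseries_ge k u0)).
  rewrite /u lte_fin kx mule1 poweR_EFin lee_fin ge0_ler_powR//; first exact: ltW.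
  by rewrite nnegrE (le_trans x0).
suff -> : \sum_(k <oo) u k = +oo by rewrite leey.
apply/eqyP => M M0.
pose x := (Num.max (M `^ al^-1) (2 * t0))%R.
have [|k /andP[_ xk]] := @dyadic_bracket x t0 t00.
  by rewrite /x lt_max [X in _ || X]ltr_pMl// ltr1n orbT.
apply: (le_trans _ (nneseries_ge k u0)).
rewrite /u ltry mule1 lee_fin.
have Mk : (M `^ al^-1 <= 2 ^+ k.+1 * t0)%R.
  by apply: le_trans xk; rewrite /x le_max lexx.
have -> : M = ((M `^ al^-1) `^ al)%R.
  by rewrite -powRrM mulVf ?gt_eqF// powRr1 ?ltW.
apply: ge0_ler_powR => //; first exact: ltW.
- by rewrite nnegrE powR_ge0.
- by rewrite nnegrE mulr_ge0 ?exprn_ge0 ?ltW.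
Qed.

Lemma geometric_sum_le (rho : R) n : (1 < rho)%R ->
  (\sum_(0 <= k < n.+1) rho ^+ k <= rho / (rho - 1) * rho ^+ n)%R.
Proof.
move=> r1; have r10 : (0 < rho - 1)%R by rewrite subr_gt0.
elim: n => [|n IH].
  by rewrite big_nat1 !expr0 mulr1 ler_pdivlMr// mul1r gerBl.
rewrite big_nat_recr//=; apply: (le_trans (lerD IH (lexx _))).
rewrite exprS; apply: eqle; field.
by rewrite gt_eqF.
Qed.

Lemma powR_dyadic k (t0 : R) al : (0 < t0)%R ->
  ((2 ^+ k * t0) `^ al = (2 `^ al) ^+ k * t0 `^ al)%R.
Proof.
move=> t00; rewrite powRM ?exprn_ge0 ?ltW//.
rewrite -(powR_mulrn k (powR_ge0 2 al)) -(powR_mulrn k (ler0n R 2)).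
by rewrite powRAC.
Qed.

Lemma powR2_gt1 al : (0 < al)%R -> (1 < 2 `^ al :> R)%R.
Proof. move=> al0; have := @gt0_ltr_powR R al al0 1%R 2%R.
by rewrite powR1; apply; rewrite ?nnegrE ?ltr1n. Qed.

Lemma powR2_lt1 al : (al < 0)%R -> (2 `^ al < 1 :> R)%R.
Proof.
by move=> al0; rewrite /powR pnatr_eq0/= expR_lt1 nmulr_rlt0// ln_gt0// ltr1n.
Qed.

(** A geometric sum of ratio larger than 1 is comparable to its last term. *)
Lemma dyadic_lower F (t0 : R) al : (0 < t0)%R -> (0 < al)%R -> 0 <= F ->
  \sum_(k <oo) (((2 ^+ k * t0) `^ al)%:E *
                 (((2 ^+ k * t0)%:E < F)%E%:R : R)%:E)
    <= (2 `^ al / (2 `^ al - 1))%:E * F `^ al.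
Proof.
move=> t00 al0 F0.
set C := (2 `^ al / (2 `^ al - 1))%R.
have rho1 : (1 < 2 `^ al :> R)%R by exact: powR2_gt1.
have C0 : (0 < C)%R by rewrite divr_gt0// ?subr_gt0// powR_gt0.
apply: nneseries_le => [k|n]; first by rewrite mule_ge0// lee_fin powR_ge0.
elim: n => [|n IH].
  by rewrite big_nil mule_ge0// ?poweR_ge0// lee_fin ltW.
rewrite big_nat_recr//=.
case: (ltP (2 ^+ n * t0)%:E F) => nF; last by rewrite mule0 adde0.
rewrite mule1.
apply: (@le_trans _ _ (\sum_(0 <= k < n.+1) ((2 ^+ k * t0) `^ al)%:E)).
  rewrite big_nat_recr//= leeD2r//; apply: lee_sum => k _.
  by rewrite -[leRHS]mule1 lee_pmul2l// ?lte_fin ?powR_gt0 ?mulr_gt0 ?exprn_gt0//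
    lee_fin; case: (_ < _).
apply: (@le_trans _ _ (C%:E * ((2 ^+ n * t0) `^ al)%:E)).
  rewrite sumEFin -EFinM lee_fin.
  under eq_bigr do rewrite powR_dyadic//.
  rewrite -mulr_suml powR_dyadic// mulrA ler_wpM2r ?powR_ge0//.
  exact: geometric_sum_le.
rewrite lee_pmul2l// -poweR_EFin; apply: poweR_le; [exact: ltW| |exact: ltW].
by rewrite lee_fin mulr_ge0// ?exprn_ge0// ltW.
Qed.
End dyadic.

(** * Layer cake estimates and Kolmogorov's inequality *)

(** Identities between powers of positive reals are reduced to linear algebra
    in the logarithms by writing the bases as exponentials. *)
Lemma powR_expR {R : realType} (y a : R) : (expR y `^ a = expR (a * y))%R.
Proof. by rewrite /powR gt_eqF ?expR_gt0// expRK. Qed.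

Lemma expR_ex {R : realType} (x : R) : (0 < x)%R -> exists y, x = expR y.
Proof. by move=> x0; exists (ln x); rewrite lnK. Qed.

Section layer_cake.
Context {d : measure_display} {X : measurableType d} {R : realType}.
Variable nu : {measure set X -> \bar R}.
Variable F : X -> \bar R.
Hypothesis mF : measurable_fun [set: X] F.

Lemma measurable_gt (t : R) : measurable [set x | t%:E < F x].
Proof.
rewrite -[X in measurable X]setTI.
exact: emeasurable_fun_o_infty.
Qed.

Lemma indic_gt (t : R) x : \1_[set x | t%:E < F x] x = ((t%:E < F x)%E%:R : R).
Proof. by rewrite indicE; congr (_%:R); rewrite mem_setE. Qed.

Lemma measurable_poweRF (al : R) D : measurable_fun D (fun x => F x `^ al).
Proof.
by apply: (measurableT_comp (@measurable_poweR R al)); exact: measurable_funTS.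
Qed.

Lemma layer_upper (t0 al : R) : (0 < t0)%R -> (0 < al)%R ->
  \int[nu]_(x in [set x | t0%:E < F x]) F x `^ al <=
  \sum_(k <oo) ((2 ^+ k.+1 * t0) `^ al)%:E * nu [set x | (2 ^+ k * t0)%:E < F x].
Proof.
move=> t00 al0.
pose u (k : nat) (x : X) : \bar R := ((2 ^+ k.+1 * t0) `^ al)%:E *
                 (\1_[set x | ((2 ^+ k * t0)%:E < F x)%E] x)%:E.
have u0 k x : 0 <= u k x by rewrite mule_ge0// lee_fin powR_ge0.
have mu k D : measurable_fun D (u k).
  apply: measurable_funTS; apply: measurable_funeM; apply/measurable_EFinP.
  exact/measurable_indic/measurable_gt.
have mD := measurable_gt t0.
apply: (@le_trans _ _ (\int[nu]_(x in [set x | t0%:E < F x]) \sum_(k <oo) u k x)).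
  apply: ge0_le_integral => //.
  - by move=> x _; exact: poweR_ge0.
  - exact: measurable_poweRF.
  - by apply: ge0_emeasurable_sum => // k x _ _.
  - move=> x Fx; apply: (le_trans (dyadic_upper t00 al0 Fx)).
    by under eq_eseriesr do rewrite -indic_gt.
rewrite integral_nneseries//; apply: lee_nneseries => k _.
  by move=> _; exact: integral_ge0.
rewrite /u ge0_integralZl ?lee_fin ?powR_ge0//; last first.
  by apply/measurable_EFinP/measurable_funTS/measurable_indic/measurable_gt.
rewrite lee_wpmul2l ?lee_fin ?powR_ge0// integral_indic//; last first.
  exact: measurable_gt.
by apply: le_measure; rewrite ?inE//; [apply: measurableI| ]; exact: measurable_gt.
Qed.

Lemma layer_lower (t0 al : R) : (0 < t0)%R -> (0 < al)%R ->
  (forall x, 0 <= F x) ->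
  \sum_(k <oo) ((2 ^+ k * t0) `^ al)%:E * nu [set x | (2 ^+ k * t0)%:E < F x] <=
  (2 `^ al / (2 `^ al - 1))%:E * \int[nu]_x F x `^ al.
Proof.
move=> t00 al0 F0.
pose u (k : nat) (x : X) : \bar R := ((2 ^+ k * t0) `^ al)%:E *
                 (\1_[set x | ((2 ^+ k * t0)%:E < F x)%E] x)%:E.
have u0 k x : 0 <= u k x by rewrite mule_ge0// lee_fin powR_ge0.
have mi k : measurable_fun [set: X] (EFin \o \1_[set x | ((2 ^+ k * t0)%:E < F x)%E]
    : _ -> \bar R).
  by apply/measurable_EFinP/measurable_indic/measurable_gt.
have mu k D : measurable_fun D (u k).
  by apply: measurable_funTS; apply: measurable_funeM; exact: mi.
have C0 : (0 <= 2 `^ al / (2 `^ al - 1) :> R)%R.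
  by rewrite divr_ge0 ?powR_ge0// subr_ge0 ltW// powR2_gt1.
rewrite -ge0_integralZl//; last 2 first.
- exact: measurable_poweRF.
- by move=> x _; exact: poweR_ge0.
apply: (@le_trans _ _ (\int[nu]_x \sum_(k <oo) u k x)).
  rewrite integral_nneseries//; apply: lee_nneseries => k _.
    by move=> _; rewrite mule_ge0// lee_fin powR_ge0.
  rewrite /u ge0_integralZl ?lee_fin ?powR_ge0//; last exact: mi.
  by rewrite integral_indic ?setIT//; exact: measurable_gt.
apply: ge0_le_integral => //.
- by move=> x _; exact: nneseries_ge0.
- by apply: ge0_emeasurable_sum => // k x _ _.
- by apply: measurable_funeM; exact: measurable_poweRF.
- move=> x _; apply: le_trans (dyadic_lower t00 al0 (F0 x)).
  by under [leRHS]eq_eseriesr do rewrite -indic_gt.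
Qed.

(** With [t0 = K / nu A], use [F <= t0] on one part of [A] and the weak type
    bound, summed over the dyadic levels above [t0], on the other. *)
Lemma kolmogorov (A : set X) (K th : R) : measurable A -> nu A < +oo ->
  (forall x, 0 <= F x) ->
  (0 < K)%R -> (0 < th < 1)%R ->
  (forall t : R, (0 < t)%R -> nu [set x | t%:E < F x] <= (K / t)%:E) ->
  \int[nu]_(x in A) F x `^ th <=
   ((1 + 2 `^ th / (1 - 2 `^ (th - 1))) * K `^ th)%:E * nu A `^ (1 - th).
Proof.
move=> mA Aoo F0 K0 /andP[th0 th1] weak.
have mp D : measurable_fun D (fun x => F x `^ th) by exact: measurable_poweRF.
set c2 : R := (2 `^ th / (1 - 2 `^ (th - 1)))%R.
have r1 : (2 `^ (th - 1) < 1 :> R)%R.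
  by apply: powR2_lt1; rewrite subr_lt0.
have c20 : (0 <= c2)%R by rewrite divr_ge0 ?powR_ge0// subr_ge0 ltW.
have [A0|A0] := eqVneq (nu A) 0.
  rewrite (null_set_integral mA (mp A) A0) mule_ge0 ?poweR_ge0// lee_fin.
  by rewrite mulr_ge0 ?powR_ge0// addr_ge0.
have [a nuA a0] : exists2 a : R, nu A = a%:E & (0 < a)%R.
  exists (fine (nu A)); rewrite ?fineK// ?ge0_fin_numE//.
  by rewrite fine_gt0// Aoo lt0e A0 measure_ge0.
pose t0 := (K / a)%R; have t00 : (0 < t0)%R by rewrite divr_gt0.
pose D := [set x | t0%:E < F x]; have mD : measurable D by exact: measurable_gt.
have Fth0 x : 0 <= F x `^ th by exact: poweR_ge0.
have mAD : measurable (A `\` D) by exact: measurableD.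
apply: (@le_trans _ _ (\int[nu]_(x in (A `\` D) `|` D) F x `^ th)).
  apply: ge0_subset_integral => //; first exact: measurableU.
  by move=> x Ax; case: (pselect (D x)) => Dx; [right|left].
rewrite ge0_integral_setU//; last first.
  by apply/disj_setPS => x [[_ ?]].
have step1 : \int[nu]_(x in A `\` D) F x `^ th <= (K `^ th * a `^ (1 - th))%:E.
  apply: (@le_trans _ _ (\int[nu]_(x in A `\` D) (t0 `^ th)%:E)).
    apply: ge0_le_integral => // x [Ax /negP].
    rewrite -leNgt => Fx; rewrite -poweR_EFin; apply: poweR_le => //.
    exact: ltW.
  rewrite integral_cst//; apply: (@le_trans _ _ ((t0 `^ th)%:E * nu A)).
    apply: lee_wpmul2l; first by rewrite lee_fin powR_ge0.
    by apply: le_measure; rewrite ?inE//; exact: subDsetl.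
  rewrite nuA -EFinM lee_fin /t0.
  have [k ->] := expR_ex K0; have [b ->] := expR_ex a0.
  rewrite -expRN -expRD !powR_expR -!expRD ler_expR.
  by apply: eqle; ring.
have step2 : \int[nu]_(x in D) F x `^ th <= (c2 * (K `^ th * a `^ (1 - th)))%:E.
  apply: (le_trans (layer_upper t00 th0)).
  pose c := (2 `^ th * (K `^ th * a `^ (1 - th)))%R.
  have -> : (c2 * (K `^ th * a `^ (1 - th)) = c / (1 - 2 `^ (th - 1)))%R.
    by rewrite /c2 /c; ring.
  apply: le_trans; last apply: geometric_le; last 2 first.
  - by rewrite /c !mulr_ge0// powR_ge0.
  - by rewrite r1 powR_ge0.
  apply: lee_nneseries => k _; first by rewrite mule_ge0 ?lee_fin ?powR_ge0.
  apply: (@le_trans _ _ (((2 ^+ k.+1 * t0) `^ th)%:E * (K / (2 ^+ k * t0))%:E)).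
    rewrite lee_wpmul2l ?lee_fin ?powR_ge0//; apply: weak.
    by rewrite mulr_gt0 ?exprn_gt0.
  rewrite -EFinM lee_fin /c /t0 -(powR_mulrn k (powR_ge0 _ _)).
  rewrite -!(powR_mulrn _ (ler0n R 2)) -[k.+1%:R]natr1.
  have [k' ->] := expR_ex K0; have [b ->] := expR_ex a0.
  have [l ->] := @expR_ex _ (2 : R) (ltr0n _ _).
  rewrite !powR_expR -!expRN -!expRD !powR_expR -!expRN -!expRD ler_expR.
  by apply: eqle; ring.
apply: (le_trans (leeD step1 step2)).
rewrite nuA poweR_EFin -EFinD -EFinM lee_fin.
by apply: eqle; rewrite -/c2; ring.
Qed.

End layer_cake.

(** * Geometry of the balls *)

(** The axiom [bb_B4] with its constant made explicit, since all later
    constants depend on it. *)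
Record enlargement {d : measure_display} {X : measurableType d} {R : realType}
  (mu : {measure set X -> \bar R}) (BB : set (set X)) (star : set X -> set X)
  (C0 : R) : Prop := {
  enl_ge1 : (1 <= C0)%R ;
  enl_ball : forall B, BB B -> BB (star B) ;
  enl_measure : forall B, BB B -> mu (star B) <= C0%:E * mu B ;
  enl_meets : forall B, BB B ->
    \bigcup_(B' in [set B' | [/\ BB B', B' `&` B !=set0 &
                                 mu B' <= 2%:E * mu B]]) B' `<=` star B ;
  enl_mono : forall A B, BB A -> BB B -> A `<=` B -> star A `<=` star B }.

Section geometry.
Context {d : measure_display} {X : measurableType d} {R : realType}.
Variables (mu : {measure set X -> \bar R}) (BB : set (set X)).
Variables (star : set X -> set X) (C0 : R).
Hypothesis hBB : ball_basis mu BB star.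
Hypothesis hE : enlargement mu BB star C0.
Implicit Types (A B : set X).

Lemma ball_pos B : BB B -> 0 < mu B.
Proof. by move=> /(bb_B1 hBB)/andP[]. Qed.

Lemma ball_fin B : BB B -> mu B < +oo.
Proof. by move=> /(bb_B1 hBB)/andP[]. Qed.

Lemma ball_fin_num B : BB B -> mu B \is a fin_num.
Proof. by move=> bB; rewrite ge0_fin_numE// ball_fin. Qed.

Lemma ball_fineE B : BB B -> exists2 b : R, (0 < b)%R & mu B = b%:E.
Proof.
move=> bB; exists (fine (mu B)); last by rewrite fineK// ball_fin_num.
by rewrite fine_gt0// ball_pos// ball_fin.
Qed.

Lemma ball_nonempty B : BB B -> B !=set0.
Proof.
move=> bB; apply/set0P/eqP => B0; have := ball_pos bB.
by rewrite B0 measure0 ltxx.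
Qed.

Lemma sub_star B B' : BB B -> BB B' -> B' `&` B !=set0 -> mu B' <= 2%:E * mu B ->
  B' `<=` star B.
Proof. by move=> bB bB' BB0 le2 x Bx; apply: (enl_meets hE bB); exists B'. Qed.

Lemma le_double B : mu B <= 2%:E * mu B.
Proof.
by rewrite -[leLHS]mul1e lee_wpmul2r// lee_fin ler1n.
Qed.

Lemma ball_star B : BB B -> B `<=` star B.
Proof.
by move=> bB; apply: sub_star => //; [rewrite setIid; exact: ball_nonempty|
  exact: le_double].
Qed.

(** Families of balls of bounded measure need not have a largest member; a
    member whose measure exceeds half of the supremum serves as well, because
    [star] absorbs the balls of at most twice the measure. *)
Lemma near_max (F : set (set X)) (M : \bar R) : F `<=` BB -> F !=set0 ->
  M < +oo -> (forall B, F B -> mu B <= M) ->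
  exists2 B, F B & forall B', F B' -> mu B' <= 2%:E * mu B.
Proof.
move=> FB [A FA] Moo FM; pose S := ereal_sup [set mu B | B in F].
have SM : S <= M by apply: ge_ereal_sup => _ [B FB' <-]; exact: FM.
have S0 : 0 < S.
  by apply: (lt_le_trans (ball_pos (FB _ FA))); apply: ereal_sup_ubound; exists A.
have [s sE s0] : exists2 s : R, S = s%:E & (0 < s)%R.
  exists (fine S); last by rewrite fine_gt0// S0 (le_lt_trans SM).
  by rewrite fineK// ge0_fin_numE ?(le_lt_trans SM)// ltW.
have : (s / 2)%:E < S by rewrite sE lte_fin ltr_pdivrMr// ltr_pMr// ltr1n.
move=> /ereal_sup_gt[_ [B FB' <-] sB]; exists B => // B' FB''.
apply: (@le_trans _ _ S); first by apply: ereal_sup_ubound; exists B'.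
rewrite sE (_ : s = 2 * (s / 2))%R; last by field.
by rewrite EFinM lee_wpmul2l// ltW.
Qed.

(** For each [n] take a nearly maximal ball among those that contain a base
    point and have measure at most [n].  Any ball containing the base point
    and [x] is eventually swallowed by the enlargement of these. *)
Lemma exhaustion : exists Q : nat -> set X,
  (forall n, BB (Q n)) /\ (forall x, exists N, forall n, (N <= n)%N -> Q n x).
Proof.
pose x0 : X := point.
have step (n : nat) : exists B, [/\ BB B, B x0 & forall B', BB B' -> B' x0 ->
    mu B' <= n%:R%:E -> mu B' <= 2%:E * mu B].
  pose F := [set B | [/\ BB B, B x0 & mu B <= n%:R%:E]].
  have [F0|F0] := pselect (F !=set0).
    have [|||B [bB Bx Bn] maxB] := @near_max F n%:R%:E _ F0.
    - by move=> B [].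
    - by rewrite ltry.
    - by move=> B [].
    by exists B; split => // B' bB' Bx' Bn'; apply: maxB; split.
  have [B [bB Bx _]] := bb_B2 hBB x0 x0.
  by exists B; split => // B' bB' Bx' Bn'; exfalso; apply: F0; exists B'; split.
have [Q hQ] := choice step.
exists (star \o Q); split => [n|x] /=; first by apply: (enl_ball hE); case: (hQ n).
have [B [bB Bx0 Bx]] := bb_B2 hBB x0 x.
have [b b0 bE] := ball_fineE bB.
exists (Num.bound b) => n bn; have [bQ Qx0 Qmax] := hQ n.
apply: (sub_star bQ bB) => //; first by exists x0.
apply: Qmax => //; rewrite bE lee_fin ltW// (lt_le_trans (archi_boundP _))//.
  exact: ltW.
by rewrite ler_nat.
Qed.

(** Zorn's lemma is applied to the disjoint subfamilies [G] with the property
    that every ball of [F] that meets [G] meets a member of [G] of at least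
    half its measure.  If some ball of [F] met no member of a maximal [G], a
    nearly maximal ball among those could be added to [G]. *)
Lemma vitali_family (F : set (set X)) (M : \bar R) : F `<=` BB ->
  M < +oo -> (forall B, F B -> mu B <= M) ->
  exists G : set (set X), [/\ G `<=` F, trivIset G id &
    forall B, F B -> exists2 B', G B' & B `&` B' !=set0 /\ mu B <= 2%:E * mu B'].
Proof.
move=> FB Moo FM.
pose good (G : set (set X)) := [/\ G `<=` F, trivIset G id &
  forall B, F B -> (exists2 B', G B' & B `&` B' !=set0) ->
   exists2 B', G B' & B `&` B' !=set0 /\ mu B <= 2%:E * mu B'].
have [|G [[GF tG GP] maxG]] := @Zorn_bigcup _ good.
  move=> C Cgood totC; split.
  - by move=> B [G CG GB]; have [GF _ _] := Cgood _ CG; exact: GF.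
  - move=> B B' [G CG GB] [G' CG' GB'].
    have [GG'|G'G] := totC _ _ CG CG'.
      by have [_ tG' _] := Cgood _ CG'; apply: tG' => //; exact: GG'.
    by have [_ tG _] := Cgood _ CG; apply: tG => //; exact: G'G.
  - move=> B FB' [B' [G CG GB'] BB'0]; have [_ _ GP] := Cgood _ CG.
    have [|B'' GB'' ?] := GP _ FB'; first by exists B'.
    by exists B'' => //; exists G.
exists G; split => // B FB'; apply: (GP) => //.
apply: contrapT => nB.
pose H := [set B | F B /\ ~ exists2 B', G B' & B `&` B' !=set0].
have [|||B0 [FB0 nB0] maxB0] := @near_max H M _ _ Moo.
- by move=> A [/FB].
- by exists B; split.
- by move=> A [/FM].
apply: (maxG (G `|` [set B0])).
  split; first by move=> A; left.
  move=> /(_ B0) => GB0; apply: nB0; exists B0; first by apply: GB0; right.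
  by rewrite setIid; apply: ball_nonempty; exact: FB.
split.
- by move=> A [/GF//|->].
- move=> A A' [GA|->] [GA'|->] //.
  + exact: tG.
  + by rewrite setIC => AB; exfalso; apply: nB0; exists A.
  + by move=> AB; exfalso; apply: nB0; exists A'.
- move=> A FA [A' GA' AA'].
  have [[A'' GA'' AA'']|nA] := pselect (exists2 B', G B' & A `&` B' !=set0).
    have [|E GE ?] := GP _ FA; first by exists A''.
    by exists E => //; left.
  case: GA' AA' => [GA'|-> AB0]; first by move=> AA'; exfalso; apply: nA; exists A'.
  by exists B0; [right|split => //; exact: maxB0].
Qed.

Lemma exists_meets_exhaustion (Q : nat -> set X) A : (forall n, BB (Q n)) ->
  (forall x, exists N, forall n, (N <= n)%N -> Q n x) -> measurable A ->
  0 < mu A -> exists n, 0 < mu (A `&` Q n).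
Proof.
move=> bQ exQ mA A0; apply: contrapT => /forallNP nA.
suff : mu A <= 0 by rewrite leNgt A0.
have mQ n : measurable (Q n) by exact: (bb_measurable hBB (bQ n)).
have AE : A `<=` \bigcup_n (A `&` Q n).
  by move=> x Ax; have [N HN] := exQ x; exists N => //; split=> //; exact: HN.
have mAQ n : measurable (A `&` Q n) by exact: measurableI.
apply: (le_trans (measure_sigma_subadditive mu mAQ mA AE)).
apply: nneseries_le => // N; rewrite big1// => n _; apply/eqP.
by rewrite eq_le measure_ge0 andbT leNgt; exact/negP.
Qed.

(** Only finitely many disjoint balls can meet a ball of an exhaustion in
    measure at least [1 / (k + 1)]. *)
Lemma countable_disjoint (G : set (set X)) : G `<=` BB -> trivIset G id ->
  countable G.
Proof.
move=> GB tG; have [Q [bQ exQ]] := exhaustion.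
have mQ n : measurable (Q n) by exact: (bb_measurable hBB (bQ n)).
pose H n k := [set B | G B /\ (k.+1%:R^-1)%:E < mu (B `&` Q n)].
have -> : G = \bigcup_n \bigcup_k H n k.
  apply/seteqP; split => [B GB'|B [n _ [k _ []]]//].
  have mB := bb_measurable hBB (GB _ GB').
  have [n Bn] := exists_meets_exhaustion bQ exQ mB (ball_pos (GB _ GB')).
  have fin : mu (B `&` Q n) \is a fin_num.
    rewrite ge0_fin_numE//; apply: le_lt_trans (ball_fin (bQ n)).
    by apply: le_measure; rewrite ?inE//; exact: measurableI.
  pose b := fine (mu (B `&` Q n)).
  have b0 : (0 < b)%R by rewrite fine_gt0// Bn ltey_eq fin.
  exists n => //; exists (Num.bound b^-1) => //; split => //.
  rewrite -(fineK fin) lte_fin -/b invf_plt ?posrE//.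
  apply: (lt_le_trans (archi_boundP _)); first by rewrite invr_ge0 ltW.
  by rewrite ler_nat.
apply: bigcup_countable => // n _; apply: bigcup_countable => // k _.
apply: finite_set_countable; apply: contrapT => /infiniteP/pcard_leP[f].
have Hf i : H n k (f i) by exact: (@funS _ _ _ _ f i I).
have mf i : measurable (f i `&` Q n).
  by apply: measurableI => //; apply: (bb_measurable hBB); apply: GB; case: (Hf i).
have tf : trivIset setT (fun i => f i `&` Q n).
  move=> i j _ _ [x [[fix_ _] [fjx _]]].
  have [Gi _] := Hf i; have [Gj _] := Hf j.
  have : f i = f j by apply: (tG _ _ Gi Gj); exists x.
  by move/(@inj _ _ _ f); apply; rewrite inE.
have [q q0 qE] := ball_fineE (bQ n).
have sumq N : (N%:R * k.+1%:R^-1 <= q)%R.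
  rewrite -lee_fin -qE.
  apply: (@le_trans _ _ (mu (\bigcup_i (f i `&` Q n)))); last first.
    apply: le_measure; rewrite ?inE//; first exact: bigcupT_measurable.
    by move=> x [i _ []].
  rewrite measure_semi_bigcup//; last exact: bigcupT_measurable.
  apply: (@le_trans _ _ (\sum_(0 <= i < N) mu (f i `&` Q n))).
    apply: (@le_trans _ _ (\sum_(0 <= i < N) (k.+1%:R^-1)%:E)).
      by rewrite sumEFin sumr_const_nat subn0 mulr_natl.
    by apply: lee_sum => i _; apply: ltW; case: (Hf i).
  apply: lime_ge; first exact: is_cvg_nneseries.
  by exists N => // M /= NM; exact: lee_sum_nneg_natr.
have k0 : (0 < k.+1%:R^-1 :> R)%R by rewrite invr_gt0.
have := sumq (Num.bound (q / k.+1%:R^-1)); rewrite -ler_pdivlMr// leNgt.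
by rewrite archi_boundP// divr_ge0 ?ltW.
Qed.

Lemma vitali (F : set (set X)) (M : \bar R) : F `<=` BB ->
  M < +oo -> (forall B, F B -> mu B <= M) ->
  exists (D : set nat) (B_ : nat -> set X),
    [/\ forall k, D k -> F (B_ k), trivIset D B_ &
    forall B, F B -> exists2 k, D k & B `&` B_ k !=set0 /\ mu B <= 2%:E * mu (B_ k)].
Proof.
move=> FB Moo FM; have [G [GF tG GP]] := vitali_family FB Moo FM.
have /countable_injP[f finj] : countable G.
  by apply: countable_disjoint => // B /GF/FB.
pose B_ k : set X := xget set0 [set B | G B /\ f B = k].
have BE B : G B -> B_ (f B) = B.
  move=> GB'; rewrite /B_; case: xgetP => [B' _ [GB'' fB]|/(_ B) nB].
    by apply: finj => //; rewrite inE.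
  by exfalso; apply: nB.
exists (f @` G), B_; split.
- by move=> _ [B GB' <-]; rewrite BE//; exact: GF.
- by move=> _ _ [B GB' <-] [B' GB'' <-]; rewrite !BE// => /(tG _ _ GB' GB'') ->.
- move=> B FB'; have [B' GB' ?] := GP _ FB'.
  by exists (f B'); [exists B'|rewrite BE].
Qed.

(** For each rational [a] take a countable Vitali family for the balls
    of measure in the interval from [a] to [2 a]; the enlargements of all these
    balls form the countable family. *)
Lemma grid : exists G : nat -> set X, (forall n, BB (G n)) /\
  forall B, BB B -> exists n, B `<=` G n /\ G n `<=` star (star B).
Proof.
pose F (a : rat) := [set B | [/\ BB B, (ratr a : R)%:E < mu B & mu B <= (2 * ratr a : R)%:E]].
have step a : exists DB : set nat * (nat -> set X),
    [/\ forall k, DB.1 k -> F a (DB.2 k), trivIset DB.1 DB.2 &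
    forall B, F a B -> exists2 k, DB.1 k & B `&` DB.2 k !=set0 /\ mu B <= 2%:E * mu (DB.2 k)].
  have [|||D [B_ HD]] := @vitali (F a) (2 * ratr a)%:E.
  - by move=> B [].
  - exact: ltry.
  - by move=> B [].
  by exists (D, B_).
have [DB HDB] := choice step.
have [Q [bQ _]] := exhaustion.
pose G n := if @unpickle (rat * nat)%type n is Some (a, k) then
  if pselect ((DB a).1 k) then star ((DB a).2 k) else Q 0%N else Q 0%N.
have bG n : BB (G n).
  rewrite /G; case: (@unpickle _ n) => [[a k]|]; last exact: bQ.
  case: pselect => Dk; last exact: bQ.
  by apply: (enl_ball hE); have [H _ _] := HDB a; case: (H _ Dk).
exists G; split => // B bB.
have [b b0 bE] := ball_fineE bB.
have [a ab] : exists a : rat, (b / 2 <= ratr a < b)%R.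
  have [|a] := @rat_in_itvoo R (b / 2) b; first by rewrite ltr_pdivrMr// ltr_pMr// ltr1n.
  by rewrite in_itv/= => /andP[ba ab]; exists a; rewrite ltW.
have [HF _ HP] := HDB a.
have [|k Dk [BBk Bk]] := HP B.
  case/andP: ab => ba ab; split => //; rewrite bE ?lte_fin// lee_fin.
  by rewrite mulrC -ler_pdivrMr.
have [bBk lk uk] := HF _ Dk.
exists (pickle (a, k)); rewrite /G pickleK; case: pselect => [Dk'|/(_ Dk)//] /=.
split; first exact: sub_star.
apply: (enl_mono hE) => //; first exact: (enl_ball hE).
apply: sub_star => //; first by rewrite setIC.
apply: (le_trans uk); rewrite EFinM lee_wpmul2l// bE lee_fin.
by case/andP: ab => _ /ltW.
Qed.

End geometry.

(** * The maximal function over a countable family of balls *)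
Record doubling {d : measure_display} {X : measurableType d} {R : realType}
  (BB : set (set X)) (star : set X -> set X) (nu : set X -> \bar R)
  (D : R) : Prop := {
  dbl_pos : forall B, BB B -> 0 < nu B < +oo ;
  dbl_le : forall B, BB B -> nu (star B) <= D%:E * nu B }.

Definition gmax {d : measure_display} {X : measurableType d} {R : realType}
  (G : nat -> set X) (nu : {measure set X -> \bar R}) (phi : X -> \bar R)
  (x : X) : \bar R :=
  ereal_sup (range (fun n => (\1_(G n) x)%:E * mean nu (G n) phi)).

Section measure_aux.
Context {d : measure_display} {X : measurableType d} {R : realType}.
Variable nu : {measure set X -> \bar R}.

Lemma meanE (B : set X) (b : R) (phi : X -> \bar R) : (0 < b)%R ->
  nu B = b%:E -> mean nu B phi = (b^-1)%:E * \int[nu]_(x in B) phi x.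
Proof. by move=> b0 bE; rewrite /mean bE inver gt_eqF. Qed.

Lemma mean_ge0 (B : set X) (phi : X -> \bar R) : (forall x, 0 <= phi x) ->
  0 <= mean nu B phi.
Proof. by move=> phi0; rewrite mule_ge0 ?inve_ge0// integral_ge0. Qed.

Lemma measure_bigcup_limit (B_ : nat -> set X) (P : set nat) (C : \bar R) :
  (forall k, P k -> measurable (B_ k)) ->
  (forall N, nu (\bigcup_(k in P `&` `I_N) B_ k) <= C) ->
  nu (\bigcup_(k in P) B_ k) <= C.
Proof.
move=> mB HC; pose U N := \bigcup_(k in P `&` `I_N) B_ k.
have UE : \bigcup_(k in P) B_ k = \bigcup_N U N.
  apply/seteqP; split => [x [k Pk Bx]|x [N _ [k [Pk _] Bx]]]; last by exists k.
  by exists k.+1 => //; exists k => //; split => //=.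
have mU N : measurable (U N).
  by apply: bigcup_measurable => k [Pk _]; exact: mB.
have ndU : {homo U : n m / (n <= m)%N >-> (n <= m)%O}.
  move=> n m nm; apply/subsetPset => x [k [Pk kn] Bx]; exists k => //.
  by split => //; exact: leq_trans nm.
have := nondecreasing_cvg_mu (mu := nu) mU (bigcupT_measurable _ mU) ndU.
rewrite -UE => cvgU; rewrite -(cvg_lim _ cvgU)//.
apply: lime_le; first by apply/cvg_ex; exists (nu (\bigcup_(k in P) B_ k)).
by apply: nearW => N; exact: HC.
Qed.

End measure_aux.

Section maximal_function.
Context {d : measure_display} {X : measurableType d} {R : realType}.
Variables (mu : {measure set X -> \bar R}) (BB : set (set X)).
Variables (star : set X -> set X) (C0 : R).
Hypothesis hBB : ball_basis mu BB star.
Hypothesis hE : enlargement mu BB star C0.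

(** A finite subfamily has a disjoint Vitali subfamily whose enlargements
    cover it; the doubling condition and the disjointness then give the
    bound. *)
Lemma covering (nu : {measure set X -> \bar R}) (D : R) (psi : X -> \bar R)
    (B_ : nat -> set X) (P : set nat) :
  doubling BB star nu D -> (0 <= D)%R ->
  measurable_fun [set: X] psi -> (forall x, 0 <= psi x) ->
  (forall k, P k -> BB (B_ k)) ->
  (forall k, P k -> nu (B_ k) <= \int[nu]_(x in B_ k) psi x) ->
  nu (\bigcup_(k in P) B_ k) <= D%:E * \int[nu]_x psi x.
Proof.
move=> dbl D0 mpsi psi0 PB Pnu.
apply: measure_bigcup_limit => [k /PB|N]; first exact: (bb_measurable hBB).
pose F := [set B | exists2 k, (P `&` `I_N) k & B = B_ k].
pose M := \sum_(0 <= k < N | `[< P k >]) mu (B_ k).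
have FB : F `<=` BB by move=> _ [k [Pk _] ->]; exact: PB.
have [||D' [C_ [DF tC FC]]] := vitali hBB hE (F := F) (M := M) FB.
- rewrite /M; elim/big_ind: _ => // [x y|k /asboolP Pk]; first exact: lte_add_pinfty.
  exact: (ball_fin hBB (PB _ Pk)).
- move=> _ [k [Pk kN] ->]; rewrite /M (big_rem k)/=; last by rewrite mem_index_iota.
  by rewrite asboolT// leeDl// sume_ge0.
pose C' j := if `[< D' j >] then C_ j else set0.
have mC' j : measurable (C' j).
  by rewrite /C'; case: asboolP => // /DF/FB/(bb_measurable hBB).
have mS j : measurable (if `[< D' j >] then star (C_ j) else set0).
  by case: asboolP => // /DF/FB/(enl_ball hE)/(bb_measurable hBB).
have tC' : trivIset setT C'.
  move=> i j _ _; rewrite /C'; case: asboolP => Di; case: asboolP => Dj.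
  - exact: tC.
  - by rewrite setI0 => -[].
  - by rewrite set0I => -[].
  - by rewrite set0I => -[].
have mU : measurable (\bigcup_(k in P `&` `I_N) B_ k).
  by apply: bigcup_measurable => k [/PB /(bb_measurable hBB)].
have sub : \bigcup_(k in P `&` `I_N) B_ k `<=`
    \bigcup_j (if `[< D' j >] then star (C_ j) else set0).
  move=> x [k Pk Bx]; have [|j Dj [BC le2]] := FC (B_ k); first by exists k.
  have FBk : F (B_ k) by exists k.
  exists j => //; rewrite asboolT//.
  by apply: (sub_star hE (FB _ (DF _ Dj)) (FB _ FBk)).
apply: (le_trans (measure_sigma_subadditive nu mS mU sub)).
apply: (@le_trans _ _ (\sum_(j <oo) D%:E * \int[nu]_(x in C' j) psi x)).
  apply: lee_nneseries => j _; first by [].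
  rewrite /C'; case: asboolP => Dj /=; last by rewrite measure0 integral_set0 mule0.
  apply: (le_trans (dbl_le dbl (FB _ (DF _ Dj)))); apply: lee_wpmul2l => //.
  by have [k [Pk _] ->] := DF _ Dj; exact: Pnu.
rewrite nneseriesZl; last by move=> j _; exact: integral_ge0.
rewrite lee_wpmul2l// -ge0_integral_bigcup//; last exact: measurable_funTS.
by apply: ge0_subset_integral => //; exact: bigcupT_measurable.
Qed.

Variable G : nat -> set X.
Hypothesis bG : forall n, BB (G n).
Hypothesis hG : forall B, BB B -> exists n, B `<=` G n /\ G n `<=` star (star B).

Let mG n : measurable (G n). Proof. exact: (bb_measurable hBB). Qed.

Section nu.
Variables (nu : {measure set X -> \bar R}) (D : R).
Hypothesis D0 : (0 <= D)%R.
Hypothesis dbl : doubling BB star nu D.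

Let nuE B : BB B -> exists2 b : R, (0 < b)%R & nu B = b%:E.
Proof.
move=> bB; have /andP[B0 Boo] := dbl_pos dbl bB.
exists (fine (nu B)); first by rewrite fine_gt0// B0.
by rewrite fineK// ge0_fin_numE.
Qed.

Lemma gmax_ge0 phi x : (forall x, 0 <= phi x) -> 0 <= gmax G nu phi x.
Proof.
move=> phi0; apply: (@le_trans _ _ ((\1_(G 0%N) x)%:E * mean nu (G 0%N) phi)).
  by rewrite mule_ge0 ?mean_ge0// lee_fin.
by apply: ereal_sup_ubound; exists 0%N.
Qed.

Lemma gmax_ge phi x n : G n x -> mean nu (G n) phi <= gmax G nu phi x.
Proof.
move=> Gx; apply: ereal_sup_ubound; exists n => //.
by rewrite indicE mem_set// mul1e.
Qed.

Lemma gmax_le phi x c : 0 <= c ->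
  (forall n, G n x -> mean nu (G n) phi <= c) -> gmax G nu phi x <= c.
Proof.
move=> c0 H; apply: ge_ereal_sup => _ [n _ <-]; rewrite indicE.
have [Gx|nGx] := pselect (G n x); first by rewrite mem_set// mul1e; exact: H.
by rewrite memNset// mul0e.
Qed.

Lemma measurable_gmax phi : measurable_fun [set: X] (gmax G nu phi).
Proof.
rewrite (_ : gmax G nu phi = fun x => esups
    (fun n => (\1_(G n) x)%:E * mean nu (G n) phi) 0%N).
  apply: measurable_fun_esups => n; apply: emeasurable_funM => //.
  by apply/measurable_EFinP; exact: measurable_indic.
apply/funext => x; rewrite /gmax /esups /sdrop/=; congr ereal_sup.
by apply/seteqP; split => _ [n _ <-]; exists n.
Qed.

Lemma gmax_gtE phi (t : R) : (0 < t)%R -> [set x | t%:E < gmax G nu phi x] =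
  \bigcup_(n in [set n | t%:E < mean nu (G n) phi]) G n.
Proof.
move=> t0; apply/seteqP; split => [x /ereal_sup_gt[_ [n _ <-]]|x [n /= tn Gx]].
  rewrite indicE; have [Gx|nGx] := pselect (G n x).
    by rewrite mem_set// mul1e => tn; exists n.
  by rewrite memNset// mul0e lte_fin ltNge ltW.
exact: (lt_le_trans tn (gmax_ge _ _)).
Qed.

Lemma gmax_weak phi (t : R) : measurable_fun [set: X] phi ->
  (forall x, 0 <= phi x) -> (0 < t)%R ->
  nu [set x | t%:E < gmax G nu phi x] <= (D / t)%:E * \int[nu]_x phi x.
Proof.
move=> mphi phi0 t0; rewrite gmax_gtE//.
apply: (@le_trans _ _ (D%:E * \int[nu]_x (t^-1%:E * phi x))).
  apply: covering => //.
  - exact: measurable_funeM.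
  - by move=> x; rewrite mule_ge0// lee_fin invr_ge0 ltW.
  - move=> n /= tn; have [b b0 bE] := nuE (bG n).
    rewrite ge0_integralZl//; last 2 first.
    + exact: measurable_funTS.
    + by rewrite lee_fin invr_ge0 ltW.
    move: tn; rewrite (meanE _ b0 bE) bE => /ltW.
    rewrite lee_pdivlMl// lee_pdivlMl// -!EFinM mulrC//.
rewrite ge0_integralZl//; last by rewrite lee_fin invr_ge0 ltW.
by rewrite muleA -EFinM.
Qed.

End nu.
End maximal_function.

(** * Strong type bounds for the maximal function *)
Lemma measurable_ltR {d} {X : measurableType d} {R : realType} (phi : X -> R)
    (t : R) : measurable_fun [set: X] phi ->
  measurable_fun [set: X] (fun x => ((t < phi x)%R%:R : R)).
Proof.
move=> mphi; rewrite (_ : (fun x => _) = \1_[set x | (t%:E < (phi x)%:E)%E]).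
  apply: measurable_indic; apply: (@measurable_gt _ _ _ (EFin \o phi)).
  exact/measurable_EFinP.
by apply/funext => x; rewrite (indic_gt (EFin \o phi)) /= lte_fin.
Qed.

Section maximal_bounds.
Context {d : measure_display} {X : measurableType d} {R : realType}.
Variables (mu : {measure set X -> \bar R}) (BB : set (set X)).
Variables (star : set X -> set X) (C0 : R).
Hypothesis hBB : ball_basis mu BB star.
Hypothesis hE : enlargement mu BB star C0.
Variable G : nat -> set X.
Hypothesis bG : forall n, BB (G n).
Hypothesis hG : forall B, BB B -> exists n, B `<=` G n /\ G n `<=` star (star B).

Let mG n : measurable (G n). Proof. exact: (bb_measurable hBB). Qed.

Section strong.
Variables (nu : {measure set X -> \bar R}) (D : R).
Hypothesis D0 : (0 <= D)%R.
Hypothesis dbl : doubling BB star nu D.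

(** On a ball where the mean of [phi] exceeds [2 t], the mean of the part of
    [phi] above [t] exceeds [t]; the weak type bound applies to that part. *)
Lemma gmax_truncation (phi : X -> R) (t : R) : measurable_fun [set: X] phi ->
  (forall x, (0 <= phi x)%R) -> (0 < t)%R ->
  nu [set x | (2 * t)%:E < gmax G nu (EFin \o phi) x] <=
  (D / t)%:E * \int[nu]_x (phi x * ((t < phi x)%R%:R : R))%:E.
Proof.
move=> mphi phi0 t0; set psi := fun x => (phi x * _)%:E.
have mpsi : measurable_fun [set: X] psi.
  apply/measurable_EFinP; apply: measurable_funM => //.
  exact: measurable_ltR.
have psi0 x : 0 <= psi x by rewrite lee_fin mulr_ge0.
apply: le_trans (gmax_weak hBB hE bG D0 dbl mpsi psi0 t0).
apply: le_measure; rewrite ?inE.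
- exact/measurable_gt/(measurable_gmax hBB bG).
- exact/measurable_gt/(measurable_gmax hBB bG).
rewrite !gmax_gtE// ?mulr_gt0// => x [n /= tn Gx]; exists n => //=.
have /andP[n0 noo] := dbl_pos dbl (bG n).
have nfin : nu (G n) \is a fin_num by rewrite ge0_fin_numE.
pose b := fine (nu (G n)); have b0 : (0 < b)%R by rewrite fine_gt0// n0.
have bE : nu (G n) = b%:E by rewrite fineK.
move: tn; rewrite !(meanE _ b0 bE) !lte_pdivlMl//.
have mphiE : measurable_fun (G n) (EFin \o phi).
  by apply/measurable_EFinP/measurable_funTS.
have : \int[nu]_(x in G n) (phi x)%:E <= \int[nu]_(x in G n) psi x + (b * t)%:E.
  have -> : (b * t)%:E = \int[nu]_(x in G n) t%:E.
    by rewrite integral_cst// bE -EFinM mulrC.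
  rewrite -ge0_integralD//; last 2 first.
  - exact: measurable_funTS.
  - by move=> y _; rewrite lee_fin ltW.
  apply: ge0_le_integral => //.
  - by move=> y _; rewrite lee_fin.
  - apply: emeasurable_funD => //; exact: measurable_funTS.
  - move=> y _; rewrite /psi -EFinD lee_fin; case: ltP => ty.
      by rewrite mulr1 lerDl ltW.
    by rewrite mulr0 add0r.
move=> H /lt_le_trans => /(_ _ H).
rewrite -!EFinM (_ : (b * (2 * t) = b * t + b * t)%R); last by ring.
by rewrite EFinD lteD2rE.
Qed.

(** Marcinkiewicz interpolation with [L ^ oo], through dyadic layers: the
    level sets of the maximal function are estimated by the truncations of
    [phi] at half the level, and the resulting sum of truncations is a
    geometric sum of order [phi ^ Q]. *)
Lemma gmax_strong (phi : X -> R) (Q : R) : measurable_fun [set: X] phi ->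
  (forall x, (0 <= phi x)%R) -> (1 < Q)%R ->
  \int[nu]_x gmax G nu (EFin \o phi) x `^ Q <=
  (4 `^ Q * D * (2 `^ (Q - 1) / (2 `^ (Q - 1) - 1)))%:E
    * \int[nu]_x (phi x `^ Q)%:E.
Proof.
move=> mphi phi0 Q1; have Q0 : (0 < Q)%R by exact: lt_trans Q1.
have Q10 : (0 < Q - 1)%R by rewrite subr_gt0.
pose M := gmax G nu (EFin \o phi).
have mM : measurable_fun [set: X] M by exact: (measurable_gmax hBB bG).
have M0 x : 0 <= M x by apply: gmax_ge0 => y; rewrite lee_fin.
set c := (2 `^ (Q - 1) / (2 `^ (Q - 1) - 1))%R.
have c0 : (0 <= c)%R.
  by rewrite divr_ge0 ?powR_ge0// subr_ge0 ltW// powR2_gt1.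
have C0' : (0 <= 4 `^ Q * D)%R by rewrite mulr_ge0// powR_ge0.
have trunc (t0 : R) : (0 < t0)%R -> \int[nu]_(x in [set x | t0%:E < M x]) M x `^ Q <=
    (4 `^ Q * D * c)%:E * \int[nu]_x (phi x `^ Q)%:E.
  move=> t00; apply: (le_trans (layer_upper nu mM t00 Q0)).
  pose s0 := (t0 / 2)%R; have s00 : (0 < s0)%R by rewrite divr_gt0.
  pose u (k : nat) (x : X) : \bar R := (((2 ^+ k * s0) `^ (Q - 1))%:E *
                (phi x * ((2 ^+ k * s0 < phi x)%R%:R : R))%:E).
  have u0 k x : 0 <= u k x by rewrite mule_ge0// lee_fin ?powR_ge0// mulr_ge0.
  have mind k : measurable_fun [set: X]
     (fun x => (phi x * ((2 ^+ k * s0 < phi x)%R%:R : R))%:E).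
    apply/measurable_EFinP; apply: measurable_funM => //.
    exact: measurable_ltR.
  have mu_ k : measurable_fun [set: X] (u k) by apply: measurable_funeM.
  have phiQ0 x : 0 <= (phi x `^ Q)%:E by rewrite lee_fin powR_ge0.
  have mphiQ : measurable_fun [set: X] (fun x => (phi x `^ Q)%:E).
    apply/measurable_EFinP.
    exact: (@measurableT_comp _ _ _ _ _ _ (fun x => x `^ Q)%R).
  rewrite EFinM -muleA.
  apply: (@le_trans _ _ ((4 `^ Q * D)%:E * \int[nu]_x \sum_(k <oo) u k x)); last first.
    rewrite lee_wpmul2l// -ge0_integralZl//.
    apply: ge0_le_integral => //.
    - by move=> x _; exact: nneseries_ge0.
    - by apply: ge0_emeasurable_sum => // k x _ _.
    - exact: measurable_funeM.
    - move=> x _.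
      have -> : \sum_(k <oo) u k x = (phi x)%:E * \sum_(k <oo)
          (((2 ^+ k * s0) `^ (Q - 1))%:E *
            (((2 ^+ k * s0)%:E < (phi x)%:E)%E%:R : R)%:E).
        rewrite -nneseriesZl; last by move=> k _; rewrite mule_ge0// lee_fin powR_ge0.
        by apply: eq_eseriesr => k _; rewrite /u lte_fin EFinM muleCA.
      apply: (@le_trans _ _ ((phi x)%:E * (c%:E * (phi x)%:E `^ (Q - 1)))).
        by rewrite lee_wpmul2l ?lee_fin//; apply: dyadic_lower => //; rewrite lee_fin.
      by rewrite poweR_EFin -!EFinM lee_fin mulrCA mulr_powRB1.
  rewrite integral_nneseries// -nneseriesZl; last by move=> k _; exact: integral_ge0.
  apply: lee_nneseries => k _; first by rewrite mule_ge0// lee_fin powR_ge0.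
  rewrite /u ge0_integralZl//; last 2 first.
  - by move=> x _; rewrite lee_fin mulr_ge0.
  - by rewrite lee_fin powR_ge0.
  have k0 : (0 < 2 ^+ k * s0)%R by rewrite mulr_gt0 ?exprn_gt0.
  have := gmax_truncation mphi phi0 k0.
  rewrite (_ : 2 * (2 ^+ k * s0) = 2 ^+ k * t0)%R; last by rewrite /s0; field.
  move=> /(lee_wpmul2l (x := ((2 ^+ k.+1 * t0) `^ Q)%:E)) => /(_ _)/le_trans; apply.
    by rewrite lee_fin powR_ge0.
  rewrite !muleA -!EFinM lee_wpmul2r//.
    by apply: integral_ge0 => x _; rewrite lee_fin mulr_ge0.
  rewrite lee_fin (_ : 2 ^+ k.+1 * t0 = 4 * (2 ^+ k * s0))%R; last first.
    by rewrite /s0 exprS; field.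
  move: k0; set y := (2 ^+ k * s0)%R => y0.
  rewrite powRM ?(ltW y0)// -(mulr_powRB1 (ltW y0) Q0).
  apply: eqle; field.
  by rewrite gt_eqF.
pose S (n : nat) := [set x | (n.+1%:R^-1)%:E < M x].
have mS n : measurable (S n) by exact: measurable_gt.
have ndS : nondecreasing_seq S.
  move=> n m nm; apply/subsetPset => x /=; apply: le_lt_trans.
  by rewrite lee_fin lef_pV2 ?posrE// ler_nat.
have MQ0 x : 0 <= M x `^ Q by exact: poweR_ge0.
have mMQ E : measurable_fun E (fun x => M x `^ Q) by exact: measurable_poweRF.
have cvg := @ge0_nondecreasing_set_cvg_integral _ _ _ S (fun x => M x `^ Q) nu
  ndS mS (fun i => mMQ _) (fun i x _ => MQ0 x).
have -> : \int[nu]_x M x `^ Q = \int[nu]_(x in \bigcup_n S n) M x `^ Q.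
  rewrite [RHS]integral_mkcond; apply: eq_integral => x _; rewrite patchE.
  case: ifPn => // /negP nS; have /eqP -> : M x == 0.
    rewrite eq_le M0 andbT leNgt; apply/negP => Mx; apply: nS; rewrite inE.
    have [n nM] : exists n : nat, (n.+1%:R^-1)%:E < M x.
      case: (M x) Mx => [y y0| _|//]; last by exists 0%N; rewrite ltry.
      exists (Num.bound y^-1); rewrite lte_fin invf_plt ?posrE//.
      apply: (lt_le_trans (archi_boundP _)); first by rewrite invr_ge0 ltW.
      by rewrite ler_nat.
    by exists n.
  by rewrite poweR0r// gt_eqF.
rewrite -(cvg_lim _ cvg)//; apply: lime_le; first by apply/cvg_ex; eexists; exact: cvg.
by apply: nearW => n; apply: trunc; rewrite invr_gt0.
Qed.
End strong.
End maximal_bounds.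

(** * Density points and the theorem of Coifman and Rochberg *)
Section coifman_rochberg.
Context {d : measure_display} {X : measurableType d} {R : realType}.
Variables (mu : {measure set X -> \bar R}) (BB : set (set X)).
Variables (star : set X -> set X) (C0 : R).
Hypothesis hBB : ball_basis mu BB star.
Hypothesis hE : enlargement mu BB star C0.

Let C00 : (0 < C0)%R. Proof. exact: lt_le_trans (enl_ge1 hE). Qed.

Lemma doubling_base : doubling BB star mu C0.
Proof. by split; [exact: (bb_B1 hBB)|exact: (enl_measure hE)]. Qed.

(** If all balls met [E] in at most half of their measure, then approximating
    [E] by a union [U] of balls up to an error [e], the covering lemma would
    bound [mu U] by a multiple of the measure of [U] minus [E], hence of [e],
    and [mu E] would vanish. *)
Lemma density_ball (E : set X) : measurable E -> 0 < mu E ->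
  exists2 B, BB B & mu B < 2%:E * mu (B `&` E).
Proof.
move=> mE E0; apply: contrapT => nB.
have HB B : BB B -> mu B <= 2%:E * mu (B `\` E).
  move=> bB; have mB := bb_measurable hBB bB.
  have mBE : measurable (B `&` E) by exact: measurableI.
  have mBD : measurable (B `\` E) by exact: measurableD.
  have [b b0 bE] := ball_fineE hBB bB.
  have Bsplit : mu B = mu (B `\` E) + mu (B `&` E).
    by rewrite -measureU// ?setDUK//; [rewrite setUC setUIDK|apply/seteqP; split=> x // [[? ?] [? ?]]].
  have le1 : mu (B `&` E) <= b%:E.
    by rewrite -bE; apply: le_measure; rewrite ?inE.
  have le2 : mu (B `\` E) <= b%:E.
    by rewrite -bE; apply: le_measure; rewrite ?inE.
  have : ~ (mu B < 2%:E * mu (B `&` E)) by move=> H; apply: nB; exists B.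
  move/negP; rewrite -leNgt; move: Bsplit le1 le2; rewrite bE.
  have := measure_ge0 mu (B `&` E); have := measure_ge0 mu (B `\` E).
  case: (mu (B `&` E)) => [i| |] //; case: (mu (B `\` E)) => [j| |] //.
  rewrite -EFinD -!EFinM !lee_fin => j0 i0 [->] ? ?; lra.
suff : mu E <= 0 by rewrite leNgt E0.
apply/lee_addgt0Pr => e e0; rewrite add0e.
pose k : R := (1 + 2 * C0)%R; have k0 : (0 < k)%R by rewrite addr_gt0// mulr_gt0.
have [D [B_ [DB /ltW mue]]] := bb_B3 hBB (divr_gt0 e0 k0) mE.
pose U := \bigcup_(j in D) B_ j.
have mU : measurable U.
  by apply: bigcup_measurable => j /DB /(bb_measurable hBB).
have mUE : measurable (U `\` E) by exact: measurableD.
have mEU : measurable (E `\` U) by exact: measurableD.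
have mY : measurable (E `+` U) by exact: measurableU.
pose psi x : \bar R := 2%:E * (\1_(U `\` E) x)%:E.
have mpsi : measurable_fun [set: X] psi.
  apply: measurable_funeM; apply/measurable_EFinP; exact: measurable_indic.
have psi0 x : 0 <= psi x by rewrite mule_ge0.
have Ipsi A : measurable A -> \int[mu]_(x in A) psi x = 2%:E * mu ((U `\` E) `&` A).
  move=> mA; rewrite ge0_integralZl//; first by rewrite integral_indic.
  by apply/measurable_EFinP/measurable_funTS; exact: measurable_indic.
have HU := @covering _ _ _ _ _ _ _ hBB hE mu C0 psi B_ D doubling_base
   (ltW C00) mpsi psi0 DB.
have muU : mu U <= (C0 * (2 * (e / k)))%:E.
  apply: le_trans (HU _) _ => [j Dj|].
    have mj := bb_measurable hBB (DB _ Dj).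
    rewrite Ipsi//; apply: (le_trans (HB _ (DB _ Dj))); rewrite lee_wpmul2l//.
    apply: le_measure; rewrite ?inE//; [exact: measurableD|exact: measurableI|].
    by move=> x [Bx nEx]; split => //; split => //; exists j.
  rewrite Ipsi// setIT !EFinM lee_wpmul2l ?lee_fin ?(ltW C00)// lee_wpmul2l//.
  apply: le_trans mue; apply: le_measure; rewrite ?inE//.
  by move=> x [? ?]; right.
apply: (@le_trans _ _ (mu (E `\` U) + mu U)).
  rewrite -measureU//.
    apply: le_measure; rewrite ?inE//; first exact: measurableU.
    by move=> x Ex; case: (pselect (U x)) => Ux; [right|left].
  by apply/seteqP; split => x // [[]].
have le1 : mu (E `\` U) <= (e / k)%:E.
  apply: le_trans mue; apply: le_measure; rewrite ?inE//.
  by move=> x [? ?]; left.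
apply: (le_trans (leeD le1 muU)); rewrite -EFinD lee_fin.
by apply: eqle; rewrite /k; field; rewrite gt_eqF.
Qed.

Lemma mean_sub (A B : set X) (K : R) (phi : X -> \bar R) : BB A -> BB B ->
  A `<=` B -> mu B <= K%:E * mu A -> measurable_fun [set: X] phi ->
  (forall x, 0 <= phi x) -> mean mu A phi <= K%:E * mean mu B phi.
Proof.
move=> bA bB AB; have [a a0 aE] := ball_fineE hBB bA.
have [b b0 bE] := ball_fineE hBB bB.
rewrite aE bE -EFinM lee_fin => bKa mphi phi0.
rewrite (meanE _ a0 aE) (meanE _ b0 bE) lee_pdivrMl// !muleA -!EFinM.
have le1 : \int[mu]_(x in A) phi x <= \int[mu]_(x in B) phi x.
  apply: ge0_subset_integral => //; try exact: (bb_measurable hBB).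
  exact: measurable_funTS.
apply: (le_trans le1); rewrite -[leLHS]mul1e lee_wpmul2r//.
  exact: integral_ge0.
by rewrite lee_fin ler_pdivlMr// mul1r mulrC.
Qed.

Variable G : nat -> set X.
Hypothesis bG : forall n, BB (G n).
Hypothesis hG : forall B, BB B -> exists n, B `<=` G n /\ G n `<=` star (star B).

Let mG n : measurable (G n). Proof. exact: (bb_measurable hBB). Qed.

Lemma measure_star2 B : BB B -> mu (star (star B)) <= (C0 ^+ 2)%:E * mu B.
Proof.
move=> bB; have bB' := enl_ball hE bB.
apply: (le_trans (enl_measure hE bB')); rewrite expr2 EFinM -muleA.
by rewrite lee_wpmul2l ?lee_fin ?(ltW C00)//; exact: (enl_measure hE).
Qed.

Lemma grid_measure B : BB B ->
  exists2 n, B `<=` G n & mu (G n) <= (C0 ^+ 2)%:E * mu B.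
Proof.
move=> bB; have [n [Bn nB]] := hG bB; exists n => //.
apply: le_trans (measure_star2 bB); apply: le_measure; rewrite ?inE//.
by apply: (bb_measurable hBB); do 2 apply: (enl_ball hE).
Qed.

Lemma mean_le_gmax B (phi : X -> \bar R) y : BB B -> B y ->
  measurable_fun [set: X] phi -> (forall x, 0 <= phi x) ->
  mean mu B phi <= (C0 ^+ 2)%:E * gmax G mu phi y.
Proof.
move=> bB By mphi phi0; have [n Bn muGn] := grid_measure bB.
apply: (le_trans (mean_sub bB (bG n) Bn muGn mphi phi0)).
rewrite lee_wpmul2l// ?lee_fin ?exprn_ge0 ?(ltW C00)//.
by apply: gmax_ge; exact: Bn.
Qed.

(** A ball of the family that meets [B] is either small, and then inside
    [star B], or large, and then its own enlargement contains [B], so that its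
    mean is controlled by the maximal function at any point of [B]. *)
Lemma gmax_star B (phi : X -> \bar R) x y n : BB B -> B x -> B y -> G n x ->
  measurable_fun [set: X] phi -> (forall x, 0 <= phi x) ->
  G n `<=` star B \/ mean mu (G n) phi <= (C0 ^+ 3)%:E * gmax G mu phi y.
Proof.
move=> bB Bx By Gx mphi phi0.
have [le2|gt2] := leP (mu (G n)) (2%:E * mu B).
  by left; apply: (sub_star hE) => //; exists x.
right; have bGs : BB (star (G n)) by exact: (enl_ball hE).
have BG : B `<=` star (G n).
  apply: (sub_star hE) => //; first by exists x.
  apply: (@le_trans _ _ (2%:E * mu B)); first exact: le_double.
  by apply: (le_trans (ltW gt2)); exact: le_double.
apply: (le_trans (mean_sub (bG n) bGs (ball_star hBB hE (bG n)) (enl_measure hE (bG n)) mphi phi0)).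
rewrite exprS EFinM -muleA lee_wpmul2l ?lee_fin ?(ltW C00)//.
by apply: mean_le_gmax => //; exact: BG.
Qed.

(** By [gmax_star], on [B] the maximal function of [phi] is at most the larger
    of that of [phi] restricted to [star B] and a multiple of its value [c] at
    [y].  The first one is of weak type with a constant of order [c mu B], so
    Kolmogorov's inequality bounds the integral of its power [ga < 1]. *)
Lemma coifman_rochberg (ga : R) : (0 < ga < 1)%R ->
  exists2 C : R, (0 < C)%R & forall (phi : X -> R), measurable_fun [set: X] phi ->
   (forall x, (0 <= phi x)%R) -> forall B y (c : R), BB B -> B y -> (0 < c)%R ->
   gmax G mu (EFin \o phi) y <= c%:E ->
   \int[mu]_(x in B) gmax G mu (EFin \o phi) x `^ ga <= (C * c `^ ga)%:E * mu B.
Proof.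
move=> ga01; have /andP[ga0 ga1] := ga01.
pose Cg : R := (1 + 2 `^ ga / (1 - 2 `^ (ga - 1)))%R.
have r1 : (2 `^ (ga - 1) < 1 :> R)%R.
  by apply: powR2_lt1; rewrite subr_lt0.
have Cg0 : (0 < Cg)%R by rewrite addr_gt0// divr_gt0 ?powR_gt0// subr_gt0.
exists (Cg * (C0 ^+ 4) `^ ga + (C0 ^+ 3) `^ ga)%R.
  by rewrite addr_gt0 ?mulr_gt0 ?powR_gt0 ?exprn_gt0.
move=> phi mphi phi0 B y c bB By c0 yc.
have mB := bb_measurable hBB bB; have bBs := enl_ball hE bB.
have mBs := bb_measurable hBB bBs.
pose phi1 := (phi \* \1_(star B))%R.
have mphi1 : measurable_fun [set: X] phi1.
  by apply: measurable_funM => //; exact: measurable_indic.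
have phi10 x : (0 <= phi1 x)%R by rewrite mulr_ge0.
pose M := gmax G mu (EFin \o phi); pose M1 := gmax G mu (EFin \o phi1).
have mphiE : measurable_fun [set: X] (EFin \o phi) by exact/measurable_EFinP.
have mphi1E : measurable_fun [set: X] (EFin \o phi1) by exact/measurable_EFinP.
have phiE0 x : 0 <= (EFin \o phi) x by rewrite lee_fin.
have phi1E0 x : 0 <= (EFin \o phi1) x by rewrite lee_fin.
have M0 x : 0 <= M x by exact: gmax_ge0.
have M10 x : 0 <= M1 x by exact: gmax_ge0.
have mM1 : measurable_fun [set: X] M1 by exact: (measurable_gmax hBB bG).
have mM : measurable_fun [set: X] M by exact: (measurable_gmax hBB bG).
have [b b0 bE] := ball_fineE hBB bB.
have K30 : (0 <= C0 ^+ 3 * c)%R by rewrite mulr_ge0 ?exprn_ge0 ?(ltW C00) ?(ltW c0).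
have MM1 x : B x -> M x `^ ga <= M1 x `^ ga + ((C0 ^+ 3 * c) `^ ga)%:E.
  move=> Bx; have : M x <= Order.max (M1 x) (C0 ^+ 3 * c)%:E.
    apply: gmax_le => [|n Gx]; first by rewrite le_max M10.
    rewrite le_max; apply/orP.
    have [GB|le3] := gmax_star bB Bx By Gx mphiE phiE0; [left|right].
      suff -> : mean mu (G n) (EFin \o phi) = mean mu (G n) (EFin \o phi1).
        exact: gmax_ge.
      rewrite /mean; congr (_ * _); apply: eq_integral => z /set_mem Gz /=.
      by rewrite /phi1/= indicE mem_set ?mulr1//; exact: GB.
    apply: (le_trans le3); rewrite [leRHS]EFinM lee_wpmul2l// lee_fin.
    by rewrite exprn_ge0 ?(ltW C00).
  move=> /(@poweR_le _ _ _ ga (ltW ga0) (M0 x)) => /le_trans; apply.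
  rewrite maxEle; case: ifP => _.
    by rewrite poweR_EFin leeDr// poweR_ge0.
  by rewrite leeDl// lee_fin powR_ge0.
apply: (@le_trans _ _ (\int[mu]_(x in B) (M1 x `^ ga + ((C0 ^+ 3 * c) `^ ga)%:E))).
  apply: ge0_le_integral => //.
  - by move=> x _; exact: poweR_ge0.
  - exact: measurable_poweRF.
  - by apply: emeasurable_funD => //; exact: measurable_poweRF.
rewrite ge0_integralD//; last 3 first.
- by move=> x _; exact: poweR_ge0.
- exact: measurable_poweRF.
- by move=> x _; rewrite lee_fin powR_ge0.
rewrite integral_cst// mulrDl EFinD ge0_muleDl; last 2 first.
- by rewrite lee_fin !mulr_ge0 ?powR_ge0// ltW.
- by rewrite lee_fin !mulr_ge0 ?powR_ge0.
rewrite powRM ?exprn_ge0 ?(ltW C00) ?(ltW c0)//; apply: leeD => //.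
have K0 : (0 < C0 ^+ 4 * c * b)%R by rewrite !mulr_gt0 ?exprn_gt0.
have weak t : (0 < t)%R -> mu [set x | t%:E < M1 x] <= (C0 ^+ 4 * c * b / t)%:E.
  move=> t0; apply: (le_trans (gmax_weak hBB hE bG (ltW C00) doubling_base mphi1E phi1E0 t0)).
  have -> : \int[mu]_x (EFin \o phi1) x = \int[mu]_(x in star B) (phi x)%:E.
    by rewrite [RHS]integral_mkcond; apply: eq_integral => x _; rewrite epatch_indic.
  have [bs bs0 bsE] := ball_fineE hBB bBs.
  have := mean_le_gmax bBs (ball_star hBB hE bB By) mphiE phiE0.
  rewrite (meanE _ bs0 bsE) lee_pdivrMl// => /le_trans le3.
  have bsb : (bs <= C0 * b)%R by rewrite -lee_fin EFinM -bE -bsE; exact: (enl_measure hE).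
  have le4 : \int[mu]_(x in star B) (phi x)%:E <= (C0 ^+ 3 * c * b)%:E.
    apply: le3; apply: (@le_trans _ _ ((bs * (C0 ^+ 2 * c))%:E)).
      have -> : (bs * (C0 ^+ 2 * c))%:E = bs%:E * ((C0 ^+ 2)%:E * c%:E) by [].
      rewrite lee_wpmul2l ?lee_fin ?(ltW bs0)// lee_wpmul2l//.
      by rewrite lee_fin exprn_ge0 ?(ltW C00).
    rewrite lee_fin; apply: (@le_trans _ _ (C0 * b * (C0 ^+ 2 * c))%R).
      by rewrite ler_wpM2r// mulr_ge0 ?exprn_ge0 ?(ltW C00) ?(ltW c0).
    by apply: eqle; ring.
  apply: (le_trans (lee_wpmul2l _ le4)).
    by rewrite lee_fin divr_ge0 ?(ltW C00) ?(ltW t0).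
  rewrite -EFinM lee_fin; apply: eqle; field.
  by rewrite gt_eqF.
apply: (le_trans (kolmogorov mM1 mB _ M10 K0 ga01 weak)).
  by rewrite bE ltry.
rewrite -/Cg bE poweR_EFin -!EFinM lee_fin.
rewrite !powRM ?mulr_ge0 ?exprn_ge0 ?(ltW C00) ?(ltW c0) ?(ltW b0)//.
rewrite -[X in (_ <= _ * X)%R](powRr1 (ltW b0)).
rewrite (_ : b `^ 1 = b `^ ga * b `^ (1 - ga))%R; last first.
  rewrite -powRD ?(gt_eqF b0) ?implybT//; congr (_ `^ _)%R; ring.
by apply: eqle; ring.
Qed.

End coifman_rochberg.

(** * Tuples of functions in L^r *)
Section lebesgue_class.
Context {d : measure_display} {X : measurableType d} {R : realType}.
Variable mu : {measure set X -> \bar R}.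
Variables (m : nat) (r : R).
Hypothesis r1 : (1 <= r)%R.
Implicit Types (f : 'I_m -> X -> R).

Let r0 : (0 < r)%R. Proof. exact: lt_le_trans r1. Qed.

Lemma LrP f : Lr mu r f <-> forall i, measurable_fun [set: X] (f i) /\
  \int[mu]_x (`|f i x| `^ r)%:E < +oo.
Proof.
have NE g : 'N[mu]_(r%:E)[EFin \o g] = (\int[mu]_x (`|g x| `^ r)%:E) `^ r^-1.
  by rewrite unlock.
have I0 g : 0 <= \int[mu]_x (`|g x| `^ r)%:E.
  by apply: integral_ge0 => x _; rewrite lee_fin powR_ge0.
split=> H i; have := H i.
  move=> /[dup] /sub_Lfun_mfun /[!inE] mf /sub_Lfun_finLfun /[!inE].
  rewrite /= /finite_norm NE => fin; split => //.
  have : ((\int[mu]_x (`|f i x| `^ r)%:E) `^ r^-1) `^ r < +oo.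
    exact: poweR_lty.
  by rewrite -poweRrM mulVf ?gt_eqF// poweRe1.
move=> [mf fin]; rewrite inE; apply/andP; split; rewrite inE//=.
by rewrite /finite_norm NE poweR_lty.
Qed.

Lemma Lr_measurable f i : Lr mu r f -> measurable_fun [set: X] (f i).
Proof. by move=> /LrP/(_ i)[]. Qed.

Definition Lrpow f (i : 'I_m) (x : X) : R := (`|f i x| `^ r)%R.

Lemma Lrpow_ge0 f i x : (0 <= Lrpow f i x)%R.
Proof. exact: powR_ge0. Qed.

Lemma measurable_Lrpow f i : Lr mu r f -> measurable_fun [set: X] (Lrpow f i).
Proof.
move=> /Lr_measurable - /(_ i) mf.
apply: (@measurableT_comp _ _ _ _ _ _ (fun x => x `^ r)%R) => //.
exact: measurableT_comp.
Qed.

Lemma restr_restr f (A B : set X) : A `<=` B -> restr (restr f B) A = restr f A.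
Proof.
move=> AB; apply/funext => i; apply/funext => x; rewrite /restr/=.
rewrite !indicE; have [Ax|nAx] := pselect (A x).
  by rewrite !mem_set ?mulr1//; exact: AB.
by rewrite (memNset nAx) !mulr0.
Qed.

Lemma Lrpow_restr f (A : set X) i x :
  (Lrpow (restr f A) i x = Lrpow f i x * \1_A x)%R.
Proof.
rewrite /Lrpow /restr/= indicE; case: (x \in A); rewrite ?mulr1//.
by rewrite !mulr0 normr0 powR0// gt_eqF.
Qed.

Definition Lint f i (A : set X) : \bar R := \int[mu]_(x in A) (Lrpow f i x)%:E.

Lemma Lint_ge0 f i A : 0 <= Lint f i A.
Proof. by apply: integral_ge0 => x _; rewrite lee_fin Lrpow_ge0. Qed.

Lemma le_Lint f i A B : Lr mu r f -> measurable A -> measurable B -> A `<=` B ->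
  Lint f i A <= Lint f i B.
Proof.
move=> Lf mA mB AB; apply: ge0_subset_integral => //.
  by apply/measurable_EFinP/measurable_funTS/measurable_Lrpow.
by move=> x _; rewrite lee_fin Lrpow_ge0.
Qed.

Lemma Lint_fin f i A : Lr mu r f -> measurable A -> Lint f i A \is a fin_num.
Proof.
move=> Lf mA; rewrite ge0_fin_numE ?Lint_ge0//.
have [_] := (LrP f).1 Lf i; apply: le_lt_trans.
exact: (le_Lint i Lf mA measurableT).
Qed.

Lemma Lint_restr f i A : Lint (restr f A) i setT = Lint f i A.
Proof.
rewrite /Lint [RHS]integral_mkcond; apply: eq_integral => x _.
by rewrite Lrpow_restr epatch_indic.
Qed.

Lemma Lr_restr f A : Lr mu r f -> measurable A -> Lr mu r (restr f A).
Proof.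
move=> Lf mA; apply/LrP => i; split.
  apply: measurable_funM; first exact: Lr_measurable.
  exact: measurable_indic.
have := Lint_fin i Lf mA; rewrite -Lint_restr ge0_fin_numE//.
exact: Lint_ge0.
Qed.

Definition Lrnorm f i : R := (fine (Lint f i setT) `^ r^-1)%R.

Lemma Lrnorm_ge0 f i : (0 <= Lrnorm f i)%R. Proof. exact: powR_ge0. Qed.

Lemma LrnormE f i : Lr mu r f -> 'N[mu]_(r%:E)[EFin \o f i] = (Lrnorm f i)%:E.
Proof.
move=> Lf; rewrite unlock /Lrnorm -poweR_EFin fineK//.
exact: Lint_fin.
Qed.

Lemma avgE f i B (b : R) : Lr mu r f -> measurable B -> (0 < b)%R ->
  mu B = b%:E ->
  avg mu r B (EFin \o f i) = ((fine (Lint f i B) / b) `^ r^-1)%:E.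
Proof.
move=> Lf mB b0 bE; rewrite /avg (meanE _ b0 bE) -poweR_EFin.
congr (_ `^ _); rewrite [in RHS]mulrC EFinM fineK//.
exact: Lint_fin.
Qed.

Definition ravg f B : R := (\prod_(i < m) fine (avg mu r B (EFin \o f i)))%R.

Lemma avg_ge0 B (g : X -> \bar R) : 0 <= avg mu r B g.
Proof. exact: poweR_ge0. Qed.

Lemma ravgE f B b : Lr mu r f -> measurable B -> (0 < b)%R -> mu B = b%:E ->
  (ravg f B)%:E = \prod_(i < m) avg mu r B (EFin \o f i).
Proof.
move=> Lf mB b0 bE; rewrite /ravg -prodEFin; apply: eq_bigr => i _.
by rewrite (avgE i Lf mB b0 bE).
Qed.

Lemma ravg_ge0 f B : (0 <= ravg f B)%R.
Proof. by apply: prodr_ge0 => i _; rewrite fine_ge0// avg_ge0. Qed.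

Lemma prod_Lrnorm_restr f B b : Lr mu r f -> measurable B -> (0 < b)%R ->
  mu B = b%:E ->
  (\prod_(i < m) Lrnorm (restr f B) i = ravg f B * b `^ (m%:R / r))%R.
Proof.
move=> Lf mB b0 bE.
have -> : (b `^ (m%:R / r) = \prod_(i < m) b `^ r^-1)%R.
  rewrite prodr_const card_ord -powR_mulrn ?powR_ge0//.
  by rewrite -powRrM mulrC.
rewrite /ravg -big_split/=; apply: eq_bigr => i _.
rewrite (avgE i Lf mB b0 bE)/= /Lrnorm Lint_restr -powRM ?divfK ?gt_eqF//.
  by rewrite divr_ge0 ?fine_ge0 ?Lint_ge0 ?(ltW b0).
exact: ltW.
Qed.

End lebesgue_class.

(** * Bounded oscillation operators: the good-lambda method *)
Lemma measure_bigcup_null {d : measure_display} {X : measurableType d}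
  {R : realType} (mu : {measure set X -> \bar R}) (F : nat -> set X) :
  (forall n, measurable (F n)) -> (forall n, mu (F n) <= 0) ->
  mu (\bigcup_n F n) <= 0.
Proof.
move=> mF F0; have mU : measurable (\bigcup_n F n) by exact: bigcupT_measurable.
apply: (le_trans (measure_sigma_subadditive mu mF mU (@subset_refl _ _))).
by apply: nneseries_le => // n; rewrite big1// => k _; apply/eqP; rewrite eq_le F0/=.
Qed.

Section operator.
Context {d : measure_display} {X : measurableType d} {R : realType}.
Variables (mu : {measure set X -> \bar R}) (BB : set (set X)).
Variables (star : set X -> set X) (C0 : R).
Hypothesis hBB : ball_basis mu BB star.
Hypothesis hE : enlargement mu BB star C0.
Variable G : nat -> set X.
Hypothesis bG : forall n, BB (G n).
Hypothesis hG : forall B, BB B -> exists n, B `<=` G n /\ G n `<=` star (star B).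
Variables (m : nat) (m0 : (0 < m)%N) (r : R) (r1 : (1 <= r)%R).
Variables (V : completeNormedModType R) (cT : ('I_m -> X -> R) -> X -> V).
Variables (C1 C2 Cw : R).
Hypotheses (C10 : (0 < C1)%R) (C20 : (0 < C2)%R) (Cw0 : (0 < Cw)%R).
Hypothesis hT1 : osc_T1 mu BB r star cT C1.
Hypothesis hT2 : osc_T2 mu BB r star cT C2.
Let q : R := (r / m%:R)%R.
Let t (f : 'I_m -> X -> R) (x : X) : R := `|cT f x|%R.
Hypothesis mt : forall f, Lr mu r f -> measurable_fun [set: X] (t f).
Hypothesis weakT : forall f, Lr mu r f -> forall l : R, (0 < l)%R ->
  mu [set x | (l < t f x)%R] <= ((Cw * (\prod_(i < m) Lrnorm mu r f i) / l) `^ q)%:E.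
Implicit Types f : 'I_m -> X -> R.

Let C00 : (0 < C0)%R. Proof. exact: lt_le_trans (enl_ge1 hE). Qed.
Let r0 : (0 < r)%R. Proof. exact: lt_le_trans r1. Qed.
Let m0R : (0 < m%:R :> R)%R. Proof. by rewrite ltr0n. Qed.
Let q0 : (0 < q)%R. Proof. by rewrite divr_gt0. Qed.
Let mB B : BB B -> measurable B. Proof. exact: (bb_measurable hBB). Qed.

Lemma measurable_t_gt f (l : R) : Lr mu r f -> measurable [set x | (l < t f x)%R].
Proof.
move=> Lf; rewrite (_ : [set x | _] = [set x | l%:E < (EFin \o t f) x]).
  by apply: measurable_gt; apply/measurable_EFinP; exact: mt.
by apply/seteqP; split => x /=; rewrite lte_fin.
Qed.

Lemma ravg_ball f B : Lr mu r f -> BB B ->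
  (ravg mu r f B)%:E = \prod_(i < m) avg mu r B (EFin \o f i).
Proof.
move=> Lf bB; have [b b0 bE] := ball_fineE hBB bB.
exact: (ravgE r1 Lf (mB bB) b0 bE).
Qed.

(** The weak type bound applied to the restriction of [f] to [star B], whose
    norms are averages over [star B] times powers of its measure. *)
Lemma local_weak (eta : R) : (0 < eta)%R -> exists2 C : R, (0 < C)%R &
  forall B f, BB B -> Lr mu r f ->
  mu [set x | (C * ravg mu r f (star B) < t (restr f (star B)) x)%R]
    <= eta%:E * mu B.
Proof.
move=> eta0; exists (Cw * (C0 / eta) `^ q^-1)%R.
  by rewrite mulr_gt0// powR_gt0// divr_gt0.
set C := (Cw * _)%R; move=> B f bB Lf.
have C_gt0 : (0 < C)%R by rewrite mulr_gt0// powR_gt0// divr_gt0.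
have bS := enl_ball hE bB; have [s s0 sE] := ball_fineE hBB bS.
have [b b0 bE] := ball_fineE hBB bB.
have Lg := Lr_restr r1 Lf (mB bS).
set a := ravg mu r f (star B).
have NE : (\prod_(i < m) Lrnorm mu r (restr f (star B)) i = a * s `^ (m%:R / r))%R.
  exact: (prod_Lrnorm_restr r1 Lf (mB bS) s0 sE).
have [a0|a0] := eqVneq a 0%R.
  apply: (@le_trans _ _ 0); last by rewrite bE lee_fin mulr_ge0// ltW.
  rewrite a0 mulr0.
  have -> : [set x | (0 < t (restr f (star B)) x)%R] =
      \bigcup_n [set x | (n.+1%:R^-1 < t (restr f (star B)) x)%R].
    apply/seteqP; split => [x /= x0|x [n _] /=]; last exact: lt_trans.
    exists (Num.bound (t (restr f (star B)) x)^-1) => //=.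
    rewrite invf_plt ?posrE//.
    apply: (lt_le_trans (archi_boundP _)); first by rewrite invr_ge0 ltW.
    by rewrite ler_nat.
  apply: measure_bigcup_null => n; first exact: measurable_t_gt.
  apply: (le_trans (weakT Lg _)) => //.
  by rewrite NE a0 mul0r mulr0 mul0r powR0// gt_eqF.
have {}a0 : (0 < a)%R by rewrite lt_neqAle eq_sym a0 ravg_ge0.
apply: (le_trans (weakT Lg _)); first by rewrite mulr_gt0.
rewrite NE bE -EFinM lee_fin.
have sb : (s <= C0 * b)%R by rewrite -lee_fin EFinM -bE -sE; exact: (enl_measure hE).
have -> : ((Cw * (a * s `^ (m%:R / r)) / (C * a)) `^ q = s * (eta / C0))%R.
  have -> : (Cw * (a * s `^ (m%:R / r)) / (C * a) =
             s `^ (m%:R / r) * ((C0 / eta) `^ q^-1)^-1)%R.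
    by rewrite /C; field; rewrite !gt_eqF// powR_gt0// divr_gt0.
  rewrite -powRN powRM ?powR_ge0// -!powRrM mulNr mulVf ?gt_eqF//.
  rewrite (_ : m%:R / r * q = 1)%R; last by rewrite /q; field; rewrite !gt_eqF.
  by rewrite powRr1 ?(ltW s0)// powR_inv1 ?divr_ge0 ?(ltW C00) ?(ltW eta0)// invf_div.
apply: (le_trans (ler_wpM2r _ sb)); first by rewrite divr_ge0 ?ltW.
by apply: eqle; field; rewrite gt_eqF.
Qed.

(** A product of maximal functions, one for each entry.  It is larger than
    [multimax], where all entries are averaged over the same ball, and serves
    where [osc_T2] involves suprema of averages taken separately for each
    entry. *)
Definition prodmax f (x : X) : \bar R :=
  \prod_(i < m) gmax G mu (EFin \o Lrpow r f i) x `^ r^-1.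

Definition multimax f (x : X) : \bar R :=
  ereal_sup (range (fun n => (\1_(G n) x)%:E *
    \prod_(i < m) avg mu r (G n) (EFin \o f i))).

Definition grid_const : R := ((C0 ^+ 2) `^ r^-1 ^+ m)%R.

Lemma grid_const_gt0 : (0 < grid_const)%R.
Proof. by rewrite exprn_gt0// powR_gt0// exprn_gt0. Qed.

Lemma prode_le (a b : 'I_m -> \bar R) : (forall i, 0 <= a i) ->
  (forall i, a i <= b i) -> \prod_(i < m) a i <= \prod_(i < m) b i.
Proof.
move=> a0 ab.
suff : 0 <= \prod_(i < m) a i /\ \prod_(i < m) a i <= \prod_(i < m) b i by case.
elim/big_ind2 : _ => // [x1 x2 y1 y2 [x10 x12] [y10 y12]].
by split; [rewrite mule_ge0|rewrite lee_pmul].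
Qed.

Lemma prode_scale (c : R) (b : 'I_m -> \bar R) : (0 <= c)%R ->
  (forall i, 0 <= b i) ->
  \prod_(i < m) (c%:E * b i) = (c ^+ m)%:E * \prod_(i < m) b i.
Proof.
move=> c0 b0; rewrite big_split/=; congr (_ * _).
by rewrite prodEFin prodr_const card_ord.
Qed.

Lemma avg_mono (A B : set X) f i : BB A -> Lr mu r f -> BB B -> A `<=` B ->
  mu B <= (C0 ^+ 2)%:E * mu A ->
  avg mu r A (EFin \o f i) <= ((C0 ^+ 2) `^ r^-1)%:E * avg mu r B (EFin \o f i).
Proof.
move=> bA Lf bB AB le2; rewrite /avg -poweR_EFin -poweRM.
- apply: poweR_le; first by rewrite invr_ge0 ltW.
    by apply: mean_ge0 => x; exact: poweR_ge0.
  apply: (mean_sub hBB) => //; last by move=> x; exact: poweR_ge0.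
  have := measurable_Lrpow r1 i Lf => /measurable_EFinP.
  by apply: eq_measurable_fun => x _ /=.
- by rewrite lee_fin exprn_ge0 ?ltW.
- by apply: mean_ge0 => x; exact: poweR_ge0.
Qed.

Lemma ravg_le_multimax f B y : Lr mu r f -> BB B -> B y ->
  (ravg mu r f B)%:E <= grid_const%:E * multimax f y.
Proof.
move=> Lf bB By; rewrite ravg_ball//.
have [n Bn muGn] := grid_measure hBB hE bG hG bB.
apply: (@le_trans _ _ (grid_const%:E * \prod_(i < m) avg mu r (G n) (EFin \o f i))).
  rewrite /grid_const -prode_scale ?powR_ge0//; last by move=> i; exact: avg_ge0.
  by apply: prode_le => i; [exact: avg_ge0|exact: avg_mono].
rewrite lee_wpmul2l// ?lee_fin ?(ltW grid_const_gt0)//.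
apply: ereal_sup_ubound; exists n => //; rewrite indicE mem_set ?mul1e//.
exact: Bn.
Qed.

Lemma sup_avg_le_prodmax f B y : Lr mu r f -> BB B -> B y ->
  \prod_(i < m) sup_avg mu BB r B (EFin \o f i) <= grid_const%:E * prodmax f y.
Proof.
move=> Lf bB By; rewrite /grid_const -prode_scale ?powR_ge0//; last first.
  by move=> i; exact: poweR_ge0.
apply: prode_le => i.
  apply: (@le_trans _ _ (avg mu r B (EFin \o f i))); first exact: avg_ge0.
  by apply: ereal_sup_ubound; exists B => //; split => //; exact: subset_refl.
apply: ge_ereal_sup => _ [B' [bB' BB'] <-].
rewrite /avg -poweR_EFin -poweRM; first last.
- by apply: gmax_ge0 => x; rewrite lee_fin Lrpow_ge0.
- by rewrite lee_fin exprn_ge0 ?ltW.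
apply: poweR_le; first by rewrite invr_ge0 ltW.
  by apply: mean_ge0 => x; exact: poweR_ge0.
apply: (mean_le_gmax hBB hE bG hG bB' (BB' _ By)).
  by apply/measurable_EFinP; exact: measurable_Lrpow.
by move=> x; rewrite lee_fin Lrpow_ge0.
Qed.

Lemma ravg_le_sup_avg f B B' : Lr mu r f -> BB B -> BB B' -> B `<=` B' ->
  (ravg mu r f B')%:E <= \prod_(i < m) sup_avg mu BB r B (EFin \o f i).
Proof.
move=> Lf bB bB' BB'; rewrite ravg_ball//.
apply: prode_le => i; first exact: avg_ge0.
by apply: ereal_sup_ubound; exists B'.
Qed.

Lemma measurable_prodmax f : Lr mu r f -> measurable_fun [set: X] (prodmax f).
Proof.
move=> Lf; rewrite /prodmax; elim: (index_enum _) => [|i s IH].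
  by under eq_fun do rewrite big_nil; exact: measurable_cst.
under eq_fun do rewrite big_cons.
apply: emeasurable_funM => //.
apply: (measurableT_comp (@measurable_poweR R r^-1)).
exact: (measurable_gmax hBB bG).
Qed.

Lemma measurable_multimax f : measurable_fun [set: X] (multimax f).
Proof.
rewrite (_ : multimax f = fun x => esups
    (fun n => (\1_(G n) x)%:E * \prod_(i < m) avg mu r (G n) (EFin \o f i)) 0%N).
  apply: measurable_fun_esups => n; apply: emeasurable_funM => //.
  by apply/measurable_EFinP; apply: measurable_indic; exact: mB.
apply/funext => x; rewrite /multimax /esups /sdrop/=; congr ereal_sup.
by apply/seteqP; split => _ [n _ <-]; exists n.
Qed.

Lemma multimax_ge0 f x : 0 <= multimax f x.
Proof.
apply: (@le_trans _ _ ((\1_(G 0%N) x)%:E * \prod_(i < m) avg mu r (G 0%N) (EFin \o f i))).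
  rewrite mule_ge0 ?lee_fin//; elim/big_ind: _ => // [x1 x2|i _].
    exact: mule_ge0.
  exact: avg_ge0.
by apply: ereal_sup_ubound; exists 0%N.
Qed.

Lemma measure_bigsetU_le (s : seq 'I_m) (A : 'I_m -> set X) (c : \bar R) :
  (forall i, measurable (A i)) -> (forall i, mu (A i) <= c) ->
  measurable (\big[setU/set0]_(i <- s) A i) /\
  mu (\big[setU/set0]_(i <- s) A i) <= (size s)%:R%:E * c.
Proof.
move=> mA Ac; elim: s => [|i s [mU IH]].
  by rewrite !big_nil measure0 mul0e.
rewrite !big_cons; split; first exact: measurableU.
apply: (le_trans (measureU2 _ _ _)) => //.
have c0 : 0 <= c by apply: le_trans (Ac i).
rewrite [size _]/= -natr1 EFinD ge0_muleDl// mul1e [leRHS]addeC.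
exact: (leeD (Ac i) IH).
Qed.

(** If a product of [m] factors exceeds [l], one factor exceeds its share.
    With the thresholds proportional to the norms of the entries, the weak type
    bounds of all the factors coincide. *)
Lemma prodmax_weak : exists2 C : R, (0 < C)%R & forall f, Lr mu r f ->
  forall l : R, (0 < l)%R ->
  mu [set x | l%:E < prodmax f x] <=
    (C * ((\prod_(i < m) Lrnorm mu r f i) / l) `^ q)%:E.
Proof.
exists (m%:R * C0)%R; first by rewrite mulr_gt0.
move=> f Lf l l0; set P := (\prod_(i < m) _)%R.
pose g i := gmax G mu (EFin \o Lrpow r f i).
have mg i : measurable_fun [set: X] (g i) by exact: (measurable_gmax hBB bG).
have g0 i x : 0 <= g i x by apply: gmax_ge0 => y; rewrite lee_fin Lrpow_ge0.
have [/existsP[i /eqP Ni0]|/existsPn N0] :=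
    boolP [exists i : 'I_m, Lrnorm mu r f i == 0%R].
  rewrite (_ : [set x | _] = set0).
    rewrite measure0 lee_fin !mulr_ge0 ?powR_ge0 ?(ltW C00)//.
  apply/seteqP; split => // x /=.
  rewrite /prodmax (bigD1 i)//= -/(g i) (_ : g i x = 0).
    rewrite poweR0r ?mul0e; last by rewrite invr_neq0// gt_eqF.
    by rewrite lte_fin ltNge (ltW l0).
  apply/eqP; rewrite eq_le g0 andbT; apply: gmax_le => // n _.
  rewrite /mean; have -> : \int[mu]_(y in G n) (EFin \o Lrpow r f i) y = 0.
    apply/eqP; rewrite eq_le integral_ge0 ?andbT//; last first.
      by move=> y _; rewrite lee_fin Lrpow_ge0.
    apply: (le_trans (le_Lint r1 i Lf (mB (bG n)) measurableT (@subsetT _ _))).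
    have /eqP := Ni0; rewrite powR_eq0 => /andP[/eqP I0 _].
    by rewrite -(fineK (Lint_fin r1 i Lf measurableT)) I0.
  by rewrite mule0.
have Np i : (0 < Lrnorm mu r f i)%R.
  by rewrite lt_neqAle eq_sym N0 Lrnorm_ge0.
have P0 : (0 < P)%R by apply: prodr_gt0 => i _; exact: Np.
pose k := ((l / P) `^ m%:R^-1)%R.
have k0 : (0 < k)%R by rewrite powR_gt0// divr_gt0.
have kl : (\prod_(i < m) (Lrnorm mu r f i * k) = l)%R.
  rewrite big_split/= prodr_const card_ord -/P.
  rewrite -powR_mulrn ?powR_ge0// -powRrM mulVf ?gt_eqF// powRr1 ?divr_ge0 ?ltW//.
  by rewrite mulrC divfK// gt_eqF.
pose A i := [set x | ((Lrnorm mu r f i * k) `^ r)%:E < g i x].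
have mA i : measurable (A i) by exact: measurable_gt.
have Ac i : mu (A i) <= (C0 * (P / l) `^ q)%:E.
  have lr0 : (0 < (Lrnorm mu r f i * k) `^ r)%R by rewrite powR_gt0// mulr_gt0.
  have mL : measurable_fun [set: X] (EFin \o Lrpow r f i).
    by apply/measurable_EFinP; exact: measurable_Lrpow.
  have L0 x : 0 <= (EFin \o Lrpow r f i) x by rewrite lee_fin Lrpow_ge0.
  apply: (le_trans (gmax_weak hBB hE bG (ltW C00) (doubling_base hBB hE) mL L0 lr0)).
  have -> : \int[mu]_x (EFin \o Lrpow r f i) x = (Lrnorm mu r f i `^ r)%:E.
    rewrite /Lrnorm -powRrM mulVf ?gt_eqF// powRr1 ?fine_ge0 ?Lint_ge0//.
    by rewrite fineK ?Lint_fin.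
  have kr : (k `^ r * (P / l) `^ q = 1)%R.
    rewrite /k -powRrM (_ : m%:R^-1 * r = q)%R; last by rewrite mulrC.
    rewrite -powRM ?divr_ge0 ?ltW// (_ : l / P * (P / l) = 1)%R ?powR1//.
    by field; rewrite !gt_eqF.
  rewrite powRM ?(ltW k0) ?(ltW (Np i))// -EFinM lee_fin.
  have Lr0 := powR_gt0 r (Np i); have kr0 := powR_gt0 r k0.
  have -> : ((P / l) `^ q = (k `^ r)^-1)%R.
    by apply: (mulfI (lt0r_neq0 kr0)); rewrite kr mulfV// gt_eqF.
  move: Lr0 kr0; move: (k `^ r)%R (Lrnorm mu r f i `^ r)%R => a b b0 a0.
  apply: eqle; field.
  by rewrite !gt_eqF.
have [mU leU] := measure_bigsetU_le (index_enum 'I_m) mA Ac.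
apply: (@le_trans _ _ (mu (\big[setU/set0]_(i < m) A i))).
  apply: le_measure; rewrite ?inE//; first exact/measurable_gt/measurable_prodmax.
  move=> x /= lx; apply: contrapT => nx; move: lx; apply/negP; rewrite -leNgt.
  rewrite -kl -prodEFin; apply: prode_le => i; first exact: poweR_ge0.
  have : ~ A i x by move=> Ax; apply: nx; rewrite -bigcup_seq; exists i => //=; rewrite mem_index_enum.
  move/negP; rewrite -leNgt -/(g i x) => le1.
  have -> : (Lrnorm mu r f i * k)%:E = (((Lrnorm mu r f i * k) `^ r)%:E) `^ r^-1.
    by rewrite poweR_EFin -powRrM mulfV ?gt_eqF// powRr1// mulr_ge0 ?ltW.
  by apply: poweR_le; [rewrite invr_ge0 ltW|exact: g0|exact: le1].
apply: (le_trans leU); rewrite -EFinM lee_fin mulrA.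
by rewrite (_ : size _ = m)// -[RHS](size_enum_ord m) /index_enum -enumT.
Qed.

(** For a linear operator the difference is the contribution of the part of
    [f] outside [star B]. *)
Definition oscball (f : 'I_m -> X -> R) (l : R) (B : set X) : Prop :=
  BB B /\ exists2 y, B y & (l < `|cT f y - cT (restr f (star B)) y|)%R.

Definition Omega (f : 'I_m -> X -> R) (l : R) : set X :=
  [set x | exists2 B, oscball f l B & B x].

(** Let [B] belong to the family [oscball f l].  Either [|cT f| > l / 3] on
    half of [B], so that the maximal function of the indicator of this set is
    large on [B]; or some point [x'] of [B] has both [|cT f| <= l / 3] and
    [|cT (f 1_(star B))|] at most a multiple of the averages of [f].  In the second
    case [|cT f - cT (f 1_(star B))|] is at [x'] at most [l / 3] plus a multiple
    of these averages, while [osc_T2] bounds its variation on [B] by averages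
    of [f].  As it exceeds [l] somewhere on [B], the averages, and [prodmax] at
    every point of [B], must be at least of order [l]. *)
Lemma Omega_weak : exists2 C : R, (0 < C)%R & forall f, Lr mu r f ->
  forall l : R, (0 < l)%R -> exists U, [/\ measurable U, Omega f l `<=` U &
    mu U <= (C * ((\prod_(i < m) Lrnorm mu r f i) / l) `^ q)%:E].
Proof.
have [Cp Cp0 Hp] := prodmax_weak.
have [Cl Cl0 Hl] := @local_weak (4^-1) (ltac:(by rewrite invr_gt0)).
(* With this [c], averages that stay below [c l] contribute at most [l / 2] to
   the difference. *)
pose c := (2 * (C2 + Cl) * grid_const)^-1%R.
have KG0 := grid_const_gt0.
have c0 : (0 < c)%R by rewrite invr_gt0 !mulr_gt0// addr_gt0.
(* A ball of which half lies in [E] has mean 1/2 of the indicator of [E]; the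
   passage to the countable family loses [C0 ^ 2], and the factor 4 makes the
   resulting inequality strict. *)
pose e := (4 * C0 ^+ 2)^-1%R.
have e0 : (0 < e)%R by rewrite invr_gt0 mulr_gt0// exprn_gt0.
exists (C0 / e * (3 * Cw) `^ q + Cp * c^-1 `^ q)%R.
  have ci0 : (0 < c^-1)%R by rewrite invr_gt0.
  have a0 : (0 < C0 / e)%R by exact: divr_gt0.
  have b0 : (0 < 3 * Cw)%R by exact: mulr_gt0.
  by apply: addr_gt0; apply: mulr_gt0 => //; exact: powR_gt0.
move=> f Lf l l0; pose E := [set x | (l / 3 < t f x)%R].
have l30 : (0 < l / 3)%R by rewrite divr_gt0.
have mE : measurable E by exact: measurable_t_gt.
pose U1 := [set x | e%:E < gmax G mu (EFin \o \1_E) x].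
pose U2 := [set x | (c * l)%:E < prodmax f x].
have mU1 : measurable U1 by apply: measurable_gt; exact: (measurable_gmax hBB bG).
have mU2 : measurable U2 by apply: measurable_gt; exact: measurable_prodmax.
have m1 : measurable_fun [set: X] (EFin \o (\1_E : X -> R)).
  exact/measurable_EFinP/measurable_indic.
have i0 x : 0 <= (EFin \o (\1_E : X -> R)) x by rewrite lee_fin.
set P := (\prod_(i < m) _)%R.
have P0 : (0 <= P)%R by apply: prodr_ge0 => i _; exact: Lrnorm_ge0.
exists (U1 `|` U2); split; first exact: measurableU; last first.
  apply: (le_trans (measureU2 _ _ _)) => //; rewrite mulrDl EFinD; apply: leeD.
    apply: (le_trans (gmax_weak hBB hE bG (ltW C00) (doubling_base hBB hE) m1 i0 e0)).
    rewrite integral_indic// setIT.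
    have -> : (C0 / e * (3 * Cw) `^ q * (P / l) `^ q)%:E =
        (C0 / e)%:E * ((3 * Cw) `^ q * (P / l) `^ q)%:E by rewrite -EFinM mulrA.
    rewrite lee_wpmul2l//.
      by rewrite lee_fin divr_ge0 ?ltW.
    apply: (le_trans (weakT Lf l30)); rewrite lee_fin -/P -powRM//; last first.
    - by rewrite divr_ge0// ltW.
    - by rewrite mulr_ge0// ltW.
    apply: eqle; congr (_ `^ _)%R; field.
    by rewrite gt_eqF.
  apply: (le_trans (Hp _ Lf _ _)); first by rewrite mulr_gt0.
  rewrite lee_fin -/P -mulrA -powRM//; last first.
  - by rewrite divr_ge0// ltW.
  - by rewrite invr_ge0 ltW.
  apply: eqle; congr (_ * _ `^ _)%R; field.
  by rewrite !gt_eqF.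
move=> z [B [bB [y By ly]] Bz].
have mBB := mB bB; have [b b0 bE] := ball_fineE hBB bB.
have bS := enl_ball hE bB.
have [half|small] := leP (2^-1%:E * mu B) (mu (B `&` E)).
  left; rewrite /U1/=.
  have : (2^-1)%:E <= mean mu B (EFin \o \1_E).
    rewrite (meanE _ b0 bE) lee_pdivlMl// integral_indic// setIC.
    by rewrite muleC -bE.
  move=> /le_trans/(_ (mean_le_gmax hBB hE bG hG bB Bz m1 i0)).
  rewrite -lee_pdivrMl; last by rewrite exprn_gt0.
  apply: lt_le_trans; rewrite -EFinM lte_fin /e.
  rewrite invfM mulrC ltr_pM2l ?invr_gt0 ?exprn_gt0//.
  by rewrite ltf_pV2 ?posrE// ltr_nat.
right; rewrite /U2/=; rewrite ltNge; apply/negP => cl.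
have [x' [Bx' nE nl]] : exists x', [/\ B x', ~ E x' &
    (t (restr f (star B)) x' <= Cl * ravg mu r f (star B))%R].
  apply: contrapT => nx.
  pose W := [set x | (Cl * ravg mu r f (star B) < t (restr f (star B)) x)%R].
  have mW : measurable W by apply/measurable_t_gt/Lr_restr => //; exact: mB.
  have sub : B `<=` (B `&` E) `|` W.
    move=> x Bx; have [Ex|nEx] := pselect (E x); [by left|right].
    rewrite /W/= ltNge; apply/negP => lW; apply: nx; exists x; split => //.
  have mBE : measurable (B `&` E) by exact: measurableI.
  have : mu B <= mu (B `&` E) + mu W.
    apply: le_trans (measureU2 _ _ _) => //.
    by apply: le_measure; rewrite ?inE//; exact: measurableU.
  have := Hl _ _ bB Lf; rewrite -/W; move: small; rewrite bE -!EFinM.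
  case: (mu (B `&` E)) => [u| |]; case: (mu W) => [u'| |] //.
  rewrite -EFinD !lee_fin lte_fin => h1 h2 h3; lra.
pose S := \prod_(i < m) sup_avg mu BB r B (EFin \o f i).
have S1 : S <= (grid_const * (c * l))%:E.
  apply: (le_trans (sup_avg_le_prodmax Lf bB Bz)).
  by rewrite EFinM lee_wpmul2l// lee_fin ltW.
have S2 : (ravg mu r f (star B))%:E <= S.
  exact: (ravg_le_sup_avg Lf bB bS (ball_star hBB hE bB)).
have osc : (`|(cT f y - cT (restr f (star B)) y) -
             (cT f x' - cT (restr f (star B)) x')|%R)%:E <= C2%:E * S.
  apply: le_trans (hT2 bB Lf); apply: ereal_sup_ubound.
  by exists y => //; exists x'.
have osc' : (`|(cT f y - cT (restr f (star B)) y) -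
             (cT f x' - cT (restr f (star B)) x')| <= C2 * (grid_const * (c * l)))%R.
  rewrite -lee_fin; apply: (le_trans osc); rewrite [leRHS]EFinM.
  by rewrite lee_wpmul2l// lee_fin ltW.
have av : (ravg mu r f (star B) <= grid_const * (c * l))%R.
  by rewrite -lee_fin; exact: le_trans S1.
have tri : (`|cT f y - cT (restr f (star B)) y| <=
   `|(cT f y - cT (restr f (star B)) y) - (cT f x' - cT (restr f (star B)) x')|
     + (t f x' + t (restr f (star B)) x'))%R.
  rewrite -[X in (`|X| <= _)%R](subrK (cT f x' - cT (restr f (star B)) x')%R).
  apply: (le_trans (ler_normD _ _)); rewrite lerD2l.
  exact: (le_trans (ler_normB _ _)).
have tE : (t f x' <= l / 3)%R by rewrite leNgt; apply/negP.
have : (Cl * ravg mu r f (star B) <= Cl * (grid_const * (c * l)))%R.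
  by rewrite ler_pM2l.
have : ((C2 + Cl) * (grid_const * (c * l)) = l / 2)%R.
  by rewrite /c; field; rewrite !gt_eqF// addr_gt0.
move: ly osc' tri tE nl l0.
move: (`|_|)%R => a1; move: (`|_|)%R => a2.
by lra.
Qed.

Lemma restr_setT f : restr f setT = f.
Proof.
by apply/funext => i; apply/funext => x; rewrite /restr/= indicT mulr1.
Qed.

Lemma oscball_le f l B z : BB B -> B z -> ~ oscball f l B ->
  (`|cT f z - cT (restr f (star B)) z| <= l)%R.
Proof.
by move=> bB Bz nB; rewrite leNgt; apply/negP => lz; apply: nB; split => //; exists z.
Qed.

(** Condition [osc_T1] for [star (star B)] provides a strictly larger ball [P].
    It is too large to belong to [oscball f l], as [B] is nearly maximal among
    the balls of this family through [x]; hence the difference for [P] is at most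
    [l] on [P], and [osc_T1] controls the passage from [star P] back to
    [star (star (star B))]. *)
Lemma stopping_ball f (l ga : R) B x y z : Lr mu r f -> (0 < l)%R ->
  (C1 * (grid_const * ga) <= 1)%R ->
  oscball f l B -> B x ->
  (forall B', oscball f l B' -> B' x -> mu B' <= 2%:E * mu B) ->
  star (star B) y -> multimax f y <= (ga * l)%:E -> star (star B) z ->
  (`|cT f z - cT (restr f (star (star (star B)))) z| <= 2 * l)%R.
Proof.
move=> Lf l0 Cga [bB oB] Bx maxB Sy My Sz; set S := star (star B).
have bS1 := enl_ball hE bB; have bS : BB S := enl_ball hE bS1.
have bS' := enl_ball hE bS.
have [ST|SnT] := pselect (star S = setT).
  by rewrite -/S ST restr_setT subrr normr0 mulr_ge0// ltW.
have SsubT : star S `<` [set: X].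
  by rewrite properEneq; split => //; exact/eqP.
have [P [bP SP T1P]] := hT1 bS SsubT.
have BS : B `<=` S.
  exact: (subset_trans (ball_star hBB hE bB) (ball_star hBB hE bS1)).
have Px : P x by apply: SP.1; exact: BS.
have nP : ~ oscball f l P.
  move=> oP; apply: SP.2; apply: (subset_trans _ (ball_star hBB hE bS1)).
  by apply: (sub_star hE bB bP) => //; [exists x|exact: maxB].
have Pz : P z by apply: SP.1.
have d1 := oscball_le bP Pz nP.
have bP' := enl_ball hE bP.
have d2 : (`|cT (restr f (star P)) z - cT (restr f (star S)) z| <= l)%R.
  rewrite -lee_fin; apply: (@le_trans _ _ (ereal_sup [set (`|cT (restr f (star P)) x
      - cT (restr f (star S)) x|%R)%:E | x in S])).
    by apply: ereal_sup_ubound; exists z.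
  apply: (le_trans (T1P _ Lf)); rewrite -ravg_ball//.
  have yP : star P y by apply: (ball_star hBB hE bP); apply: SP.1.
  have av := ravg_le_multimax Lf bP' yP.
  have {}av : (ravg mu r f (star P) <= grid_const * (ga * l))%R.
    rewrite -lee_fin; apply: (le_trans av); rewrite [leRHS]EFinM.
    by rewrite lee_wpmul2l// lee_fin ltW// grid_const_gt0.
  rewrite -EFinM lee_fin.
  apply: (@le_trans _ _ (C1 * (grid_const * (ga * l)))%R); first by rewrite ler_pM2l.
  rewrite (_ : C1 * (grid_const * (ga * l)) = (C1 * (grid_const * ga)) * l)%R; last by ring.
  by rewrite ler_piMl// ltW.
have -> : (cT f z - cT (restr f (star S)) z =
   (cT f z - cT (restr f (star P)) z) +
   (cT (restr f (star P)) z - cT (restr f (star S)) z))%R.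
  by rewrite addrA subrK.
apply: (le_trans (ler_normD _ _)); rewrite (_ : 2 * l = l + l)%R; last by ring.
exact: lerD.
Qed.

(** Choose for each point of [Omega f l] a nearly maximal ball of the family,
    and a disjoint Vitali subfamily [B_ j] of these.  Where [multimax] is at
    most [ga l], a ball of [oscball f (3 l)] lies in [S j], the double
    enlargement of some [B_ j], and by [stopping_ball] it still belongs to the
    family of level [l] for the restriction of [f] to [star (S j)].  By
    [Omega_weak] for that restriction, these balls fill a small part of [S j],
    of [sg]-measure at most [D ^ 2 eps] times that of [B_ j].  The [B_ j] are
    disjoint subsets of [Omega f l], hence of [U]. *)
Lemma good_lambda (D eps eta : R) : (0 <= D)%R -> (0 <= eps)%R -> (0 < eta)%R ->
  exists2 ga : R, (0 < ga)%R & forall sg : {measure set X -> \bar R},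
  doubling BB star sg D ->
  (forall B A, BB B -> measurable A -> A `<=` B ->
     mu A <= eta%:E * mu B -> sg A <= eps%:E * sg B) ->
  forall f (l : R) U, Lr mu r f -> (0 < l)%R -> measurable U -> Omega f l `<=` U ->
  exists U', [/\ measurable U', Omega f (3 * l) `<=` U' &
   sg U' <= sg [set x | (ga * l)%:E < multimax f x] + (D ^+ 2 * eps)%:E * sg U].
Proof.
move=> D0 eps0 eta0; have [Co Co0 Ho] := Omega_weak.
have KG0 := grid_const_gt0.
(* [g1] is the threshold for [stopping_ball]; [g2] makes the part of [S j]
   that is filled by the balls at most [eta] of its measure. *)
pose g1 := ((C1 * grid_const)^-1)%R; pose g2 := ((eta / (Co * C0)) `^ q^-1 / grid_const)%R.
have g10 : (0 < g1)%R by rewrite invr_gt0 mulr_gt0.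
have g20 : (0 < g2)%R by rewrite divr_gt0// powR_gt0// divr_gt0// mulr_gt0.
pose ga := Num.min g1 g2; have ga0 : (0 < ga)%R by rewrite lt_min g10.
exists ga => // sg dsg small f l U Lf l0 mU OU.
have ga1 : (C1 * (grid_const * ga) <= 1)%R.
  apply: (@le_trans _ _ (C1 * (grid_const * g1))%R).
    by rewrite ler_pM2l// ler_pM2l// ge_min lexx.
  by rewrite /g1 mulrA mulfV// gt_eqF// mulr_gt0.
have ga2 : (Co * (grid_const * ga) `^ q * C0 <= eta)%R.
  apply: (@le_trans _ _ (Co * (grid_const * g2) `^ q * C0)%R).
    rewrite ler_pM2r// ler_pM2l//; apply: ge0_ler_powR; first exact: ltW.
    - by rewrite nnegrE mulr_ge0// ltW.
    - by rewrite nnegrE mulr_ge0// ltW.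
    - by rewrite ler_pM2l// ge_min lexx orbT.
  rewrite /g2 [(grid_const * _)%R]mulrC divfK ?gt_eqF//.
  rewrite -powRrM mulVf ?gt_eqF// powRr1; last by rewrite divr_ge0// ?ltW// mulr_gt0.
  apply: eqle; field.
  by rewrite !gt_eqF.
pose Fx x := [set B | oscball f l B /\ B x].
have [U0 [mU0 OU0 muU0]] := Ho f Lf l l0.
have oscU0 B : oscball f l B -> mu B <= mu U0.
  move=> oB; have bB := oB.1; apply: le_measure; rewrite ?inE//; first exact: mB.
  by move=> x Bx; apply: OU0; exists B.
have U0oo : mu U0 < +oo by apply: (le_lt_trans muU0); exact: ltry.
pose F := [set B | exists x, Fx x B /\ forall B', Fx x B' -> mu B' <= 2%:E * mu B].
have FB : F `<=` BB by move=> B [x [[[]]]].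
have FU B : F B -> mu B <= mu U0 by move=> [x [[oB _] _]]; exact: oscU0.
have Fex x : Omega f l x -> exists2 B, F B & Fx x B /\
    forall B', Fx x B' -> mu B' <= 2%:E * mu B.
  move=> [B oB Bx]; have [|||B' FB' maxB'] := @near_max _ _ _ mu BB star hBB (Fx x) (mu U0) _ _ U0oo.
  - by move=> A [[]].
  - by exists B; split.
  - by move=> A [oA _]; exact: oscU0.
  by exists B' => //; exists x.
have [Dk [B_ [DF tB FBj]]] := vitali hBB hE FB U0oo FU.
pose S j := star (star (B_ j)).
have bBj j : Dk j -> BB (B_ j) by move=> /DF/FB.
have bS j : Dk j -> BB (S j) by move=> /bBj bj; do 2 apply: (enl_ball hE).
have bS' j : Dk j -> BB (star (S j)) by move=> /bS bj; exact: (enl_ball hE).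
(* The part of [S j] filled by the balls of level [3 l], for points where
   [multimax] is small. *)
have Vex j : exists V, Dk j -> [/\ measurable V, V `<=` S j,
    mu V <= eta%:E * mu (S j) &
    forall y B, multimax f y <= (ga * l)%:E -> oscball f (3 * l) B -> B y ->
      B `<=` S j -> V y].
  have [Dj|nDj] := pselect (Dk j); last by exists set0 => /nDj.
  have [[y0 Sy0 My0]|nz] := pselect (exists2 z, S j z & multimax f z <= (ga * l)%:E); last first.
    exists set0 => _; split => //; first by rewrite measure0 mule_ge0// lee_fin ltW.
    by move=> y B My oB By BS; apply: nz; exists y => //; exact: BS.
  have Lg := Lr_restr r1 Lf (mB (bS' _ Dj)).
  have [W [mW OW muW]] := Ho _ Lg l l0.
  exists (W `&` S j) => _; split.
  - by apply: measurableI => //; apply: mB; exact: bS.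
  - exact: subIsetr.
  - have [s s0 sE] := ball_fineE hBB (bS' _ Dj).
    have [b b0 bE] := ball_fineE hBB (bS _ Dj).
    have sb : (s <= C0 * b)%R.
      by rewrite -lee_fin EFinM -bE -sE; apply: (enl_measure hE); exact: bS.
    apply: (@le_trans _ _ (mu W)).
      by apply: le_measure; rewrite ?inE//; apply: measurableI => //; apply: mB; exact: bS.
    apply: (le_trans muW); rewrite (prod_Lrnorm_restr r1 Lf (mB (bS' _ Dj)) s0 sE).
    set a := ravg mu r f _.
    have al : (a <= grid_const * (ga * l))%R.
      have yS : star (S j) y0 by apply: (ball_star hBB hE (bS _ Dj)).
      rewrite -lee_fin; apply: (le_trans (ravg_le_multimax Lf (bS' _ Dj) yS)).
      by rewrite [leRHS]EFinM lee_wpmul2l// lee_fin ltW.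
    have a0 : (0 <= a)%R by exact: ravg_ge0.
    rewrite bE -EFinM lee_fin.
    have -> : (a * s `^ (m%:R / r) / l = a / l * s `^ (m%:R / r))%R by ring.
    rewrite powRM ?powR_ge0 ?divr_ge0 ?(ltW l0)// -powRrM.
    rewrite (_ : m%:R / r * q = 1)%R; last by rewrite /q; field; rewrite !gt_eqF.
    rewrite powRr1 ?(ltW s0)//.
    apply: (@le_trans _ _ (Co * ((grid_const * ga) `^ q * (C0 * b)))%R).
      rewrite ler_pM2l//; apply: ler_pM => //; rewrite ?powR_ge0 ?(ltW s0)//.
      apply: ge0_ler_powR; first exact: ltW.
      - by rewrite nnegrE divr_ge0// ltW.
      - by rewrite nnegrE mulr_ge0// ltW.
      - by rewrite ler_pdivrMr// -mulrA.
    rewrite (_ : Co * ((grid_const * ga) `^ q * (C0 * b)) = Co * (grid_const * ga) `^ q * C0 * b)%R; last by ring.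
    by rewrite ler_pM2r.
  - move=> y B My [bB [z Bz lz]] By BS.
    have BSS : star B `<=` star (S j) by apply: (enl_mono hE) => //; exact: bS.
    split; last exact: BS.
    apply: OW; exists B => //; split => //; exists z => //.
    rewrite restr_restr//.
    have [x [[oBj Bjx] maxBj]] := DF _ Dj.
    have d2 := stopping_ball Lf l0 ga1 oBj Bjx (fun B' o b => maxBj B' (conj o b))
       Sy0 My0 (BS _ Bz).
    rewrite ltNge; apply/negP => d3; move: lz; apply/negP; rewrite -leNgt.
    have -> : (cT f z - cT (restr f (star B)) z =
      (cT f z - cT (restr f (star (S j))) z) +
      (cT (restr f (star (S j))) z - cT (restr f (star B)) z))%R.
      by rewrite addrA subrK.
    apply: (le_trans (ler_normD _ _)); rewrite (_ : 3 * l = 2 * l + l)%R; last by ring.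
    exact: lerD.
have [V_ HV] := choice Vex.
pose V' j := if `[< Dk j >] then V_ j else set0.
pose B' j := if `[< Dk j >] then B_ j else set0.
have mV' j : measurable (V' j) by rewrite /V'; case: asboolP => // /HV[].
have mB' j : measurable (B' j) by rewrite /B'; case: asboolP => // /bBj/mB.
have tB' : trivIset setT B'.
  move=> i j _ _; rewrite /B'; case: asboolP => Di; case: asboolP => Dj.
  - exact: tB.
  - by rewrite setI0 => -[].
  - by rewrite set0I => -[].
  - by rewrite set0I => -[].
pose M := [set x | (ga * l)%:E < multimax f x].
have mM : measurable M by apply: measurable_gt; exact: measurable_multimax.
have mUV : measurable (\bigcup_j V' j) by exact: bigcupT_measurable.
exists (M `|` \bigcup_j V' j); split; first exact: measurableU.
  move=> y [B oB By]; have [My|My] := leP (multimax f y) (ga * l)%:E; last by left.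
  right; have oB1 : oscball f l B.
    case: oB => bB [z Bz lz]; split => //; exists z => //; apply: lt_trans lz.
    by rewrite ltr_pMl// ltr1n.
  have [|By' FBy [[oBy Byy] maxBy]] := Fex y; first by exists B.
  have [j Dj [BjB lej]] := FBj _ FBy.
  exists j => //; rewrite /V' asboolT//; have [_ _ _] := HV j Dj; apply; [exact: My|exact: oB|by []|].
  have bBy := oBy.1; have bB := oB.1.
  have sub1 : B `<=` star By'.
    by apply: (sub_star hE bBy bB); [exists y|apply: maxBy; split].
  apply: (subset_trans sub1); apply: (enl_mono hE) => //.
    by apply: (enl_ball hE); exact: bBj.
  by apply: (sub_star hE (bBj _ Dj) bBy).
apply: (le_trans (measureU2 _ _ _)) => //; apply: leeD => //.
have mUV0 := @subset_refl _ (\bigcup_j V' j).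
apply: (le_trans (measure_sigma_subadditive sg mV' mUV mUV0)).
apply: (@le_trans _ _ (\sum_(j <oo) (D ^+ 2 * eps)%:E * sg (B' j))).
  apply: lee_nneseries => j _; first by [].
  rewrite /V' /B'; case: asboolP => Dj; last by rewrite !measure0 mule0.
  have [mV VS muV _] := HV _ Dj.
  apply: (le_trans (small _ _ (bS _ Dj) mV VS muV)).
  rewrite mulrC EFinM -muleA lee_wpmul2l//.
  apply: (le_trans (dbl_le dsg (enl_ball hE (bBj _ Dj)))).
  have -> : (D ^+ 2)%:E = D%:E * D%:E by rewrite -EFinM expr2.
  rewrite -muleA lee_wpmul2l//; exact: (dbl_le dsg (bBj _ Dj)).
have De0 : (0 <= D ^+ 2 * eps)%R by rewrite mulr_ge0// exprn_ge0.
rewrite nneseriesZl//.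
rewrite lee_wpmul2l// -measure_semi_bigcup//; last exact: bigcupT_measurable.
apply: le_measure; rewrite ?inE//; first exact: bigcupT_measurable.
move=> x [j _]; rewrite /B'; case: asboolP => // Dj Bx; apply: OU.
by have [y [[oBj _] _]] := DF _ Dj; exists (B_ j).
Qed.

(** Otherwise some ball [B] would have more than half of its measure in the
    exceptional set.  It is not in [oscball f l], so on that part
    [|cT (f 1_(star B))|] exceeds [l], while the average of [f] on [star B] is
    at most a small multiple of [l]; by [local_weak] this happens on at most a
    quarter of [B]. *)
Lemma control_off_Omega : exists2 gb : R, (0 < gb)%R & forall f (l : R) U,
  Lr mu r f -> (0 < l)%R -> measurable U -> Omega f l `<=` U ->
  mu ([set x | (2 * l < t f x)%R] `\` (U `|` [set x | (gb * l)%:E < multimax f x])) = 0.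
Proof.
have [Cl Cl0 Hl] := @local_weak (4^-1) (ltac:(by rewrite invr_gt0)).
have KG0 := grid_const_gt0.
exists (Cl * grid_const)^-1%R; first by rewrite invr_gt0 mulr_gt0.
set gb := ((Cl * grid_const)^-1)%R => f l U Lf l0 mU OU.
set E := _ `\` _; have mE : measurable E.
  apply: measurableD; first exact: measurable_t_gt.
  by apply: measurableU => //; apply: measurable_gt; exact: measurable_multimax.
apply/eqP; rewrite eq_le measure_ge0 andbT leNgt; apply/negP => E0.
have [B bB hB] := density_ball hBB hE mE E0.
have bS := enl_ball hE bB.
have sub : B `&` E `<=` [set x | (Cl * ravg mu r f (star B) < t (restr f (star B)) x)%R].
  move=> x [Bx [/= lt nUx]].
  have nOx : ~ oscball f l B by move=> oB; apply: nUx; left; apply: OU; exists B.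
  have d1 := oscball_le bB Bx nOx.
  have Mx : multimax f x <= (gb * l)%:E.
    by rewrite leNgt; apply/negP => Mx; apply: nUx; right.
  have av : (ravg mu r f (star B) <= grid_const * (gb * l))%R.
    rewrite -lee_fin; apply: (le_trans (ravg_le_multimax Lf bS (ball_star hBB hE bB Bx))).
    by rewrite [leRHS]EFinM lee_wpmul2l// lee_fin ltW.
  have av' : (Cl * ravg mu r f (star B) <= l)%R.
    apply: (@le_trans _ _ (Cl * (grid_const * (gb * l)))%R); first by rewrite ler_pM2l.
    by rewrite /gb; apply: eqle; field; rewrite !gt_eqF.
  apply: (le_lt_trans av').
  have := ler_normD (cT f x - cT (restr f (star B)) x)%R (cT (restr f (star B)) x).
  rewrite subrK; move: lt d1; rewrite /t; lra.
have mW := measurable_t_gt (Cl * ravg mu r f (star B))%R (Lr_restr r1 Lf (mB bS)).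
have [b b0 bE] := ball_fineE hBB bB.
have small : mu (B `&` E) <= (4^-1 * b)%:E.
  rewrite EFinM -bE; apply: le_trans (Hl _ _ bB Lf); apply: le_measure; rewrite ?inE//.
  by apply: measurableI => //; exact: mB.
have fin : mu (B `&` E) \is a fin_num.
  by rewrite ge0_fin_numE// (le_lt_trans small)// ltry.
move: hB small; rewrite bE -(fineK fin) -EFinM lte_fin lee_fin; lra.
Qed.

(** The good-lambda inequality is iterated from the level [l / 3 ^ k] up to
    [l].  The initial term, of order [kap ^ k] times [sg] of the set at level
    [l / 3 ^ k], tends to 0 because [sg] is at most a multiple of [mu] and
    [kap 3 ^ q <= 1 / 2]. *)
Lemma distribution_bound (D eps eta : R) : (0 <= D)%R -> (0 <= eps)%R -> (0 < eta)%R ->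
  (D ^+ 2 * eps * 3 `^ q <= 2^-1)%R ->
  exists2 c : R, (0 < c)%R & forall sg : {measure set X -> \bar R},
  doubling BB star sg D ->
  (forall B A, BB B -> measurable A -> A `<=` B ->
     mu A <= eta%:E * mu B -> sg A <= eps%:E * sg B) ->
  (exists b : R, forall A, measurable A -> sg A <= b%:E * mu A) ->
  forall f (l : R), Lr mu r f -> (0 < l)%R ->
  sg [set x | (2 * l < t f x)%R] <=
    2%:E * \sum_(j <oo) ((D ^+ 2 * eps) ^+ j)%:E *
       sg [set x | (c * l / 3 ^+ j)%:E < multimax f x].
Proof.
move=> D0 eps0 eta0 kq; have [ga ga0 Hga] := good_lambda D0 eps0 eta0.
have [gb gb0 Hgb] := control_off_Omega; have [Co Co0 Ho] := Omega_weak.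
pose c : R := Num.min (ga / 3)%R gb; have c0 : (0 < c)%R by rewrite lt_min divr_gt0.
exists c => // sg dsg small [b sgb] f l Lf l0.
set kap := (D ^+ 2 * eps)%R in kq *.
have kap0 : (0 <= kap)%R by rewrite mulr_ge0// exprn_ge0.
have mM (s : R) : measurable [set x | s%:E < multimax f x].
  by apply: measurable_gt; exact: measurable_multimax.
have iter k (L : R) U : (0 < L)%R -> measurable U -> Omega f (L / 3 ^+ k) `<=` U ->
    exists U', [/\ measurable U', Omega f L `<=` U' &
    sg U' <= \sum_(0 <= j < k) (kap ^+ j)%:E *
       sg [set x | (c * L / 3 ^+ j)%:E < multimax f x] + (kap ^+ k)%:E * sg U].
  elim: k L U => [|k IH] L U L0 mU OU.
    exists U; split => //; first by rewrite expr0 divr1 in OU.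
    by rewrite big_nil add0e expr0 mul1e.
  have Lk0 : (0 < L / 3 ^+ k.+1)%R by rewrite divr_gt0// exprn_gt0.
  have [U1 [mU1 OU1 sU1]] := Hga sg dsg small f _ U Lf Lk0 mU OU.
  have [|U' [mU' OU' sU']] := IH L U1 L0 mU1.
    move: OU1; rewrite (_ : 3 * (L / 3 ^+ k.+1) = L / 3 ^+ k)%R//.
    by rewrite exprS; field; rewrite expf_neq0.
  exists U'; split => //; apply: (le_trans sU').
  rewrite big_nat_recr//= -addeA leeD2l//.
  apply: (@le_trans _ _ ((kap ^+ k)%:E * (sg [set x | (ga * (L / 3 ^+ k.+1))%:E < multimax f x]
      + kap%:E * sg U))).
    by rewrite lee_wpmul2l// lee_fin exprn_ge0.
  rewrite ge0_muleDr// ?mule_ge0//; apply: leeD; last first.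
    by rewrite muleA -EFinM exprSr.
  rewrite lee_wpmul2l// ?lee_fin ?exprn_ge0//; apply: le_measure; rewrite ?inE//.
  move=> x /=; apply: le_lt_trans; rewrite lee_fin.
  rewrite (_ : ga * (L / 3 ^+ k.+1) = ga / 3 * L / 3 ^+ k)%R; last first.
    by rewrite exprS; field; rewrite expf_neq0.
  by rewrite ler_pM2r ?invr_gt0 ?exprn_gt0// ler_pM2r// ge_min lexx.
pose S := \sum_(j <oo) (kap ^+ j)%:E *
    sg [set x | (c * l / 3 ^+ j)%:E < multimax f x].
rewrite -/S; have t0S (j : nat) : 0 <= (kap ^+ j)%:E *
    sg [set x | (c * l / 3 ^+ j)%:E < multimax f x].
  by rewrite mule_ge0// lee_fin exprn_ge0.
have S0 : 0 <= S by apply: nneseries_ge0 => j _ _; exact: t0S.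
have Oe e : (0 < e)%R -> exists U', [/\ measurable U', Omega f l `<=` U' &
    sg U' <= S + e%:E].
  move=> e0; pose N := (`|b| * (Co * ((\prod_(i < m) Lrnorm mu r f i) / l) `^ q))%R.
  have PP0 : (0 <= \prod_(i < m) Lrnorm mu r f i)%R.
    by apply: prodr_ge0 => i _; exact: Lrnorm_ge0.
  have N0 : (0 <= N)%R by rewrite !mulr_ge0 ?powR_ge0// ltW.
  pose k := Num.bound (N / e).
  have lk0 : (0 < l / 3 ^+ k)%R by rewrite divr_gt0// exprn_gt0.
  have [U [mU OU muU]] := Ho f Lf _ lk0.
  have [U' [mU' OU' sU']] := iter k l U l0 mU OU.
  exists U'; split => //; apply: (le_trans sU'); apply: leeD.
    by apply: nneseries_lim_ge => j _ _.
  apply: (@le_trans _ _ ((kap ^+ k)%:E * (`|b|%:E * mu U))).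
    rewrite lee_wpmul2l ?lee_fin ?exprn_ge0//; apply: (le_trans (sgb _ mU)).
    by rewrite lee_wpmul2r// lee_fin ler_norm.
  apply: (@le_trans _ _ ((kap ^+ k)%:E * (`|b|%:E * (Co * ((\prod_(i < m) Lrnorm mu r f i) / (l / 3 ^+ k)) `^ q)%:E))).
    by rewrite lee_wpmul2l ?lee_fin ?exprn_ge0// lee_wpmul2l.
  rewrite -!EFinM lee_fin.
  have -> : ((\prod_(i < m) Lrnorm mu r f i) / (l / 3 ^+ k) =
     (\prod_(i < m) Lrnorm mu r f i) / l * 3 ^+ k)%R.
    by rewrite invfM invrK mulrA.
  rewrite powRM ?exprn_ge0 ?divr_ge0 ?(ltW l0)//.
  have -> : ((3 ^+ k) `^ q = (3 `^ q) ^+ k :> R)%R.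
    by rewrite -(powR_mulrn k (powR_ge0 3 q)) -(powR_mulrn k (ler0n R 3)) powRAC.
  have alg (a1 b1 c1 z1 w1 : R) :
      (a1 * (b1 * (c1 * (z1 * w1))) = a1 * w1 * (b1 * (c1 * z1)))%R by ring.
  set z := ((_ / l) `^ q)%R.
  have -> : (kap ^+ k * (`|b| * (Co * (z * (3 `^ q) ^+ k))) =
      (kap * 3 `^ q) ^+ k * (`|b| * (Co * z)))%R.
    by rewrite [X in (_ = X * _)%R]exprMn alg.
  rewrite -/N; apply: (@le_trans _ _ (2^-1 ^+ k * N)%R).
    by rewrite ler_wpM2r// lerXn2r ?nnegrE ?mulr_ge0 ?powR_ge0.
  rewrite exprVn mulrC ler_pdivrMr ?exprn_gt0// mulrC -ler_pdivrMr//.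
  apply: (@le_trans _ _ k%:R%R); first by rewrite ltW// archi_boundP// divr_ge0// ltW.
  by rewrite -natrX ler_nat ltnW// ltn_expl.
have main e : (0 < e)%R -> sg [set x | (2 * l < t f x)%R] <= 2%:E * S + e%:E.
  move=> e0; have [U [mU OU sU]] := Oe e e0.
  have mt2 := measurable_t_gt (2 * l)%R Lf.
  pose W := U `|` [set x | (gb * l)%:E < multimax f x].
  have mW : measurable W by exact: measurableU.
  have sub : [set x | (2 * l < t f x)%R] `<=` ([set x | (2 * l < t f x)%R] `\` W) `|` W.
    by move=> x tx; case: (pselect (W x)) => Wx; [right|left].
  have mD : measurable ([set x | (2 * l < t f x)%R] `\` W) by exact: measurableD.
  apply: (@le_trans _ _ (sg ([set x | (2 * l < t f x)%R] `\` W) + sg W)).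
    apply: le_trans (measureU2 _ _ _) => //.
    by apply: le_measure; rewrite ?inE//; exact: measurableU.
  have -> : sg ([set x | (2 * l < t f x)%R] `\` W) = 0.
    apply/eqP; rewrite eq_le measure_ge0 andbT; apply: (le_trans (sgb _ mD)).
    by rewrite Hgb// mule0.
  rewrite add0e; apply: (le_trans (measureU2 _ _ _)) => //.
  have -> : 2%:E * S = S + S by rewrite (_ : 2 = 1 + 1)%R// EFinD ge0_muleDl// mul1e.
  rewrite -[leRHS]addeA [leRHS]addeC.
  apply: leeD => //.
  apply: le_trans (nneseries_ge 0%N t0S); rewrite expr0 mul1e expr0 divr1.
  apply: le_measure; rewrite ?inE//; move=> x /=; apply: le_lt_trans.
  by rewrite lee_fin ler_pM2r// ge_min lexx orbT.
by apply/lee_addgt0Pr => e e0; exact: main.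
Qed.

(** Integrate [distribution_bound] against the dyadic layers; the sum over [j]
    converges because of the smallness of [D ^ 2 eps 3 ^ q]. *)
Lemma coifman_fefferman (D eps eta dl : R) : (0 <= D)%R -> (0 <= eps)%R ->
  (0 < eta)%R -> (D ^+ 2 * eps * 3 `^ q <= 2^-1)%R -> (0 < dl)%R -> (dl <= q)%R ->
  exists2 C : R, (0 < C)%R & forall sg : {measure set X -> \bar R},
  doubling BB star sg D ->
  (forall B A, BB B -> measurable A -> A `<=` B ->
     mu A <= eta%:E * mu B -> sg A <= eps%:E * sg B) ->
  (exists b : R, forall A, measurable A -> sg A <= b%:E * mu A) ->
  forall f (t0 : R), Lr mu r f -> (0 < t0)%R ->
  \int[sg]_(x in [set x | t0%:E < (t f x)%:E]) (t f x)%:E `^ dl <=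
    C%:E * \int[sg]_x multimax f x `^ dl.
Proof.
move=> D0 eps0 eta0 kq dl0 dlq.
have [c c0 Hc] := distribution_bound D0 eps0 eta0 kq.
set kap := (D ^+ 2 * eps)%R in kq Hc.
have kap0 : (0 <= kap)%R by rewrite mulr_ge0// exprn_ge0.
have kdl : (kap * 3 `^ dl <= 2^-1)%R.
  by apply: le_trans kq; rewrite ler_wpM2l// ler_powR// ler1n.
pose K : R := (2 * (4 / c) `^ dl)%R.
have K0 : (0 < K)%R by rewrite mulr_gt0// powR_gt0// divr_gt0.
pose Cd : R := (2 `^ dl / (2 `^ dl - 1))%R.
have Cd0 : (0 < Cd)%R by rewrite divr_gt0 ?powR_gt0// subr_gt0 powR2_gt1.
exists (K * Cd * 2)%R; first by apply: mulr_gt0 => //; exact: mulr_gt0.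
move=> sg dsg small sgb f t0 Lf t00.
have mtE : measurable_fun [set: X] (EFin \o t f) by apply/measurable_EFinP; exact: mt.
have mM := measurable_multimax f.
apply: (le_trans (@layer_upper _ _ _ sg (EFin \o t f) mtE t0 dl t00 dl0)).
pose s (j : nat) : R := (c * t0 / 2 / 3 ^+ j)%R.
have s0 j : (0 < s j)%R by rewrite !divr_gt0// ?mulr_gt0// exprn_gt0.
pose v (k j : nat) : \bar R := ((2 ^+ k * s j) `^ dl)%:E *
   sg [set x | (2 ^+ k * s j)%:E < multimax f x].
have v0 k j : 0 <= v k j by rewrite mule_ge0// lee_fin powR_ge0.
pose u (k j : nat) : \bar R := (K * 2^-1 ^+ j)%:E * v k j.
have u0 k j : 0 <= u k j.
  rewrite mule_ge0// lee_fin; apply: mulr_ge0; first exact: ltW.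
  by rewrite exprn_ge0// invr_ge0.
apply: (@le_trans _ _ (\sum_(k <oo) \sum_(j <oo) u k j)).
  apply: lee_nneseries => k _; first by rewrite mule_ge0// lee_fin powR_ge0.
  have l0 : (0 < 2 ^+ k * t0 / 2)%R by rewrite divr_gt0// mulr_gt0// exprn_gt0.
  have := Hc sg dsg small sgb f _ Lf l0.
  rewrite (_ : 2 * (2 ^+ k * t0 / 2) = 2 ^+ k * t0)%R; last by rewrite mulrC divfK.
  have -> : [set x | (2 ^+ k * t0)%:E < (EFin \o t f) x] =
      [set x | (2 ^+ k * t0 < t f x)%R].
    by apply/seteqP; split => x /=; rewrite lte_fin.
  have p0 : (0 <= (2 ^+ k.+1 * t0) `^ dl)%R by exact: powR_ge0.
  move=> H; apply: (le_trans (lee_wpmul2l _ H)); first by rewrite lee_fin.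
  rewrite muleA -EFinM -nneseriesZl; last first.
    by move=> j _; rewrite mule_ge0// lee_fin exprn_ge0.
  apply: lee_nneseries => j _.
    by rewrite !mule_ge0// lee_fin ?exprn_ge0// mulr_ge0.
  have -> : (c * (2 ^+ k * t0 / 2) / 3 ^+ j = 2 ^+ k * s j)%R.
    by rewrite /s !mulrA; congr (_ / _)%R; rewrite [(c * _)%R]mulrC -!mulrA.
  rewrite /u /v !muleA -!EFinM; apply: lee_wpmul2r => //; rewrite lee_fin.
  have -> : (2 ^+ k.+1 * t0 = 4 / c * (3 ^+ j * (2 ^+ k * s j)))%R.
    have alg (a e : R) : (e != 0 -> 2 * a * t0 = 4 / c * (e * (a * (c * t0 / 2 / e))))%R.
      by move=> e0; field; rewrite e0 gt_eqF.
    by rewrite exprS (alg _ (3 ^+ j)%R) ?expf_neq0.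
  have sk0 : (0 <= 2 ^+ k * s j)%R by rewrite mulr_ge0 ?exprn_ge0// ltW.
  have c40 : (0 <= 4 / c)%R by rewrite divr_ge0// ltW.
  have j30 : (0 <= 3 ^+ j :> R)%R by rewrite exprn_ge0.
  rewrite (powRM dl c40 (mulr_ge0 j30 sk0)) (powRM dl j30 sk0).
  have -> : ((3 ^+ j) `^ dl = (3 `^ dl) ^+ j :> R)%R.
    by rewrite -(powR_mulrn j (powR_ge0 3 dl)) -(powR_mulrn j (ler0n R 3)) powRAC.
  move: sk0; set z := ((2 ^+ k * s j) `^ dl)%R => _.
  have z0 : (0 <= z)%R by exact: powR_ge0.
  have alg (a1 b1 c1 e1 : R) : (a1 * (b1 * e1) * 2 * c1 = 2 * a1 * (c1 * b1) * e1)%R by ring.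
  rewrite alg; apply: ler_wpM2r => //.
  rewrite -/K ler_pM2l// -[X in (X <= _)%R]exprMn.
  apply: lerXn2r => //; rewrite nnegrE ?invr_ge0//.
  by rewrite mulr_ge0 ?powR_ge0.
rewrite nneseries_interchange//.
pose I := \int[sg]_x multimax f x `^ dl.
have I0 : 0 <= I by apply: integral_ge0 => x _; exact: poweR_ge0.
have KC0 : (0 <= K * Cd)%R by apply: mulr_ge0; exact: ltW.
apply: (@le_trans _ _ (\sum_(j <oo) (K * Cd * 2^-1 ^+ j)%:E * I)).
  apply: lee_nneseries => j _; first by move=> _; apply: nneseries_ge0.
  rewrite nneseriesZl//.
  have := @layer_lower _ _ _ sg (multimax f) mM (s j) dl (s0 j) dl0 (multimax_ge0 f).
  rewrite -/I -/Cd => H.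
  apply: (le_trans (lee_wpmul2l _ H)).
    rewrite lee_fin; apply: mulr_ge0; first exact: ltW.
    by rewrite exprn_ge0// invr_ge0.
  by rewrite muleA -EFinM mulrAC.
rewrite -/I; have [->|Ine] := eqVneq I +oo.
  have K2 : (0 < K * Cd * 2)%R by apply: mulr_gt0 => //; exact: mulr_gt0.
  by rewrite [leRHS]gt0_muley ?leey// lte_fin.
have IE : I = (fine I)%:E by rewrite fineK// ge0_fin_numE// ltey.
have -> : \sum_(j <oo) (K * Cd * 2^-1 ^+ j)%:E * I = I * \sum_(j <oo) (K * Cd * 2^-1 ^+ j)%:E.
  rewrite IE -nneseriesZl; first by apply: eq_eseriesr => j _; rewrite muleC.
  by move=> j _; rewrite lee_fin mulr_ge0// exprn_ge0// invr_ge0.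
rewrite muleC lee_wpmul2r//.
have h01 : (0 <= (2^-1 : R) < 1)%R by rewrite invr_ge0 ler0n/= invf_lt1// ltr1n.
apply: (le_trans (@geometric_le R (K * Cd)%R 2^-1%R KC0 h01)).
by rewrite lee_fin; apply: eqle; field.
Qed.

End operator.

(** * Products of weights *)
Section weights.
Context {d : measure_display} {X : measurableType d} {R : realType}.
Variables (mu : {measure set X -> \bar R}) (BB : set (set X)).
Variables (star : set X -> set X) (C0 : R).
Hypothesis hBB : ball_basis mu BB star.
Hypothesis hE : enlargement mu BB star C0.

Let C00 : (0 < C0)%R. Proof. exact: lt_le_trans (enl_ge1 hE). Qed.
Let mB B : BB B -> measurable B. Proof. exact: (bb_measurable hBB). Qed.

(** The [A_p] condition with [y = 1 / (p - 1)], raised to the power [y]. *)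
Definition muckenhoupt (v : X -> R) (y A : R) : Prop := forall B (b : R), BB B ->
  mu B = b%:E -> exists N N' : R, [/\ (0 < N)%R /\ (0 < N')%R,
    \int[mu]_(x in B) (v x)%:E = N%:E,
    \int[mu]_(x in B) (v x `^ (- y))%:E = N'%:E &
    (N `^ y * N' <= A * b `^ (1 + y))%R].

(** The [A_1] condition for the power [u ^ s], with integrals over the ball in
    place of means. *)
Definition A1_power (u : X -> R) (s C : R) : Prop := forall B (b : R), BB B ->
  mu B = b%:E -> exists J : R, [/\ (0 < J)%R,
    \int[mu]_(x in B) (u x `^ s)%:E = J%:E &
    {ae mu, forall x, B x -> (J <= C * b * u x `^ s)%R}].

Lemma measurable_powRF (f : X -> R) (a : R) (D : set X) :
  measurable_fun [set: X] f -> measurable_fun D (fun x => (f x `^ a)%R).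
Proof.
move=> mf; apply: measurable_funTS.
exact: (@measurableT_comp _ _ _ _ _ _ (fun x => x `^ a)%R).
Qed.

Lemma integral_powR_ge0 (f : X -> R) (a : R) (B : set X) :
  0 <= \int[mu]_(x in B) (f x `^ a)%:E.
Proof. by apply: integral_ge0 => x _; rewrite lee_fin powR_ge0. Qed.

Lemma ge0_integral_sub (f : X -> R) (A B : set X) : measurable A -> measurable B ->
  measurable_fun [set: X] f -> (forall x, (0 <= f x)%R) -> A `<=` B ->
  \int[mu]_(x in A) (f x)%:E <= \int[mu]_(x in B) (f x)%:E.
Proof.
move=> mA mB' mf f0 AB; apply: ge0_subset_integral => //.
  by apply/measurable_EFinP/measurable_funTS.
by move=> x _; rewrite lee_fin.
Qed.

Section product.
Variables (v u : X -> R) (x y s A C : R).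
Hypotheses (mv : measurable_fun [set: X] v) (mu_ : measurable_fun [set: X] u).
Hypotheses (v0 : forall x, (0 < v x)%R) (u0 : forall x, (0 < u x)%R).
Hypotheses (x0 : (0 < x)%R) (y0 : (0 < y)%R) (s0 : (0 < s)%R).
Hypotheses (A0 : (0 < A)%R) (Cp0 : (0 < C)%R).
Hypothesis xs1 : (x + s^-1 < 1)%R.
Hypothesis hv : muckenhoupt v y A.
Hypothesis hu : A1_power u s C.
Let e : R := (1 - x - s^-1)%R.
Let e0 : (0 < e)%R. Proof. by rewrite /e subr_gt0 ltrBrDl. Qed.
Let W z : R := (v z `^ x * u z)%R.

Let mW : measurable_fun [set: X] W.
Proof. by apply: measurable_funM => //; exact: measurable_powRF. Qed.

Let W0 z : (0 <= W z)%R.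
Proof. by rewrite mulr_ge0 ?powR_ge0// ltW. Qed.

(** Holder's inequality with exponents [x], [1 / s] and [e], the last one for
    the constant function. *)
Lemma product_upper B (b N J : R) E (a : R) : BB B -> mu B = b%:E ->
  \int[mu]_(x in B) (v x)%:E = N%:E -> \int[mu]_(x in B) (u x `^ s)%:E = J%:E ->
  measurable E -> E `<=` B -> mu E = a%:E -> (0 <= N)%R -> (0 <= J)%R ->
  \int[mu]_(z in E) (W z)%:E <= (N `^ x * J `^ s^-1 * a `^ e)%:E.
Proof.
move=> bB bE NE JE mE EB aE N0 J0.
have s10 : (0 < s^-1)%R by rewrite invr_gt0.
have H := @holder_three _ _ _ mu E v (fun z => u z `^ s)%R (cst 1%R) x s^-1 e
  mE mv (measurable_powRF s mu_) (measurable_cst _) (fun z => ltW (v0 z))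
  (fun z => powR_ge0 _ _) (fun z => ler01) x0 s10 e0 _.
apply: le_trans (le_trans (H _) _).
- apply: eqle; apply: eq_integral => z _.
  rewrite /= powR1 mulr1 -powRrM mulfV ?gt_eqF// powRr1 ?ltW//.
- by rewrite /e; ring.
- have IN : \int[mu]_(z in E) (v z)%:E <= N%:E.
    by rewrite -NE; apply: ge0_integral_sub => // [|z]; [exact: mB|exact: ltW].
  have IJ : \int[mu]_(z in E) (u z `^ s)%:E <= J%:E.
    rewrite -JE; apply: ge0_integral_sub => //; first exact: mB.
    exact: measurable_powRF.
    by move=> z; exact: powR_ge0.
  have I1 : \int[mu]_(z in E) (cst 1%R z)%:E = a%:E.
    by rewrite /= integral_cst// mul1e.
  rewrite I1 poweR_EFin !EFinM -!poweR_EFin; apply: lee_wpmul2r.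
    exact: poweR_ge0.
  apply: lee_pmul; try exact: poweR_ge0.
  + apply: poweR_le => //; first exact: ltW.
    by apply: integral_ge0 => z _; rewrite lee_fin ltW.
  + apply: poweR_le => //; first exact: ltW.
    exact: integral_powR_ge0.
Qed.

Definition product_const : R := (C `^ (- s^-1) * A `^ (- (x / y)))%R.

Lemma product_const_gt0 : (0 < product_const)%R. Proof. by rewrite mulr_gt0// powR_gt0. Qed.

(** The [A_1] condition bounds [u] from below by its mean, and Holder's
    inequality for [1 = v ^ (x al) v ^ (- y be)], with [al = y / (x + y)] and
    [be = x / (x + y)], bounds the integral of [v ^ x] from below. *)
Lemma product_lower B (b N N' J : R) E (a : R) : BB B -> mu B = b%:E -> (0 < b)%R ->
  \int[mu]_(x in B) (v x `^ (- y))%:E = N'%:E ->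
  (0 < N)%R -> (0 < N')%R -> (N `^ y * N' <= A * b `^ (1 + y))%R ->
  (0 < J)%R -> {ae mu, forall x, B x -> (J <= C * b * u x `^ s)%R} ->
  measurable E -> E `<=` B -> mu E = a%:E -> (0 < a)%R ->
  (product_const * (N `^ x * J `^ s^-1 * b `^ e) * (a / b) `^ (1 + x / y))%:E <=
  \int[mu]_(z in E) (W z)%:E.
Proof.
move=> bB bE b0 N'E N0 N'0 NN J0 aeJ mE EB aE a0.
have s10 : (0 < s^-1)%R by rewrite invr_gt0.
pose k : R := ((J / (C * b)) `^ s^-1)%R.
have Cb0 : (0 < C * b)%R by rewrite mulr_gt0.
have k0 : (0 < k)%R by rewrite powR_gt0// divr_gt0.
pose I := \int[mu]_(z in E) (v z `^ x)%:E.
have I0 : 0 <= I by exact: integral_powR_ge0.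
have step1 : k%:E * I <= \int[mu]_(z in E) (W z)%:E.
  rewrite -ge0_integralZl//; last 3 first.
  - by apply/measurable_EFinP; exact: measurable_powRF.
  - by move=> z _; rewrite lee_fin powR_ge0.
  - by rewrite lee_fin ltW.
  apply: ae_ge0_le_integral => //.
  - by move=> z _; rewrite -EFinM lee_fin mulr_ge0 ?powR_ge0.
  - by apply: measurable_funeM; apply/measurable_EFinP; exact: measurable_powRF.
  - by move=> z _; rewrite lee_fin.
  - by apply/measurable_EFinP/measurable_funTS.
  - apply: filterS aeJ => z Jz Ez; rewrite -EFinM lee_fin mulrC ler_wpM2l ?powR_ge0//.
    have le1 : (J / (C * b) <= u z `^ s)%R.
      by rewrite ler_pdivrMr// mulrC; apply: Jz; exact: EB.
    have le2 : (k <= (u z `^ s) `^ s^-1)%R.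
      apply: ge0_ler_powR => //; first exact: ltW.
      - by rewrite nnegrE divr_ge0// ltW.
      - by rewrite nnegrE powR_ge0.
    by move: le2; rewrite -powRrM mulfV ?gt_eqF// powRr1//; exact: ltW.
apply: le_trans step1; case: (eqVneq I +oo) => [->|Ine].
  by rewrite gt0_muley ?leey// lte_fin.
have IE : I = (fine I)%:E by rewrite fineK// ge0_fin_numE// ltey.
rewrite IE -EFinM lee_fin; set i := fine I.
pose al := (y / (x + y))%R; pose be := (x / (x + y))%R.
have xy0 : (0 < x + y)%R by rewrite addr_gt0.
have al0 : (0 < al)%R by rewrite divr_gt0.
have be0 : (0 < be)%R by rewrite divr_gt0.
have ab1 : (al + be = 1)%R by rewrite /al /be; field; rewrite gt_eqF.
have H := @holder_two _ _ _ mu E (fun z => v z `^ x)%R (fun z => v z `^ (- y))%R al be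
  mE (measurable_powRF _ mv) (measurable_powRF _ mv) (fun z => powR_ge0 _ _)
  (fun z => powR_ge0 _ _) al0 be0 ab1.
have {}H : (a <= i `^ al * N' `^ be)%R.
  rewrite -lee_fin; apply: le_trans (le_trans H _).
    rewrite -aE -[leLHS]mul1e -integral_cst//.
    apply: eqle; apply: eq_integral => z _ /=.
    have [l ->] := expR_ex (v0 z); rewrite !powR_expR -expRD -expR0.
    by congr (expR _)%:E; rewrite /al /be; field; rewrite gt_eqF.
  rewrite -/I IE EFinM -!poweR_EFin; apply: lee_wpmul2l; first exact: poweR_ge0.
  apply: poweR_le; [exact: ltW|exact: integral_powR_ge0|].
  rewrite -N'E; apply: ge0_integral_sub => //; first exact: mB.
    exact: measurable_powRF.
  by move=> z; exact: powR_ge0.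
have i0 : (0 < i)%R.
  rewrite lt_neqAle fine_ge0// andbT eq_sym; apply/eqP => i0.
  by move: H; rewrite -/i i0 powR0 ?gt_eqF// mul0r leNgt a0.
have [li ie] := expR_ex i0; have [la ae] := expR_ex a0.
have [lN Ne] := expR_ex N0; have [lN' N'e] := expR_ex N'0.
have [lJ Je] := expR_ex J0; have [lb be'] := expR_ex b0.
have [lA Ae] := expR_ex A0; have [lC Ce] := expR_ex Cp0.
move: H NN; rewrite /k /product_const ie ae Ne N'e Je be' Ae Ce.
rewrite -!expRN -?expRD !powR_expR -!expRN -?expRD !powR_expR -?expRD !ler_expR.
rewrite /al /be /e => H1 H2.
have H1' : (la * (x + y) <= y * li + x * lN')%R.
  have -> : (y * li + x * lN' = (y / (x + y) * li + x / (x + y) * lN') * (x + y))%R.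
    by field; rewrite gt_eqF.
  by rewrite ler_pM2r.
have H2' : (x * (y * lN + lN') <= x * (lA + (1 + y) * lb))%R by rewrite ler_pM2l.
rewrite -(ler_pM2r y0) -subr_ge0.
set L := (X in (0 <= X)%R).
have -> : L = (y * li + x * lN' - la * (x + y) +
   (x * (lA + (1 + y) * lb) - x * (y * lN + lN')))%R.
  by rewrite /L; field; rewrite !gt_eqF.
by rewrite addr_ge0// subr_ge0.
Qed.

Let ball_data B : BB B -> exists b N J M : R, [/\ (0 < b)%R, mu B = b%:E,
  (0 < N)%R, (0 < J)%R & (0 < M)%R] /\
  [/\ \int[mu]_(z in B) (v z)%:E = N%:E, \int[mu]_(z in B) (u z `^ s)%:E = J%:E,
    \int[mu]_(z in B) (W z)%:E = M%:E &
    forall E a, measurable E -> E `<=` B -> mu E = a%:E -> (0 < a)%R ->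
    (product_const * (N `^ x * J `^ s^-1 * b `^ e) * (a / b) `^ (1 + x / y))%:E <=
    \int[mu]_(z in E) (W z)%:E].
Proof.
move=> bB; have [b b0 bE] := ball_fineE hBB bB.
have [N [N' [[N0 N'0] NE N'E NN]]] := hv bB bE.
have [J [J0 JE aeJ]] := hu bB bE.
have low E a mE EB aE a0 :=
  @product_lower B b N N' J E a bB bE b0 N'E N0 N'0 NN J0 aeJ mE EB aE a0.
have up := @product_upper B b N J B b bB bE NE JE (mB bB) (@subset_refl _ B) bE
  (ltW N0) (ltW J0).
pose M := fine (\int[mu]_(z in B) (W z)%:E).
have ME : \int[mu]_(z in B) (W z)%:E = M%:E.
  rewrite /M fineK// ge0_fin_numE ?(le_lt_trans up) ?ltry//.
  by apply: integral_ge0 => z _; rewrite lee_fin.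
exists b, N, J, M; split; last by split.
split => //; rewrite -lte_fin -ME; apply: lt_le_trans (low B b (mB bB) (@subset_refl _ _) bE b0).
by rewrite lte_fin mulr_gt0 ?powR_gt0 ?divr_gt0 ?mulr_gt0 ?product_const_gt0 ?powR_gt0 ?invr_gt0.
Qed.

(** The bounds above and below differ by a power of the relative measure of the
    subset only, which is bounded below for a ball inside its enlargement. *)
Lemma product_doubling (W0' : forall x, (0 <= W x)%R) (mW' : measurable_fun [set: X] W) :
  doubling BB star (dens mu W0' mW') (product_const^-1 * C0 `^ (1 + x / y))%R.
Proof.
have lc := product_const_gt0.
split => B bB; rewrite /dens.
  by have [b [N [J [M [[b0 bE N0 J0 M0] [_ _ -> _]]]]]] := ball_data bB; rewrite lte_fin ltry M0.
have bS := enl_ball hE bB.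
have [b [N [J [M [[b0 bE N0 J0 M0] [NE JE ME low]]]]]] := ball_data bS.
have [a a0 aE] := ball_fineE hBB bB.
have BS := ball_star hBB hE bB.
have up := @product_upper (star B) b N J (star B) b bS bE NE JE (mB bS) (@subset_refl _ _) bE
  (ltW N0) (ltW J0).
have {}low := low _ _ (mB bB) BS aE a0.
have ba : (b <= C0 * a)%R.
  by rewrite -lee_fin EFinM -aE -bE; exact: (enl_measure hE).
have z0 : (0 <= 1 + x / y)%R by rewrite addr_ge0// divr_ge0// ltW.
set S := (N `^ x * J `^ s^-1 * b `^ e)%R in up low.
have S0 : (0 < S)%R by rewrite !mulr_gt0 ?powR_gt0.
apply: (le_trans up).
have [? [? [? [M1 [_ [_ _ M1E _]]]]]] := ball_data bB.
move: low; rewrite M1E -EFinM !lee_fin => low.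
rewrite -mulrA ler_pdivlMl//.
apply: le_trans (ler_wpM2l (powR_ge0 _ _) low).
rewrite [leRHS](_ : _ = product_const * S * (C0 `^ (1 + x / y) * (a / b) `^ (1 + x / y)))%R; last by ring.
apply: ler_peMr; first by rewrite mulr_ge0 ?ltW.
rewrite -powRM ?(ltW C00) ?divr_ge0 ?(ltW a0) ?(ltW b0)//.
have C0a : (1 <= C0 * (a / b))%R by rewrite mulrA ler_pdivlMr// mul1r.
have := ge0_ler_powR z0 _ _ C0a; rewrite powR1; apply; rewrite nnegrE//.
exact: le_trans C0a.
Qed.

(** The upper bound contains the factor [(mu A / mu B) ^ e]. *)
Lemma product_small (eps : R) (W0' : forall x, (0 <= W x)%R)
    (mW' : measurable_fun [set: X] W) : (0 < eps)%R ->
  forall B A', BB B -> measurable A' -> A' `<=` B ->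
  mu A' <= ((product_const * eps) `^ e^-1)%:E * mu B ->
  dens mu W0' mW' A' <= eps%:E * dens mu W0' mW' B.
Proof.
move=> eps0; have lc := product_const_gt0; move=> B E bB mE EB; rewrite /dens.
have [b [N [J [M [[b0 bE N0 J0 M0] [NE JE ME low]]]]]] := ball_data bB.
have Ef : mu E \is a fin_num.
  rewrite ge0_fin_numE//; apply: le_lt_trans (ltry b); rewrite -bE.
  by apply: le_measure; rewrite ?inE//; exact: mB.
have aE : mu E = (fine (mu E))%:E by rewrite fineK.
move: aE; set a := fine _ => aE.
have a0 : (0 <= a)%R by rewrite -lee_fin -aE.
rewrite bE aE -EFinM lee_fin => ae.
have up := @product_upper B b N J E a bB bE NE JE mE EB aE
  (ltW N0) (ltW J0).
have {}low := low _ _ (mB bB) (@subset_refl _ _) bE b0.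
apply: (le_trans up); apply: le_trans (lee_wpmul2l _ low); last by rewrite lee_fin ltW.
rewrite -EFinM lee_fin divff ?gt_eqF// powR1 mulr1.
rewrite [leRHS](_ : _ = N `^ x * J `^ s^-1 * (product_const * eps * b `^ e))%R; last by ring.
rewrite ler_wpM2l ?mulr_ge0 ?powR_ge0//.
have {}ae : (a `^ e <= ((product_const * eps) `^ e^-1 * b) `^ e)%R.
  apply: ge0_ler_powR; rewrite ?nnegrE//; first exact: ltW.
  by rewrite mulr_ge0 ?powR_ge0 ?ltW.
apply: (le_trans ae); rewrite powRM ?powR_ge0 ?(ltW b0)// -powRrM mulVf ?gt_eqF// powRr1//.
by rewrite ltW// mulr_gt0.
Qed.

End product.
End weights.

(** * The maximal operator on the dual weight *)
Section dual_weight.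
Context {d : measure_display} {X : measurableType d} {R : realType}.
Variables (mu : {measure set X -> \bar R}) (BB : set (set X)).
Variables (star : set X -> set X) (C0 : R).
Hypothesis hBB : ball_basis mu BB star.
Hypothesis hE : enlargement mu BB star C0.
Variable G : nat -> set X.
Hypothesis bG : forall n, BB (G n).
Hypothesis hG : forall B, BB B -> exists n, B `<=` G n /\ G n `<=` star (star B).
Let C00 : (0 < C0)%R. Proof. exact: lt_le_trans (enl_ge1 hE). Qed.
Let mB B : BB B -> measurable B. Proof. exact: (bb_measurable hBB). Qed.

Variables (v w : X -> R) (y s A C P0 p1 : R).
Hypotheses (mv : measurable_fun [set: X] v) (mw : measurable_fun [set: X] w).
Hypotheses (v0 : forall x, (0 < v x)%R) (w0 : forall x, (0 < w x)%R).
Hypotheses (y0 : (0 < y)%R) (s0 : (0 < s)%R) (p11 : (1 < p1)%R) (P01 : (1 < P0)%R).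
Hypotheses (A0 : (0 < A)%R) (Cp0 : (0 < C)%R).
Hypothesis hv : muckenhoupt mu BB v y A.
Hypothesis hw : A1_power mu BB w s C.
Let a' : R := ((p1 - 1) / (P0 * s))%R.
Let b' : R := (y * P0)^-1%R.
Hypothesis exps : (P0^-1 + (p1 - 1) / (P0 * s) + (y * P0)^-1 = 1)%R.
Let P00 : (0 < P0)%R. Proof. exact: lt_trans P01. Qed.
Let p0 : (0 < p1 - 1)%R. Proof. by rewrite subr_gt0. Qed.
Let a0 : (0 < a')%R. Proof. by rewrite divr_gt0// mulr_gt0. Qed.
Let b0 : (0 < b')%R. Proof. by rewrite invr_gt0 mulr_gt0. Qed.
Let O z : R := (w z `^ (1 - p1) * v z)%R.
Let K : R := (C `^ a' * A `^ b')%R.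
Let K0 : (0 < K)%R. Proof. by rewrite mulr_gt0// powR_gt0. Qed.

Let mO : measurable_fun [set: X] O.
Proof. by apply: measurable_funM => //; exact: measurable_powRF. Qed.

Let O0 z : (0 < O z)%R.
Proof. by rewrite mulr_gt0 ?powR_gt0. Qed.

Let O0' z : (0 <= O z)%R. Proof. exact: ltW. Qed.

(** The three exponents in [exps] are those of Holder's inequality for
    [phi = (phi ^ P0 O) ^ (1 / P0) (w ^ s) ^ a' (v ^ (- y)) ^ b'], where
    [O = w ^ (1 - p1) v]; the powers of [w] and of [v] cancel. The [A_1]
    condition bounds [o] by integrals of [w ^ s] and [v], and the condition on
    [v] then bounds the product of all the factors by a multiple of [b]. *)
Lemma dual_weight_ball S b : BB S -> mu S = b%:E -> (0 < b)%R ->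
  exists L o : R, [/\ (0 < L)%R, (0 < o)%R, \int[mu]_(z in S) (O z)%:E = o%:E,
   (o `^ P0^-1 * L <= K * b)%R &
   forall E (phi : X -> R), measurable E -> E `<=` S ->
    measurable_fun [set: X] phi -> (forall z, (0 <= phi z)%R) ->
    \int[mu]_(z in E) (phi z)%:E <=
    (\int[mu]_(z in E) (phi z `^ P0 * O z)%:E) `^ P0^-1 * L%:E].
Proof.
move=> bS bE bb0.
have [N [N' [[N0 N'0] NE N'E NN]]] := hv bS bE.
have [J [J0 JE aeJ]] := hw bS bE.
have L0 : (0 < J `^ a' * N' `^ b')%R by rewrite mulr_gt0 ?powR_gt0.
pose k : R := ((C * b / J) `^ ((p1 - 1) / s))%R.
have CbJ : (0 < C * b / J)%R by rewrite divr_gt0 ?mulr_gt0.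
have k0 : (0 < k)%R by rewrite powR_gt0.
have upO : \int[mu]_(z in S) (O z)%:E <= (k * N)%:E.
  rewrite EFinM -NE -ge0_integralZl; last 4 first.
  - exact: mB.
  - by apply/measurable_EFinP; exact: measurable_funTS.
  - by move=> z _; rewrite lee_fin ltW.
  - by rewrite lee_fin ltW.
  apply: ae_ge0_le_integral => //.
  - exact: mB.
  - by move=> z _; rewrite lee_fin.
  - by apply/measurable_EFinP/measurable_funTS.
  - by move=> z _; rewrite -EFinM lee_fin mulr_ge0// ltW.
  - by apply: measurable_funeM; apply/measurable_EFinP/measurable_funTS.
  apply: filterS aeJ => z Jz Sz; rewrite -EFinM lee_fin ler_wpM2r ?(ltW (v0 z))//.
  have {}Jz := Jz Sz.
  have le1 : ((C * b / J)^-1 <= w z `^ s)%R.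
    by rewrite invf_div ler_pdivrMr ?mulr_gt0// mulrC.
  have ci0 : (0 < (C * b / J)^-1)%R by rewrite invr_gt0.
  have le2 : (((C * b / J)^-1) `^ ((p1 - 1) / s) <= (w z `^ s) `^ ((p1 - 1) / s))%R.
    apply: ge0_ler_powR => //.
    - by rewrite divr_ge0// ltW.
    - by rewrite nnegrE ltW.
    - by rewrite nnegrE powR_ge0.
  move: le2; rewrite /k; have [l ->] := expR_ex CbJ; have [lw ->] := expR_ex (w0 z).
  rewrite -expRN !powR_expR !ler_expR.
  have -> : ((p1 - 1) / s * (s * lw) = (p1 - 1) * lw)%R by field; rewrite gt_eqF.
  by move=> H; rewrite -lerN2 -mulrN -mulNr opprB.
pose o := fine (\int[mu]_(z in S) (O z)%:E).
have oE : \int[mu]_(z in S) (O z)%:E = o%:E.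
  rewrite /o fineK// ge0_fin_numE ?(le_lt_trans upO) ?ltry//.
  by apply: integral_ge0 => z _; rewrite lee_fin.
have hold E (phi : X -> R) : measurable E -> E `<=` S ->
    measurable_fun [set: X] phi -> (forall z, (0 <= phi z)%R) ->
    \int[mu]_(z in E) (phi z)%:E <=
    (\int[mu]_(z in E) (phi z `^ P0 * O z)%:E) `^ P0^-1 * (J `^ a' * N' `^ b')%:E.
  move=> mE ES mphi phi0.
  have := @holder_three _ _ _ mu E (fun z => phi z `^ P0 * O z)%R (fun z => w z `^ s)%R
     (fun z => v z `^ (- y))%R P0^-1 a' b' mE
    (measurable_funM (measurable_powRF _ mphi) mO)
    (measurable_powRF _ mw) (measurable_powRF _ mv)
    (fun z => mulr_ge0 (powR_ge0 _ _) (O0' z)) (fun z => powR_ge0 _ _)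
    (fun z => powR_ge0 _ _).
  rewrite invr_gt0 => /(_ P00 a0 b0 exps) H.
  apply: le_trans (le_trans H _).
    apply: eqle; apply: eq_integral => z _.
    rewrite powRM ?powR_ge0// -powRrM mulfV ?gt_eqF// powRr1// /O; congr EFin.
    rewrite -[LHS]mulr1 -!mulrA; congr (_ * _)%R.
    have [lv ->] := expR_ex (v0 z); have [lw ->] := expR_ex (w0 z).
    rewrite !powR_expR -!expRD powR_expR -!expRD -[LHS]expR0; congr expR.
    by rewrite /a' /b'; field; rewrite !gt_eqF.
  rewrite -muleA; apply: lee_wpmul2l; first exact: poweR_ge0.
  rewrite EFinM -!poweR_EFin; apply: lee_pmul; try exact: poweR_ge0.
    apply: poweR_le; [exact: ltW|exact: integral_powR_ge0|].
    rewrite -JE; apply: ge0_integral_sub => //; first exact: mB.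
      exact: measurable_powRF.
    by move=> z; exact: powR_ge0.
  apply: poweR_le; [exact: ltW|exact: integral_powR_ge0|].
  rewrite -N'E; apply: ge0_integral_sub => //; first exact: mB.
    exact: measurable_powRF.
  by move=> z; exact: powR_ge0.
have o0 : (0 < o)%R.
  have := hold S (cst 1%R) (mB bS) (@subset_refl _ _) (measurable_cst _) (fun=> ler01).
  rewrite /= integral_cst ?mul1e; last exact: mB.
  under [X in X `^ _ * _]eq_integral do rewrite powR1 mul1r.
  rewrite oE bE poweR_EFin -EFinM lee_fin => H.
  rewrite lt_neqAle fine_ge0 ?andbT; last by apply: integral_ge0 => z _; rewrite lee_fin.
  rewrite eq_sym; apply/eqP => o0.
  by move: H; rewrite -/o o0 powR0 ?mul0r ?invr_eq0 ?gt_eqF// leNgt bb0.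
exists (J `^ a' * N' `^ b')%R, o; split => //.
move: upO; rewrite oE lee_fin => upO.
have okN : (o `^ P0^-1 <= (k * N) `^ P0^-1)%R.
  apply: ge0_ler_powR; rewrite ?nnegrE ?invr_ge0 ?mulr_ge0//; exact: ltW.
apply: (le_trans (ler_wpM2r (ltW L0) okN)).
rewrite /k.
have [lN Ne] := expR_ex N0; have [lN' N'e] := expR_ex N'0.
have [lJ Je] := expR_ex J0; have [lb be'] := expR_ex bb0.
have [lA Ae] := expR_ex A0; have [lC Ce] := expR_ex Cp0.
move: NN; rewrite /K Ne N'e Je be' Ae Ce.
rewrite -!expRN -?expRD !powR_expR -?expRD !powR_expR -?expRD !ler_expR => H.
have H' : (b' * (y * lN + lN') <= b' * (lA + (1 + y) * lb))%R by rewrite ler_pM2l.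
rewrite -subr_ge0.
have -> : (a' * lC + b' * lA + lb -
   (P0^-1 * ((p1 - 1) / s * (lC + lb - lJ) + lN) + (a' * lJ + b' * lN')) =
   b' * (lA + (1 + y) * lb) - b' * (y * lN + lN') +
    (1 - (P0^-1 + a' + b')) * lb)%R.
  by rewrite /a' /b'; field; rewrite !gt_eqF.
have -> : (P0^-1 + a' + b' = 1)%R by exact: exps.
by rewrite subrr mul0r addr0 subr_ge0.
Qed.

Local Notation om := (dens mu O0' mO).

(** [dual_weight_ball] on [star B], with [E = B] and [phi = 1]. *)
Lemma dual_weight_doubling : doubling BB star om ((K * C0) `^ P0)%R.
Proof.
split => B bB.
  have [b bb0 bE] := ball_fineE hBB bB.
  have [L [ o [L0 o0 oE _ _]]] := dual_weight_ball bB bE bb0.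
  by rewrite /dens oE lte_fin o0 ltry.
have bS := enl_ball hE bB.
have [b bb0 bE] := ball_fineE hBB bS; have [a aa0 aE] := ball_fineE hBB bB.
have [L [ o [L0 o0 oE ok hold]]] := dual_weight_ball bS bE bb0.
have [L1 [ o1 [_ o10 o1E _ _]]] := dual_weight_ball bB aE aa0.
have := hold B (cst 1%R) (mB bB) (ball_star hBB hE bB) (measurable_cst _) (fun=> ler01).
rewrite /= integral_cst ?mul1e; last exact: mB.
under [X in X `^ _ * _]eq_integral do rewrite powR1 mul1r.
rewrite /dens oE o1E aE poweR_EFin -!EFinM !lee_fin => H.
have ba : (b <= C0 * a)%R.
  by rewrite -lee_fin EFinM -aE -bE; exact: (enl_measure hE).
have H1 : (o `^ P0^-1 <= K * C0 * o1 `^ P0^-1)%R.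
  rewrite -(ler_pM2r L0); apply: (le_trans ok).
  have -> : (K * C0 * o1 `^ P0^-1 * L = K * (C0 * (o1 `^ P0^-1 * L)))%R by rewrite !mulrA.
  by rewrite ler_pM2l//; apply: (le_trans ba); rewrite ler_pM2l.
have : ((o `^ P0^-1) `^ P0 <= (K * C0 * o1 `^ P0^-1) `^ P0)%R.
  apply: ge0_ler_powR; rewrite ?nnegrE ?powR_ge0//; first exact: ltW.
  by rewrite !mulr_ge0 ?powR_ge0// ltW.
rewrite powRM ?powR_ge0//; last by rewrite mulr_ge0// ltW.
by rewrite -!powRrM mulVf ?gt_eqF// !powRr1// ltW.
Qed.

(** Means with respect to [mu] are controlled by those with respect to the
    doubling measure [O dmu], for which strong type bounds are known. *)
Lemma gmax_dual_weight (phi : X -> R) x : measurable_fun [set: X] phi ->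
  (forall z, (0 <= phi z)%R) ->
  gmax G mu (EFin \o phi) x <=
    K%:E * (gmax G om (EFin \o (fun z => phi z `^ P0)%R) x) `^ P0^-1.
Proof.
move=> mphi phi0; have pp0 z : 0 <= (EFin \o (fun z => phi z `^ P0)%R) z.
  by rewrite lee_fin powR_ge0.
have mpp : measurable_fun [set: X] (EFin \o (fun z => phi z `^ P0)%R).
  by apply/measurable_EFinP; exact: measurable_powRF.
apply: gmax_le; first by rewrite mule_ge0 ?poweR_ge0// lee_fin ltW.
move=> n Gx; have [b bb0 bE] := ball_fineE hBB (bG n).
have [L [ o [L0 o0 oE ok hold]]] := dual_weight_ball (bG n) bE bb0.
have omE : om (G n) = o%:E by [].
have le1 : mean om (G n) (EFin \o (fun z => phi z `^ P0)%R) <=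
  gmax G om (EFin \o (fun z => phi z `^ P0)%R) x by exact: gmax_ge.
have iV : (0 <= P0^-1)%R by rewrite invr_ge0 ltW.
apply: (@le_trans _ _ (K%:E * (mean om (G n) (EFin \o (fun z => phi z `^ P0)%R)) `^ P0^-1)).
  rewrite (meanE _ bb0 bE) (meanE _ o0 omE) lee_pdivrMl//.
  apply: (le_trans (hold _ _ (mB (bG n)) (@subset_refl _ _) mphi phi0)).
  rewrite integral_dens//; last 2 first.
    - exact: mB.
    - exact: measurable_funTS.
  set I := \int[mu]_(z in G n) _.
  have I0 : 0 <= I by apply: integral_ge0 => z _; rewrite lee_fin mulr_ge0 ?powR_ge0.
  rewrite poweRM ?lee_fin ?invr_ge0 ?(ltW o0)// poweR_EFin.
  rewrite !muleA -!EFinM muleC lee_wpmul2r ?poweR_ge0// lee_fin.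
  have opos : (0 < o `^ P0^-1)%R by rewrite powR_gt0.
  have -> : (o^-1 `^ P0^-1 = (o `^ P0^-1)^-1)%R.
    by have [l ->] := expR_ex o0; rewrite -expRN !powR_expR -expRN mulrN.
  by rewrite ler_pdivlMr// mulrC [(b * K)%R]mulrC.
rewrite lee_wpmul2l ?lee_fin ?(ltW K0)//.
apply: poweR_le => //.
exact: mean_ge0.
Qed.

(** The strong type bound of exponent [P / P0] for the doubling measure
    [O dmu], applied to [phi ^ P0]. *)
Lemma dual_weight_strong (P : R) : (P0 < P)%R ->
  exists2 c : R, (0 < c)%R & forall phi : X -> R, measurable_fun [set: X] phi ->
  (forall z, (0 <= phi z)%R) ->
  \int[mu]_x (gmax G mu (EFin \o phi) x `^ P * (O x)%:E) <=
  c%:E * \int[mu]_x (phi x `^ P * O x)%:E.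
Proof.
move=> PP; pose Q := (P / P0)%R.
have Q1 : (1 < Q)%R by rewrite ltr_pdivlMr// mul1r.
have P_gt0 : (0 < P)%R by exact: lt_trans PP.
set c1 := (4 `^ Q * ((K * C0) `^ P0) * (2 `^ (Q - 1) / (2 `^ (Q - 1) - 1)))%R.
have c10 : (0 < c1)%R.
  have KC : (0 < K * C0)%R by exact: mulr_gt0.
  apply: mulr_gt0; first by apply: mulr_gt0; apply: powR_gt0.
  by rewrite divr_gt0 ?powR_gt0// subr_gt0 powR2_gt1// subr_gt0.
exists (K `^ P * c1)%R; first by rewrite mulr_gt0// powR_gt0.
move=> phi mphi phi0; set pp := (fun z => phi z `^ P0)%R.
have mpp : measurable_fun [set: X] pp by exact: measurable_powRF.
have pp0 z : (0 <= pp z)%R by exact: powR_ge0.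
have := gmax_strong hBB hE bG (powR_ge0 _ _) dual_weight_doubling mpp pp0 Q1.
rewrite -/c1.
have mg := measurable_gmax hBB bG (om : {measure set X -> \bar R}) (EFin \o pp).
have g0 x : 0 <= gmax G om (EFin \o pp) x by apply: gmax_ge0 => z; rewrite lee_fin.
rewrite integral_dens//; last 2 first.
  - exact: measurable_poweRF.
  - by move=> x _; exact: poweR_ge0.
rewrite (@integral_dens _ _ _ mu O O0' mO setT (fun x => (pp x `^ Q)%:E)); last 3 first.
  - exact: measurableT.
  - by apply/measurable_EFinP; exact: measurable_powRF.
  - by move=> x _; rewrite lee_fin powR_ge0.
have m0g x : 0 <= gmax G mu (EFin \o phi) x by apply: gmax_ge0 => z; rewrite lee_fin.
move=> H; apply: (@le_trans _ _ ((K `^ P)%:E * \int[mu]_x (gmax G om (EFin \o pp) x `^ Q * (O x)%:E))).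
  rewrite -ge0_integralZl//; last 3 first.
  - apply: emeasurable_funM; first exact: measurable_poweRF.
    exact/measurable_EFinP.
  - by move=> x _; rewrite mule_ge0 ?poweR_ge0// lee_fin.
  - by rewrite lee_fin powR_ge0.
  apply: ge0_le_integral => //.
  - by move=> x _; rewrite mule_ge0 ?poweR_ge0// lee_fin.
  - apply: emeasurable_funM; last exact/measurable_EFinP.
    by apply: measurable_poweRF; exact: (measurable_gmax hBB bG).
  - apply: measurable_funeM; apply: emeasurable_funM; first exact: measurable_poweRF.
    exact/measurable_EFinP.
  - move=> x _; rewrite muleA lee_wpmul2r ?lee_fin//.
    have := poweR_le (ltW P_gt0) (m0g x) (gmax_dual_weight x mphi phi0).
    rewrite poweRM ?poweR_ge0// ?lee_fin ?(ltW K0)// poweR_EFin -poweRrM.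
    by rewrite mulrC.
rewrite [leRHS](_ : _ = (K `^ P)%:E * (c1%:E * \int[mu]_x (phi x `^ P * O x)%:E)); last first.
  by rewrite muleA.
apply: lee_wpmul2l; first by rewrite lee_fin powR_ge0.
apply: (le_trans H); apply: lee_wpmul2l; first by rewrite lee_fin; exact: ltW.
apply: eqle; apply: eq_integral => z _.
by rewrite -EFinM /pp -powRrM (_ : P0 * Q = P)%R// /Q mulrC mulfVK ?gt_eqF.
Qed.

End dual_weight.

(** * Auxiliary facts on maximal functions and weights *)
Lemma integral_gt0 {d : measure_display} {X : measurableType d} {R : realType}
  (mu : {measure set X -> \bar R}) (B : set X) (f : X -> R) : measurable B ->
  0 < mu B -> measurable_fun [set: X] f -> (forall x, (0 <= f x)%R) ->
  (forall x, B x -> (0 < f x)%R) -> 0 < \int[mu]_(x in B) (f x)%:E.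
Proof.
move=> mB B0 mf f0 fB; rewrite lt_neqAle integral_ge0 ?andbT; last first.
  by move=> x _; rewrite lee_fin.
apply/eqP => I0.
have mfE : measurable_fun B (EFin \o f).
  by apply/measurable_EFinP/measurable_funTS.
have := (ae_eq_integral_abs mu mB mfE).1; case.
  rewrite [RHS]I0; apply: eq_integral => x _.
  by rewrite /= ger0_norm.
move=> N [mN N0 BN].
have : mu B <= mu N.
  apply: le_measure; rewrite ?inE// => x Bx; apply: BN => /= /(_ Bx).
  by move=> [] /eqP; rewrite gt_eqF// fB.
by rewrite N0 leNgt B0.
Qed.

Section maximal_aux.
Context {d : measure_display} {X : measurableType d} {R : realType}.
Variables (mu : {measure set X -> \bar R}) (BB : set (set X)).
Variables (star : set X -> set X) (C0 : R).
Hypothesis hBB : ball_basis mu BB star.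
Hypothesis hE : enlargement mu BB star C0.
Variable G : nat -> set X.
Hypothesis bG : forall n, BB (G n).
Hypothesis hG : forall B, BB B -> exists n, B `<=` G n /\ G n `<=` star (star B).
Let C00 : (0 < C0)%R. Proof. exact: lt_le_trans (enl_ge1 hE). Qed.
Let mB B : BB B -> measurable B. Proof. exact: (bb_measurable hBB). Qed.
Local Notation M phi := (gmax G mu (EFin \o phi)).

(** If this failed on a set of positive measure, then for some rational [a] it
    would contain a set of positive measure where [phi > a] and the maximal
    function is less than [a / (2 C0 ^ 2)]; a ball half filled by that set
    contradicts the latter. *)
Lemma le_gmax_ae (phi : X -> R) : measurable_fun [set: X] phi ->
  (forall x, (0 <= phi x)%R) ->
  {ae mu, forall x, (phi x)%:E <= (2 * C0 ^+ 2)%:E * M phi x}.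
Proof.
move=> mphi phi0; set K : R := (2 * C0 ^+ 2)%R.
have K0 : (0 < K)%R by rewrite mulr_gt0// exprn_gt0.
have phiE0 x : 0 <= (EFin \o phi) x by rewrite lee_fin.
have mpE : measurable_fun [set: X] (EFin \o phi) by exact/measurable_EFinP.
have M0 x : 0 <= M phi x by exact: gmax_ge0.
have mM : measurable_fun [set: X] (fun x => K%:E * M phi x).
  by apply: measurable_funeM; exact: (measurable_gmax hBB bG).
pose N (a : R) := [set x | K%:E * M phi x < a%:E] `&` [set x | a%:E < (phi x)%:E].
have mN a : measurable (N a).
  apply: measurableI; last exact: measurable_gt.
  rewrite (_ : [set x | _] = ~` [set x | a%:E <= K%:E * M phi x]).
    apply: measurableC; rewrite -[X in measurable X]setTI.
    by apply: emeasurable_fun_c_infty => //.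
  by apply/seteqP; split => x /=; rewrite ltNge => /negP.
have N0 a : mu (N a) <= 0.
  rewrite leNgt; apply/negP => Na.
  have [B bB muB] := density_ball hBB hE (mN a) Na.
  have [b b0 bE] := ball_fineE hBB bB.
  have mBN : measurable (B `&` N a) by apply: measurableI => //; exact: mB.
  have BN0 : B `&` N a !=set0.
    apply/set0P/eqP => e; move: muB; rewrite e measure0 mule0.
    by rewrite ltNge measure_ge0.
  have [y [By [/= My ay]]] := BN0.
  have a0 : (0 < a)%R.
    by rewrite -lte_fin; apply: le_lt_trans My; rewrite mule_ge0// lee_fin ltW.
  have le1 : mean mu B (EFin \o phi) <= (C0 ^+ 2)%:E * M phi y.
    exact: (mean_le_gmax hBB hE bG hG).
  have le2 : (a / 2)%:E < mean mu B (EFin \o phi).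
    rewrite (meanE _ b0 bE) lte_pdivlMl// -EFinM.
    apply: (@lt_le_trans _ _ (a%:E * mu (B `&` N a))).
      rewrite [(b * _)%R](_ : _ = a * (b / 2))%R; last by ring.
      rewrite EFinM lte_pmul2l ?lte_fin// EFinM -bE.
      rewrite muleC -(@lte_pmul2l _ 2%:E) ?lte_fin//.
      by rewrite muleA -EFinM divff// mul1e.
    rewrite -[leLHS]integral_cst//.
    apply: (@le_trans _ _ (\int[mu]_(x in B `&` N a) (phi x)%:E)).
      apply: ge0_le_integral => //.
      - by move=> x _; rewrite lee_fin ltW.
      - exact: measurable_funTS.
      - by move=> x [_ [_ /= ax]]; exact: ltW.
    apply: ge0_subset_integral => //; first exact: mB.
      exact: measurable_funTS.
    by move=> x _; rewrite lee_fin.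
  have : (C0 ^+ 2)%:E * M phi y < (a / 2)%:E.
    rewrite -(@lte_pmul2l _ 2%:E) ?lte_fin// muleA -EFinM -/K.
    by rewrite -EFinM mulrC divfK.
  by rewrite ltNge (le_trans (ltW le2) le1).
pose rt n : R := ratr (odflt 0%R (unpickle n : option rat)).
exists (\bigcup_n N (rt n)); split.
- exact: bigcupT_measurable.
- by apply/eqP; rewrite eq_le measure_ge0 andbT; exact: measure_bigcup_null.
- move=> x /= /negP; rewrite -ltNge => lt1.
  have fm : K%:E * M phi x \is a fin_num.
    rewrite ge0_fin_numE; first exact: (lt_trans lt1 (ltry _)).
    by rewrite mule_ge0// lee_fin ltW.
  move: lt1; rewrite -(fineK fm) lte_fin => /rat_in_itvoo[c].
  rewrite in_itv/= => /andP[c1 c2].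
  exists (pickle c) => //; rewrite /N /rt pickleK/=; split => /=.
    by rewrite -(fineK fm) lte_fin.
  by rewrite lte_fin.
Qed.

Lemma ball_hull Q x : BB Q -> exists B, [/\ BB B, B x & Q `<=` B].
Proof.
move=> bQ; have [y Qy] := ball_nonempty hBB bQ.
have [B [bB Bx By]] := bb_B2 hBB x y.
have [QB|/ltW BQ] := leP (mu B) (mu Q).
  exists (star Q); split; [exact: (enl_ball hE)| |exact: (ball_star hBB hE)].
  apply: (sub_star hE bQ bB) Bx; first by exists y.
  exact: (le_trans QB (le_double _ _)).
exists (star B); split; first exact: (enl_ball hE).
- exact: (ball_star hBB hE).
- apply: (sub_star hE bB bQ); first by exists y.
  exact: (le_trans BQ (le_double _ _)).
Qed.

Lemma gmax_gt0 (E Q : set X) (phi : X -> R) x : measurable E -> 0 < mu E ->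
  BB Q -> E `<=` Q -> measurable_fun [set: X] phi ->
  (forall z, (0 <= phi z)%R) -> (forall z, E z -> (0 < phi z)%R) ->
  0 < M phi x.
Proof.
move=> mE E0 bQ EQ mphi phi0 phiE; have [B [bB Bx QB]] := ball_hull x bQ.
have [n [Bn _]] := hG bB.
apply: (@lt_le_trans _ _ (mean mu (G n) (EFin \o phi))); last first.
  by apply: gmax_ge; exact: Bn.
have [b b0 bE] := ball_fineE hBB (bG n).
rewrite (meanE _ b0 bE) mule_gt0// ?lte_fin ?invr_gt0//.
apply: (lt_le_trans (integral_gt0 mE E0 mphi phi0 phiE)).
apply: ge0_integral_sub => //; first exact: mB.
by move=> z /EQ/QB/Bn.
Qed.

(** The theorem of Coifman and Rochberg with the exponent [s1 / s]. *)
Lemma A1_power_gmax (s s1 : R) : (0 < s1 < s)%R -> exists2 C : R, (0 < C)%R &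
  forall phi : X -> R, measurable_fun [set: X] phi ->
  (forall x, (0 <= phi x)%R) -> (forall x, 0 < M phi x < +oo) ->
  A1_power mu BB (fun x => fine (M phi x) `^ s^-1)%R s1 C.
Proof.
move=> /andP[s10 s1s]; have s0 : (0 < s)%R by exact: lt_trans s1s.
have ga01 : (0 < s1 / s < 1)%R.
  by rewrite divr_gt0//= ltr_pdivrMr// mul1r.
have [C Cp HC] := coifman_rochberg hBB hE bG hG ga01.
exists C => // phi mphi phi0 Mphi B b bB bE.
have [b' b'0 b'E] := ball_fineE hBB bB.
have b0 : (0 < b)%R by move: b'E; rewrite bE => -[->].
have fM x : (0 < fine (M phi x))%R by rewrite fine_gt0.
have fE x : M phi x = (fine (M phi x))%:E.
  rewrite fineK// fin_numE; have /andP[p1 p2] := Mphi x.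
  by rewrite gt_eqF ?(lt_trans (ltNyr 0))//= lt_eqF.
have mM : measurable_fun [set: X] (M phi) by exact: (measurable_gmax hBB bG).
have mf : measurable_fun [set: X] (fun x => fine (M phi x)).
  by apply: measurableT_comp.
have I_E : \int[mu]_(x in B) ((fine (M phi x) `^ s^-1) `^ s1)%:E =
  \int[mu]_(x in B) (M phi x) `^ (s1 / s).
  apply: eq_integral => x _; rewrite [in RHS]fE poweR_EFin -powRrM.
  by rewrite mulrC.
have bound y : B y ->
  \int[mu]_(x in B) ((fine (M phi x) `^ s^-1) `^ s1)%:E <=
   (C * b * (fine (M phi y) `^ s^-1) `^ s1)%:E.
  move=> By; rewrite I_E.
  have := HC phi mphi phi0 B y _ bB By (fM y); rewrite -fE lexx => /(_ isT).
  rewrite bE -EFinM => /le_trans; apply; rewrite lee_fin -powRrM.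
  by rewrite [(s^-1 * _)%R]mulrC mulrAC.
have [y By] := ball_nonempty hBB bB.
have I0 : 0 < \int[mu]_(x in B) ((fine (M phi x) `^ s^-1) `^ s1)%:E.
  apply: integral_gt0 => //; first exact: mB.
  - exact: ball_pos hBB _ bB.
  - by apply: measurable_powRF; exact: measurable_powRF.
  - by move=> x; exact: powR_ge0.
  - by move=> x _; rewrite !powR_gt0.
have IJ : \int[mu]_(x in B) ((fine (M phi x) `^ s^-1) `^ s1)%:E =
  (fine (\int[mu]_(x in B) ((fine (M phi x) `^ s^-1) `^ s1)%:E))%:E.
  by rewrite fineK// ge0_fin_numE ?(ltW I0)// (le_lt_trans (bound y By)) ?ltry.
exists (fine (\int[mu]_(x in B) ((fine (M phi x) `^ s^-1) `^ s1)%:E)); split => //.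
  by rewrite -lte_fin -IJ.
apply: aeW => x Bx; rewrite -lee_fin -IJ; exact: bound.
Qed.

(** The reciprocal power of the minimum is at most the sum of the reciprocal
    powers, which gives a constant that is uniform in the truncation level. *)
Lemma muckenhoupt_min (v : X -> R) (y A kap : R) : measurable_fun [set: X] v ->
  (forall x, (0 < v x)%R) -> (0 < y)%R -> (0 < kap)%R -> muckenhoupt mu BB v y A ->
  muckenhoupt mu BB (fun x => Num.min (v x) kap) y (A + 1)%R.
Proof.
move=> mv v0 y0 k0 hv B b bB bE.
have [b' b'0 b'E] := ball_fineE hBB bB.
have b0 : (0 < b)%R by move: b'E; rewrite bE => -[->].
have [N [N' [[N0 N'0] NE N'E NN]]] := hv B b bB bE.
have mm : measurable_fun [set: X] (fun x => Num.min (v x) kap) by exact: measurable_minr.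
have mm0 x : (0 < Num.min (v x) kap)%R by rewrite lt_min v0 k0.
have p1 : 0 < \int[mu]_(x in B) (Num.min (v x) kap)%:E.
  apply: integral_gt0 => //; [exact: mB|exact: ball_pos hBB _ bB|].
  by move=> x; exact: ltW.
have p2 : 0 < \int[mu]_(x in B) ((Num.min (v x) kap) `^ (- y))%:E.
  apply: integral_gt0 => //; [exact: mB|exact: ball_pos hBB _ bB| | |].
  - exact: measurable_powRF.
  - by move=> x; exact: powR_ge0.
  - by move=> x _; exact: powR_gt0.
have u1 : \int[mu]_(x in B) (Num.min (v x) kap)%:E <= N%:E.
  rewrite -NE; apply: ge0_le_integral => //.
  - exact: mB.
  - by move=> x _; rewrite lee_fin ltW.
  - by apply/measurable_EFinP; exact: measurable_funTS.
  - by apply/measurable_EFinP; exact: measurable_funTS.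
  - by move=> x _; rewrite lee_fin ge_min lexx.
have u2 : \int[mu]_(x in B) (Num.min (v x) kap)%:E <= (kap * b)%:E.
  rewrite EFinM -bE -[leRHS]integral_cst//; last exact: mB.
  apply: ge0_le_integral => //.
  - exact: mB.
  - by move=> x _; rewrite lee_fin ltW.
  - by apply/measurable_EFinP; exact: measurable_funTS.
  - by move=> x _; rewrite lee_fin ge_min lexx orbT.
have u3 : \int[mu]_(x in B) ((Num.min (v x) kap) `^ (- y))%:E <=
    (N' + kap `^ (- y) * b)%:E.
  rewrite EFinD -N'E EFinM -bE -[X in _ <= _ + X]integral_cst//; last exact: mB.
  rewrite -ge0_integralD//; last 4 first.
  - exact: mB.
  - by move=> x _; rewrite lee_fin powR_ge0.
  - by apply/measurable_EFinP; exact: measurable_powRF.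
  - by move=> x _; rewrite lee_fin powR_ge0.
  apply: ge0_le_integral => //.
  - exact: mB.
  - by move=> x _; rewrite lee_fin powR_ge0.
  - by apply/measurable_EFinP; exact: measurable_powRF.
  - apply: emeasurable_funD => //.
    by apply/measurable_EFinP; exact: measurable_powRF.
  - move=> x _; rewrite -EFinD lee_fin /=; case: (leP (v x) kap) => _.
      by rewrite lerDl powR_ge0.
    by rewrite lerDr powR_ge0.
have f1 : \int[mu]_(x in B) (Num.min (v x) kap)%:E \is a fin_num.
  by rewrite ge0_fin_numE ?(ltW p1)// (le_lt_trans u1) ?ltry.
have f2 : \int[mu]_(x in B) ((Num.min (v x) kap) `^ (- y))%:E \is a fin_num.
  by rewrite ge0_fin_numE ?(ltW p2)// (le_lt_trans u3) ?ltry.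
move: p1 p2 u1 u2 u3; rewrite -(fineK f1) -(fineK f2) !lte_fin !lee_fin.
set n := fine _; set n' := fine _ => n0 n'0 u1 u2 u3.
exists n, n'; split => //.
have y0' := ltW y0.
apply: le_trans (ler_wpM2l (powR_ge0 _ _) u3) _.
rewrite mulrDr mulrDl mul1r lerD//.
  apply: le_trans NN; rewrite ler_wpM2r ?(ltW N'0)//.
  by apply: ge0_ler_powR => //; rewrite nnegrE ltW.
apply: (@le_trans _ _ ((kap * b) `^ y * (kap `^ (- y) * b))%R).
  rewrite ler_wpM2r// ?mulr_ge0 ?powR_ge0 ?(ltW b0)//.
  by apply: ge0_ler_powR => //; rewrite nnegrE ?mulr_ge0 ?ltW.
have [l1 ->] := expR_ex k0; have [l2 ->] := expR_ex b0.
rewrite -expRD !powR_expR -!expRD ler_expR; apply: eqle; ring.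
Qed.

End maximal_aux.

(** The condition says that [P0 (1 - s ^ 2 / s0) = 1 - 1 / s0 + 1 / y], which
    has a solution [P0 > 1] as soon as [1 < s] and [s ^ 2 < s0]. *)
Lemma exponents_exist {R : realFieldType} (s0 y : R) : (1 < s0)%R -> (0 < y)%R ->
  exists s P0 : R, [/\ (1 < s)%R, (s < s0)%R, (1 < P0)%R &
   (P0^-1 + (s * (s * P0) - 1) / (P0 * s0) + (y * P0)^-1 = 1)%R].
Proof.
move=> s1 y0; pose e : R := (Num.min ((s0 - 1) / 4) 1)%R.
have e0 : (0 < e)%R by rewrite lt_min ltr01 andbT divr_gt0// subr_gt0.
have e1 : (e <= 1)%R by rewrite ge_min lexx orbT.
have e2 : (4 * e <= s0 - 1)%R.
  by rewrite mulrC -ler_pdivlMr// ge_min lexx.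
have s00 : (0 < s0)%R by exact: lt_trans s1.
pose s : R := (1 + e)%R.
have ss : (s * s < s0)%R by rewrite /s; nra.
have den : (0 < 1 - s * s / s0)%R by rewrite subr_gt0 ltr_pdivrMr// mul1r.
pose P0 := ((1 - s0^-1 + y^-1) / (1 - s * s / s0))%R.
have y10 : (0 < y^-1)%R by rewrite invr_gt0.
have P01 : (1 < P0)%R.
  rewrite ltr_pdivlMr// mul1r; apply: (@lt_trans _ _ (1 - s0^-1)%R); last by rewrite ltrDl.
  rewrite ltrD2l ltrN2 -[ltLHS]mul1r ltr_pM2r ?invr_gt0// /s; nra.
exists s, P0; split => //; first by rewrite ltrDl.
  by rewrite /s; lra.
have P00 : (0 < P0)%R by exact: lt_trans P01.
have key : (1 - s0^-1 + y^-1 = P0 * (1 - s * s / s0))%R.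
  by rewrite /P0 divfK// gt_eqF.
have -> : (P0^-1 + (s * (s * P0) - 1) / (P0 * s0) + (y * P0)^-1 =
  ((1 - s0^-1 + y^-1) + P0 * (s * s / s0)) / P0)%R.
  by field; rewrite !gt_eqF.
by rewrite key; field; rewrite !gt_eqF.
Qed.

(** * Products with functions in weak L^1 *)
Lemma level_bracket {R : realType} (z c : R) : (0 < z)%R -> (z <= c)%R ->
  exists k, (c * 2^-1 ^+ k.+1 < z <= c * 2^-1 ^+ k)%R.
Proof.
move=> z0 zc; have c0 : (0 < c)%R by exact: lt_le_trans zc.
have ex : exists n, (c * 2^-1 ^+ n.+1 < z)%R.
  exists (Num.bound (c / z)); rewrite exprVn ltr_pdivrMr ?exprn_gt0//.
  rewrite mulrC -ltr_pdivrMr//; apply: (lt_trans (archi_boundP _)).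
    by rewrite divr_ge0// ltW.
  by rewrite -natrX ltr_nat (ltn_trans _ (ltn_expl _ _)).
have [k Pk mink] := ex_minnP ex; exists k; rewrite Pk/=.
case: k mink {Pk} => [|k] mink; first by rewrite expr0 mulr1.
by rewrite leNgt; apply/negP => /mink; rewrite ltnn.
Qed.

(** Decompose into the sets where [Z] is of order [Cz / 2 ^ j].  Their measure
    is at most of order [W (2 ^ j / Cz) ^ p], so by Kolmogorov's inequality the
    integral of [g ^ th] over them is of order
    [K ^ th (W (2 ^ j / Cz) ^ p) ^ (1 - th)]; after multiplication by
    [Cz / 2 ^ j] the sum over [j] is geometric because [p (1 - th) < 1]. *)
Lemma weak_product {R : realType} (Cz p th : R) : (0 < Cz)%R -> (0 < p)%R ->
  (0 < th < 1)%R -> (p * (1 - th) < 1)%R ->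
  exists2 c : R, (0 < c)%R & forall (d : measure_display) (X : measurableType d)
   (nu : {measure set X -> \bar R}) (g : X -> \bar R) (Z : X -> R) (K W : R),
  measurable_fun [set: X] g -> (forall x, 0 <= g x) ->
  measurable_fun [set: X] Z -> (forall x, (0 <= Z x <= Cz)%R) ->
  (0 < K)%R -> (0 <= W)%R ->
  (forall t, (0 < t)%R -> nu [set x | t%:E < g x] <= (K / t)%:E) ->
  (forall t, (0 < t)%R -> nu [set x | (t < Z x)%R] <= (W * t `^ (- p))%:E) ->
  \int[nu]_x (g x `^ th * (Z x)%:E) <= (c * K `^ th * W `^ (1 - th))%:E.
Proof.
move=> Cz0 p0 th01 pth; have /andP[th0 th1] := th01.
set cth : R := (1 + 2 `^ th / (1 - 2 `^ (th - 1)))%R.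
have cth0 : (0 < cth)%R.
  have r1 : (2 `^ (th - 1) < 1 :> R)%R.
    by apply: powR2_lt1; rewrite subr_lt0.
  by rewrite addr_gt0// divr_gt0 ?powR_gt0// subr_gt0.
have th10 : (0 < 1 - th)%R by rewrite subr_gt0.
pose rat : R := (2 `^ (p * (1 - th) - 1))%R.
have rat1 : (rat < 1)%R.
  by apply: powR2_lt1; rewrite subr_lt0.
have rat0 : (0 <= rat)%R by exact: powR_ge0.
pose b := (Cz * cth * (Cz / 2) `^ (- (p * (1 - th))))%R.
have b0 : (0 < b)%R by rewrite mulr_gt0 ?powR_gt0 ?divr_gt0// mulr_gt0.
exists (b / (1 - rat))%R; first by rewrite divr_gt0// subr_gt0.
move=> d X nu g Z K W mg g0 mZ ZC K0 W0 wg wZ.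
pose l j : R := (Cz * 2^-1 ^+ j.+1)%R.
have l0 j : (0 < l j)%R by rewrite mulr_gt0// exprn_gt0// invr_gt0.
pose L j := [set x | (l j < Z x)%R].
have mL j : measurable (L j).
  rewrite (_ : L j = [set x | (l j)%:E < (EFin \o Z) x]).
    by apply: measurable_gt; exact/measurable_EFinP.
  by apply/seteqP; split => x /=; rewrite lte_fin.
have mgt : measurable_fun [set: X] (fun x => g x `^ th) by exact: measurable_poweRF.
pose u j x : \bar R := (Cz * 2^-1 ^+ j)%:E * ((fun x => g x `^ th) \_ (L j)) x.
have c0 j : (0 <= Cz * 2^-1 ^+ j)%R by rewrite mulr_ge0 ?exprn_ge0 ?invr_ge0// ltW.
have gL0 j x : 0 <= ((fun x => g x `^ th) \_ (L j)) x.
  by rewrite patchE; case: ifP => // _; exact: poweR_ge0.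
have u0 j x : 0 <= u j x by rewrite mule_ge0// lee_fin.
have mgL j : measurable_fun [set: X] ((fun x => g x `^ th) \_ (L j)).
  apply/(measurable_restrictT _ (mL j)).1; exact: measurable_funTS.
have mu_ j : measurable_fun [set: X] (u j) by exact: measurable_funeM.
have pw x : g x `^ th * (Z x)%:E <= \sum_(j <oo) u j x.
  have /andP[Z0 ZCz] := ZC x; have [Ze|Zne] := eqVneq (Z x) 0%R.
    by rewrite Ze mule0; apply: nneseries_ge0 => j _ _.
  have [k /andP[k1 k2]] := level_bracket (z := Z x) (c := Cz) ltac:(by rewrite lt_neqAle eq_sym Zne) ZCz.
  apply: le_trans (nneseries_ge k (fun j => u0 j x)).
  rewrite /u patchE mem_set// muleC; apply: lee_wpmul2r; first exact: poweR_ge0.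
  by rewrite lee_fin.
apply: (@le_trans _ _ (\int[nu]_x \sum_(j <oo) u j x)).
  apply: ge0_le_integral => //.
  - by move=> x _; rewrite mule_ge0 ?poweR_ge0// lee_fin; have /andP[] := ZC x.
  - by apply: emeasurable_funM => //; exact/measurable_EFinP.
  - by apply: ge0_emeasurable_sum => // j x _ _.
rewrite integral_nneseries//.
apply: (@le_trans _ _ (\sum_(j <oo) (b * K `^ th * W `^ (1 - th) * rat ^+ j)%:E)).
  apply: lee_nneseries => j _.
    by move=> _; exact: integral_ge0.
  rewrite /u ge0_integralZl//; last by rewrite lee_fin.
  rewrite -integral_mkcond.
  have nL : nu (L j) <= (W * l j `^ (- p))%:E by exact: wZ.
  have Loo : nu (L j) < +oo by exact: le_lt_trans nL (ltry _).
  have := @kolmogorov _ _ _ nu g mg (L j) K th (mL j) Loo g0 K0 th01 wg.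
  move=> H; apply: le_trans (lee_wpmul2l _ H) _; first by rewrite lee_fin.
  have H2 : nu (L j) `^ (1 - th) <= ((W * l j `^ (- p)) `^ (1 - th))%:E.
    by rewrite -poweR_EFin; apply: poweR_le => //; exact: ltW.
  apply: le_trans (lee_wpmul2l _ (lee_wpmul2l _ H2)) _.
  - by rewrite lee_fin.
  - by rewrite lee_fin mulr_ge0 ?powR_ge0// ltW.
  rewrite -/cth -!EFinM lee_fin powRM ?powR_ge0// -powRrM.
  have -> : (Cz * 2^-1 ^+ j * (cth * K `^ th * (W `^ (1 - th) * l j `^ (- p * (1 - th)))) =
    (Cz * cth * (2^-1 ^+ j * l j `^ (- p * (1 - th)))) * K `^ th * W `^ (1 - th))%R by ring.
  have -> : (b * K `^ th * W `^ (1 - th) * rat ^+ j =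
    (b * rat ^+ j) * K `^ th * W `^ (1 - th))%R by ring.
  apply: eqle; do 2 congr (_ * _)%R.
  rewrite /b -!mulrA; do 2 congr (_ * _)%R.
  rewrite /l exprS mulrA powRM ?exprn_ge0 ?invr_ge0 ?divr_ge0 ?(ltW Cz0)//.
  rewrite mulrCA mulNr; congr (_ * _)%R.
  rewrite /rat -powR_mulrn ?powR_ge0// -!powR_mulrn ?invr_ge0//.
  have [a ->] := expR_ex (ltr0n R 2 : _ = true).
  rewrite -expRN !powR_expR -expRD; congr expR; ring.
rewrite [leRHS](_ : _ = ((b * K `^ th * W `^ (1 - th)) / (1 - rat))%:E); last first.
  congr EFin; ring.
apply: geometric_le; last by rewrite rat0.
by rewrite !mulr_ge0 ?powR_ge0// ltW.
Qed.

(** * The majorant of the first weight *)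
Section extrapolation.
Context {d : measure_display} {X : measurableType d} {R : realType}.
Variables (mu : {measure set X -> \bar R}) (BB : set (set X)).
Variables (star : set X -> set X) (C0 : R).
Hypothesis hBB : ball_basis mu BB star.
Hypothesis hE : enlargement mu BB star C0.
Variable G : nat -> set X.
Hypothesis bG : forall n, BB (G n).
Hypothesis hG : forall B, BB B -> exists n, B `<=` G n /\ G n `<=` star (star B).
Let C00 : (0 < C0)%R. Proof. exact: lt_le_trans (enl_ge1 hE). Qed.
Let mB B : BB B -> measurable B. Proof. exact: (bb_measurable hBB). Qed.
Local Notation M phi := (gmax G mu (EFin \o phi)).
Variables (v w : X -> R) (y s0 A C : R).
Hypotheses (mv : measurable_fun [set: X] v) (mw : measurable_fun [set: X] w).
Hypotheses (v0 : forall x, (0 < v x)%R) (w0 : forall x, (0 < w x)%R).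
Hypotheses (y0 : (0 < y)%R) (s01 : (1 < s0)%R).
Hypotheses (A0 : (0 < A)%R) (Cp0 : (0 < C)%R).
Hypothesis hv : muckenhoupt mu BB v y A.
Hypothesis hw : A1_power mu BB w s0 C.
Let s00 : (0 < s0)%R. Proof. exact: lt_trans s01. Qed.

Section truncated.
Variables (s kap : R) (E Q : set X).
Hypotheses (s1 : (1 < s)%R) (ss0 : (s < s0)%R) (k0 : (0 < kap)%R).
Hypotheses (mE : measurable E) (E0 : 0 < mu E) (bQ : BB Q) (EQ : E `<=` Q).
Hypothesis wkap : forall x, E x -> (w x <= kap)%R.
Let s_gt0 : (0 < s)%R. Proof. exact: lt_trans s1. Qed.

Definition wpow (x : X) : R := ((w x * \1_E x) `^ s)%R.
(** Taking a power of a maximal function instead of the weight itself gains the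
    [A_1] condition; the exponent [1 / s] restores the homogeneity of [w]. *)
Definition wlift (x : X) : R := (fine (M wpow x) `^ s^-1)%R.

Lemma measurable_wpow : measurable_fun [set: X] wpow.
Proof.
by apply: measurable_powRF; apply: measurable_funM => //; exact: measurable_indic.
Qed.
Let mphi := measurable_wpow.

Lemma wpow_ge0 x : (0 <= wpow x)%R. Proof. exact: powR_ge0. Qed.

Lemma wpow_in x : E x -> wpow x = (w x `^ s)%R.
Proof. by move=> Ex; rewrite /wpow indicE mem_set// mulr1. Qed.

Lemma wpow_le x : (wpow x <= w x `^ s)%R.
Proof.
apply: ge0_ler_powR; rewrite ?nnegrE ?mulr_ge0//; try exact: ltW.
by rewrite -[leRHS]mulr1 ler_wpM2l ?(ltW (w0 x))// indicE; case: (x \in E).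
Qed.

Lemma gmax_wpow x : 0 < M wpow x <= (kap `^ s)%:E.
Proof.
apply/andP; split.
  apply: (gmax_gt0 hBB hE bG hG x mE E0 bQ EQ mphi wpow_ge0) => z Ez.
  by rewrite wpow_in// powR_gt0.
apply: gmax_le; first by rewrite lee_fin powR_ge0.
move=> n _; have [b b0 bE] := ball_fineE hBB (bG n).
rewrite (meanE _ b0 bE) lee_pdivrMl// -EFinM mulrC EFinM -bE.
rewrite -[leRHS]integral_cst//; last exact: mB.
apply: ge0_le_integral => //.
- exact: mB.
- by move=> z _; rewrite lee_fin wpow_ge0.
- by apply/measurable_EFinP; exact: measurable_funTS.
- move=> z _; rewrite lee_fin; have [Ez|nEz] := pselect (E z).
    rewrite wpow_in//; apply: ge0_ler_powR; rewrite ?nnegrE//; try exact: ltW.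
    exact: wkap.
  by rewrite /wpow indicE memNset// mulr0 powR0 ?gt_eqF// powR_ge0.
Qed.

Lemma gmax_wpow_fin x : M wpow x = (fine (M wpow x))%:E.
Proof.
have /andP[p1 p2] := gmax_wpow x; rewrite fineK// ge0_fin_numE ?(ltW p1)//.
exact: le_lt_trans p2 (ltry _).
Qed.

Lemma fine_gmax_wpow_gt0 x : (0 < fine (M wpow x))%R.
Proof. by rewrite -lte_fin -gmax_wpow_fin; have /andP[] := gmax_wpow x. Qed.

Lemma wlift_gt0 x : (0 < wlift x)%R.
Proof. by rewrite powR_gt0// fine_gmax_wpow_gt0. Qed.

Lemma wlift_le x : (wlift x <= kap)%R.
Proof.
have -> : (kap = (kap `^ s) `^ s^-1)%R by rewrite -powRrM mulfV ?gt_eqF// powRr1// ltW.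
apply: ge0_ler_powR; rewrite ?nnegrE ?powR_ge0//.
- by rewrite invr_ge0 ltW.
- exact: ltW (fine_gmax_wpow_gt0 x).
- by rewrite -lee_fin -gmax_wpow_fin; have /andP[] := gmax_wpow x.
Qed.

Lemma measurable_wlift : measurable_fun [set: X] wlift.
Proof.
apply: measurable_powRF; apply: measurableT_comp => //.
exact: (measurable_gmax hBB bG).
Qed.

Lemma le_wlift : {ae mu, forall x, E x -> (w x <= (2 * C0 ^+ 2) `^ s^-1 * wlift x)%R}.
Proof.
have := le_gmax_ae hBB hE bG hG mphi wpow_ge0; apply: filterS => x.
rewrite gmax_wpow_fin -EFinM lee_fin => H Ex; rewrite wpow_in// in H.
have K0 : (0 <= 2 * C0 ^+ 2)%R by rewrite mulr_ge0// exprn_ge0// ltW.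
have m0 := ltW (fine_gmax_wpow_gt0 x).
have : ((w x `^ s) `^ s^-1 <= (2 * C0 ^+ 2 * fine (M wpow x)) `^ s^-1)%R.
  apply: ge0_ler_powR; rewrite ?nnegrE ?powR_ge0// ?invr_ge0 ?(ltW s_gt0)//.
  exact: mulr_ge0.
by rewrite -powRrM mulfV ?gt_eqF// powRr1 ?(ltW (w0 x))// powRM.
Qed.

(** A.e. on every ball the mean of [w ^ s] is at most a multiple of [w ^ s], by
    Holder's inequality and the [A_1] condition for [w ^ s0] with [s < s0]. *)
Lemma wlift_dominated : {ae mu, forall x, (wlift x <= C `^ s0^-1 * w x)%R}.
Proof.
have H : {ae mu, forall x, forall n, G n x -> mean mu (G n) (EFin \o wpow) <=
    (C `^ (s / s0) * w x `^ s)%:E}.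
  apply/ae_foralln => n; have [b b0 bE] := ball_fineE hBB (bG n).
  have [J [J0 JE aeJ]] := hw (bG n) bE; apply: filterS aeJ => x Jx Gx.
  have {}Jx := Jx Gx; rewrite (meanE _ b0 bE) lee_pdivrMl// -EFinM.
  have a0 : (0 < s / s0)%R by rewrite divr_gt0.
  have a1 : (s / s0 < 1)%R by rewrite ltr_pdivrMr// mul1r.
  have a10 : (0 < 1 - s / s0)%R by rewrite subr_gt0.
  have := @holder_two _ _ _ mu (G n) (fun z => w z `^ s0)%R (cst 1%R) (s / s0) (1 - s / s0)
    (mB (bG n)) (measurable_powRF _ mw) (measurable_cst _) (fun z => powR_ge0 _ _)
    (fun z => ler01) a0 a10 (subrKC _ _).
  rewrite JE /= integral_cst ?mul1e; last exact: mB.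
  rewrite bE !poweR_EFin -EFinM => HH.
  apply: (@le_trans _ _ (\int[mu]_(z in G n) ((w z `^ s0) `^ (s / s0) * 1 `^ (1 - s / s0))%:E)).
    apply: ge0_le_integral => //.
    - exact: mB.
    - by move=> z _; rewrite lee_fin wpow_ge0.
    - by apply/measurable_EFinP; exact: measurable_funTS.
    - apply/measurable_EFinP; apply: measurable_funM; last exact: measurable_cst.
      by apply: measurable_powRF; exact: measurable_powRF.
    - move=> z _; rewrite lee_fin powR1 mulr1 -powRrM mulrC divfK ?gt_eqF//.
      exact: wpow_le.
  apply: (le_trans HH); rewrite lee_fin.
  have le1 : (J `^ (s / s0) <= (C * b * w x `^ s0) `^ (s / s0))%R.
    apply: ge0_ler_powR => //; first exact: ltW.
      by rewrite nnegrE ltW.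
    by rewrite nnegrE !mulr_ge0 ?powR_ge0// ltW.
  apply: (le_trans (ler_wpM2r (powR_ge0 _ _) le1)).
  have [lb ->] := expR_ex b0; have [lC ->] := expR_ex Cp0.
  have [lw ->] := expR_ex (w0 x).
  rewrite !powR_expR -!expRD !powR_expR -!expRD ler_expR.
  by apply: eqle; field; rewrite gt_eqF.
apply: filterS H => x Hx.
have le1 : M wpow x <= (C `^ (s / s0) * w x `^ s)%:E.
  by apply: gmax_le => //; rewrite lee_fin mulr_ge0 ?powR_ge0.
rewrite gmax_wpow_fin lee_fin in le1.
have : (wlift x <= (C `^ (s / s0) * w x `^ s) `^ s^-1)%R.
  apply: ge0_ler_powR; rewrite ?nnegrE ?invr_ge0 ?mulr_ge0 ?powR_ge0 ?(ltW s_gt0)//.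
  exact: ltW (fine_gmax_wpow_gt0 x).
move=> /le_trans; apply; have [lC ->] := expR_ex Cp0; have [lw ->] := expR_ex (w0 x).
rewrite !powR_expR -!expRD powR_expR ler_expR.
by apply: eqle; field; rewrite !gt_eqF.
Qed.

(** [wlift ^ (s P) = (M wpow) ^ P] with [P = s P0], so this is the strong type
    bound for the dual weight. *)
Lemma wlift_strong (P0 c : R) : (forall phi : X -> R, measurable_fun [set: X] phi ->
  (forall z, (0 <= phi z)%R) ->
  \int[mu]_x (M phi x `^ (s * P0) * (w x `^ (1 - s * (s * P0)) * v x)%:E) <=
  c%:E * \int[mu]_x (phi x `^ (s * P0) * (w x `^ (1 - s * (s * P0)) * v x))%:E) ->
  (0 < P0)%R ->
  \int[mu]_x ((wlift x / w x) `^ (s * (s * P0)) * (w x * v x))%:E <=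
  c%:E * \int[mu]_(x in E) (w x * v x)%:E.
Proof.
move=> strong P00; have := strong wpow mphi wpow_ge0.
have e0 : (0 < s * (s * P0))%R by rewrite !mulr_gt0.
congr (_ <= _).
  apply: eq_integral => x _; rewrite gmax_wpow_fin poweR_EFin -EFinM; congr EFin.
  rewrite /wlift; have [l ->] := expR_ex (fine_gmax_wpow_gt0 x).
  have [lw ->] := expR_ex (w0 x).
  rewrite !powR_expR -expRN -!expRD !powR_expR !mulrA -!expRD; congr (expR _ * _)%R.
  by field; rewrite gt_eqF.
congr (_ * _); rewrite [RHS]integral_mkcond; apply: eq_integral => x _.
rewrite patchE; case: ifPn => Ex.
  rewrite wpow_in; last exact/set_mem.
  congr EFin; have [lw ->] := expR_ex (w0 x).
  rewrite !powR_expR mulrA -expRD; congr (expR _ * _)%R; ring.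
by rewrite /wpow indicE (negbTE Ex) mulr0 !powR0 ?mul0r// gt_eqF// mulr_gt0.
Qed.

End truncated.
End extrapolation.

(** * The weighted weak type estimate *)
Lemma measurable_inv {d : measure_display} {X : measurableType d} {R : realType}
  (f : X -> R) : measurable_fun [set: X] f -> (forall x, (0 < f x)%R) ->
  measurable_fun [set: X] (fun x => (f x)^-1)%R.
Proof.
move=> mf f0; rewrite (_ : (fun x => _) = (fun x => f x `^ (- 1))%R).
  exact: measurable_powRF.
by apply/funext => x; rewrite powRN powRr1// ltW.
Qed.

Section weighted_weak.
Context {d : measure_display} {X : measurableType d} {R : realType}.
Variables (mu : {measure set X -> \bar R}) (BB : set (set X)).
Variables (star : set X -> set X) (C0 : R).
Hypothesis hBB : ball_basis mu BB star.
Hypothesis hE : enlargement mu BB star C0.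
Variable G : nat -> set X.
Hypothesis bG : forall n, BB (G n).
Hypothesis hG : forall B, BB B -> exists n, B `<=` G n /\ G n `<=` star (star B).
Let C00 : (0 < C0)%R. Proof. exact: lt_le_trans (enl_ge1 hE). Qed.
Let mB B : BB B -> measurable B. Proof. exact: (bb_measurable hBB). Qed.
Local Notation M phi := (gmax G mu (EFin \o phi)).
Variables (I : Type) (ok : I -> Prop) (t : I -> X -> R) (mm : I -> X -> \bar R).
Variable q : R.
Hypothesis q0 : (0 < q)%R.

(** The comparison of the operator [t] with its maximal function [mm] in the
    form given by [coifman_fefferman]. *)
Definition dominated : Prop := forall D eps eta dl : R, (0 <= D)%R -> (0 <= eps)%R ->
  (0 < eta)%R -> (D ^+ 2 * eps * 3 `^ q <= 2^-1)%R -> (0 < dl)%R -> (dl <= q)%R ->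
  exists2 C : R, (0 < C)%R & forall sg : {measure set X -> \bar R},
  doubling BB star sg D ->
  (forall B A, BB B -> measurable A -> A `<=` B ->
     mu A <= eta%:E * mu B -> sg A <= eps%:E * sg B) ->
  (exists b : R, forall A, measurable A -> sg A <= b%:E * mu A) ->
  forall i (t0 : R), ok i -> (0 < t0)%R ->
  \int[sg]_(x in [set x | t0%:E < (t i x)%:E]) (t i x)%:E `^ dl <=
    C%:E * \int[sg]_x mm i x `^ dl.

Hypothesis mt : forall i, ok i -> measurable_fun [set: X] (t i).
Hypothesis mmm : forall i, measurable_fun [set: X] (mm i).
Hypothesis dom : dominated.

Variables (v w : X -> R) (y s0 A C : R).
Hypotheses (mv : measurable_fun [set: X] v) (mw : measurable_fun [set: X] w).
Hypotheses (v0 : forall x, (0 < v x)%R) (w0 : forall x, (0 < w x)%R).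
Hypotheses (y0 : (0 < y)%R) (s01 : (1 < s0)%R).
Hypotheses (A0 : (0 < A)%R) (Cp0 : (0 < C)%R).
Hypothesis hv : muckenhoupt mu BB v y A.
Hypothesis hw : A1_power mu BB w s0 C.
Let s00 : (0 < s0)%R. Proof. exact: lt_trans s01. Qed.
Let wv0 z : (0 <= w z * v z)%R. Proof. by rewrite mulr_ge0// ltW. Qed.
Let mwv : measurable_fun [set: X] (fun z => w z * v z)%R.
Proof. exact: measurable_funM. Qed.
Local Notation rho := (dens mu wv0 mwv).

Section step.
Variables (i : I) (E : set X) (L : X -> R) (kap th K1 Cz x : R).
Hypotheses (mE : measurable E) (oki : ok i).
Hypotheses (mL : measurable_fun [set: X] L) (L0 : forall z, (0 < L z)%R).
Hypotheses (k0 : (0 < kap)%R) (th0 : (0 < th)%R) (x0 : (0 < x)%R).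
Hypothesis thx : (th + x = 1)%R.
Hypothesis K10 : (0 < K1)%R.
Let W z : R := ((Num.min (v z) kap) `^ x * L z)%R.
Hypothesis W0 : forall z, (0 <= W z)%R.
Hypothesis mW : measurable_fun [set: X] W.
Local Notation sg := (dens mu W0 mW).

Let vsplit z : (v z `^ th * v z `^ x = v z)%R.
Proof.
have [a ->] := expR_ex (v0 z); rewrite !powR_expR -expRD; congr expR.
by rewrite -mulrDl thx mul1r.
Qed.

(** On [E] one has [(l v) ^ th <= t ^ (th q)] and [w <= K1 L]; the remaining
    power [v ^ x], [x = 1 - th], is the first factor of [sg]. *)
Lemma lower_step (t0 l : R) : (0 < l)%R ->
  (forall z, E z -> (v z <= kap)%R) ->
  (forall z, E z -> (t0 < t i z)%R /\ (l * v z <= t i z `^ q)%R) ->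
  {ae mu, forall z, E z -> (w z <= K1 * L z)%R} ->
  (l `^ th)%:E * \int[mu]_(z in E) (w z * v z)%:E <=
  K1%:E * \int[sg]_(z in [set z | t0%:E < (t i z)%:E]) (t i z)%:E `^ (th * q).
Proof.
move=> l0 vkap Et wL.
have mS : measurable [set z | t0%:E < (t i z)%:E].
  by apply: measurable_gt; apply/measurable_EFinP; exact: mt.
have mtp S : measurable_fun S (fun z => (t i z)%:E `^ (th * q)).
  by apply: measurable_poweRF; apply/measurable_EFinP; exact: mt.
have ES : E `<=` [set z | t0%:E < (t i z)%:E].
  by move=> z /Et[? _] /=; rewrite lte_fin.
rewrite integral_dens//; last by move=> z _; exact: poweR_ge0.
have mI S : measurable_fun S (fun z => (t i z)%:E `^ (th * q) * (W z)%:E).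
  apply: emeasurable_funM => //; apply/measurable_EFinP; exact: measurable_funTS.
have I0 z : 0 <= (t i z)%:E `^ (th * q) * (W z)%:E.
  by rewrite mule_ge0 ?poweR_ge0// lee_fin.
apply: (@le_trans _ _ (K1%:E * \int[mu]_(z in E) ((t i z)%:E `^ (th * q) * (W z)%:E))); last first.
  apply: lee_wpmul2l; first by rewrite lee_fin ltW.
  by apply: ge0_subset_integral.
rewrite -[leLHS]ge0_integralZl; last 4 first.
- exact: mE.
- by apply/measurable_EFinP; exact: measurable_funTS.
- by move=> z _; rewrite lee_fin.
- by rewrite lee_fin powR_ge0.
rewrite -[leRHS]ge0_integralZl; last 4 first.
- exact: mE.
- exact: mI.
- by move=> z _; exact: I0.
- by rewrite lee_fin ltW.
apply: ae_ge0_le_integral => //.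
- by move=> z _; rewrite -EFinM lee_fin mulr_ge0 ?powR_ge0.
- by apply: measurable_funeM; apply/measurable_EFinP; exact: measurable_funTS.
- by move=> z _; rewrite mule_ge0// lee_fin ltW.
- by apply: measurable_funeM.
apply: filterS wL => z wLz Ez; have [_ lt] := Et z Ez; have {}wLz := wLz Ez.
rewrite poweR_EFin -!EFinM lee_fin /W (min_idPl (vkap z Ez)).
have -> : (l `^ th * (w z * v z) = (l * v z) `^ th * (v z `^ x * w z))%R.
  rewrite powRM ?(ltW l0) ?(ltW (v0 z))// -[in LHS](vsplit z); ring.
have -> : (K1 * (t i z `^ (th * q) * (v z `^ x * L z)) =
   t i z `^ (th * q) * (v z `^ x * (K1 * L z)))%R by ring.
apply: ler_pM; rewrite ?powR_ge0 ?mulr_ge0 ?powR_ge0 ?(ltW (w0 z))//.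
  rewrite [(th * q)%R]mulrC powRrM; apply: ge0_ler_powR; rewrite ?nnegrE ?powR_ge0 ?(ltW th0)//.
  by rewrite mulr_ge0 ?ltW.
by rewrite ler_wpM2l ?powR_ge0.
Qed.

Let Z z : R := (Num.min (L z / w z) Cz)%R.
Let g z : \bar R := mm i z `^ q * (v z)^-1%:E.

(** Writing [L = (L / w) w] and [v ^ x = v v ^ (- th)] turns the integral into
    one with respect to [w v dmu]. *)
Lemma upper_step : (0 < Cz)%R -> {ae mu, forall z, (L z <= Cz * w z)%R} ->
  \int[sg]_z mm i z `^ (th * q) <= \int[rho]_z (g z `^ th * (Z z)%:E).
Proof.
move=> Cz0 LC.
have mV : measurable_fun [set: X] (fun z => (v z)^-1%R) by exact: measurable_inv.
have mg : measurable_fun [set: X] g.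
  apply: emeasurable_funM; first exact: measurable_poweRF.
  exact/measurable_EFinP.
have mZ : measurable_fun [set: X] Z.
  apply: measurable_minr => //; apply: measurable_funM => //.
  exact: measurable_inv.
have Z0 z : (0 <= Z z)%R.
  by rewrite /Z le_min (ltW Cz0) divr_ge0 ?ltW.
rewrite integral_dens//; last 2 first.
- exact: measurable_poweRF.
- by move=> z _; exact: poweR_ge0.
have mgZ : measurable_fun [set: X] (fun z => g z `^ th * (Z z)%:E).
  apply: emeasurable_funM; first exact: measurable_poweRF.
  exact/measurable_EFinP.
have gZ0 z : 0 <= g z `^ th * (Z z)%:E by rewrite mule_ge0 ?poweR_ge0// lee_fin.
rewrite integral_dens//.
apply: ae_ge0_le_integral => //.
- by move=> z _; rewrite mule_ge0 ?poweR_ge0// lee_fin.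
- apply: emeasurable_funM; first exact: measurable_poweRF.
  exact/measurable_EFinP.
- by move=> z _; rewrite mule_ge0// lee_fin.
- by apply: emeasurable_funM => //; exact/measurable_EFinP.
apply: filterS LC => z Lz _.
have -> : Z z = (L z / w z)%R.
  by rewrite /Z; apply: min_idPl; rewrite ler_pdivrMr.
rewrite /g poweRM ?poweR_ge0 ?lee_fin ?invr_ge0 ?(ltW (v0 z))//.
rewrite -poweRrM [(q * th)%R]mulrC poweR_EFin -!muleA -!EFinM.
apply: lee_wpmul2l; first exact: poweR_ge0.
rewrite lee_fin /W.
have -> : ((v z)^-1 `^ th * (L z / w z * (w z * v z)) = v z `^ x * L z)%R.
  transitivity ((v z)^-1 `^ th * (v z `^ th * v z `^ x) * L z)%R.
    by rewrite vsplit; field; rewrite gt_eqF.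
  rewrite mulrA -powRM ?invr_ge0 ?(ltW (v0 z))// mulVf ?gt_eqF//.
  by rewrite powR1 mul1r.
rewrite ler_wpM2r ?(ltW (L0 z))//.
apply: ge0_ler_powR; rewrite ?nnegrE ?(ltW x0) ?(ltW (v0 z))//.
  by rewrite le_min !ltW.
by rewrite ge_min lexx.
Qed.

Lemma level_step (p W1 : R) : (0 < p)%R ->
  \int[mu]_z ((L z / w z) `^ p * (w z * v z))%:E <= W1%:E ->
  forall a, (0 < a)%R -> rho [set z | (a < Z z)%R] <= (W1 * a `^ (- p))%:E.
Proof.
move=> p0 HW a a0; rewrite /dens.
have mq : measurable_fun [set: X] (fun z => L z / w z)%R.
  by apply: measurable_funM => //; exact: measurable_inv.
have mZ : measurable_fun [set: X] Z by exact: measurable_minr.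
have mS : measurable [set z | (a < Z z)%R].
  rewrite (_ : [set z | _] = [set z | a%:E < (EFin \o Z) z]).
    by apply: measurable_gt; exact/measurable_EFinP.
  by apply/seteqP; split => z /=; rewrite lte_fin.
have ap0 : (0 < a `^ p)%R by exact: powR_gt0.
have -> : (W1 * a `^ (- p) = (a `^ p)^-1 * W1)%R by rewrite mulrC powRN.
rewrite EFinM lee_pdivlMl//.
apply: le_trans HW.
rewrite -ge0_integralZl; last 4 first.
- exact: mS.
- by apply/measurable_EFinP; exact: measurable_funTS.
- by move=> z _; rewrite lee_fin.
- by rewrite lee_fin ltW.
have mF : measurable_fun [set: X] (fun z => ((L z / w z) `^ p * (w z * v z))%:E).
  by apply/measurable_EFinP; apply: measurable_funM => //; exact: measurable_powRF.
have F0 z : 0 <= ((L z / w z) `^ p * (w z * v z))%:E.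
  by rewrite lee_fin mulr_ge0// powR_ge0.
apply: (@le_trans _ _ (\int[mu]_(z in [set z | (a < Z z)%R])
   ((L z / w z) `^ p * (w z * v z))%:E)).
  apply: ge0_le_integral => //.
  - by move=> z _; rewrite -EFinM lee_fin mulr_ge0// ltW.
  - by apply: measurable_funeM; apply/measurable_EFinP; exact: measurable_funTS.
  - exact: measurable_funTS.
  - move=> z /=; rewrite lt_min => /andP[az _]; rewrite -EFinM lee_fin.
    apply: ler_wpM2r => //; apply: ge0_ler_powR; rewrite ?nnegrE ?(ltW p0) ?(ltW a0)//.
      by rewrite divr_ge0 ?ltW.
    exact: ltW.
by apply: ge0_subset_integral.
Qed.

End step.
Lemma theta_exists (p s1 : R) : (1 < p)%R -> (1 < s1)%R ->
  exists x : R, [/\ (0 < x)%R, (x < 1)%R, (p * x < 1)%R & (x + s1^-1 < 1)%R].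
Proof.
move=> p1 s11; have p0 : (0 < p)%R by exact: lt_trans p1.
have s10 : (0 < s1)%R by exact: lt_trans s11.
have i1 : (s1^-1 < 1)%R by rewrite invf_lt1.
have i2 : (p^-1 < 1)%R by rewrite invf_lt1.
have i3 : (0 < p^-1)%R by rewrite invr_gt0.
exists (Num.min (p^-1 / 2) ((1 - s1^-1) / 2))%R.
set x := Num.min _ _; have x1 : (x <= p^-1 / 2)%R by rewrite ge_min lexx.
have x2 : (x <= (1 - s1^-1) / 2)%R by rewrite ge_min lexx orbT.
split.
- by rewrite lt_min !divr_gt0// subr_gt0.
- by lra.
- by rewrite mulrC -ltr_pdivlMr// mul1r; lra.
- by lra.
Qed.

Lemma absorb (l r K2 K c th : R) : (0 < l)%R -> (0 < r)%R -> (0 < K2)%R ->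
  (0 < K)%R -> (0 < c)%R -> (0 < th)%R ->
  (l `^ th * r <= K2 * (K `^ th * (c * r) `^ (1 - th)))%R ->
  (l * r <= (K2 * c `^ (1 - th)) `^ th^-1 * K)%R.
Proof.
move=> l0 r0 K20 K0 c0 th0.
have [a ->] := expR_ex l0; have [b ->] := expR_ex r0.
have [e ->] := expR_ex K20; have [g ->] := expR_ex K0; have [h ->] := expR_ex c0.
rewrite -!expRD !powR_expR -!expRD !powR_expR -!expRD !ler_expR => H.
rewrite -(ler_pM2l th0) -subr_ge0.
have -> : (th * (th^-1 * (e + (1 - th) * h) + g) - th * (a + b) =
  e + (th * g + (1 - th) * (h + b)) - (th * a + b))%R by field; rewrite gt_eqF.
by rewrite subr_ge0.
Qed.

(** The comparison is applied to the measure with density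
    [min (v, kap) ^ x L], where [L] majorizes [w] on [E]; the minimum keeps the
    density bounded.  The exponent [s2] lies between 1 and [s], so that
    [L ^ s2] is an [A_1] weight, and [x] is so small that both the product
    weight and [weak_product] are available. *)
Lemma weighted_weak : exists2 Cf : R, (0 < Cf)%R &
  forall i E Q kap t0 l K, ok i -> measurable E -> BB Q -> E `<=` Q ->
  (0 < kap)%R -> (forall x, E x -> (w x <= kap)%R /\ (v x <= kap)%R) ->
  (0 < t0)%R -> (0 < l)%R -> (0 < K)%R ->
  (forall x, E x -> (t0 < t i x)%R /\ (l * v x <= t i x `^ q)%R) ->
  (forall a, (0 < a)%R ->
    \int[mu]_(x in [set x | (a * v x)%:E < mm i x `^ q]) (w x * v x)%:E
      <= (K / a)%:E) ->
  l%:E * \int[mu]_(x in E) (w x * v x)%:E <= (Cf * K)%:E.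
Proof.
have [s [P0 [s1 ss0 P01 exps]]] := exponents_exist s01 y0.
have s_gt0 : (0 < s)%R by exact: lt_trans s1.
have P00 : (0 < P0)%R by exact: lt_trans P01.
pose p := (s * (s * P0))%R.
have PP : (P0 < s * P0)%R by rewrite ltr_pMl.
have p1 : (1 < p)%R.
  by apply: (lt_trans P01); apply: (lt_trans PP); rewrite ltr_pMl// mulr_gt0.
have p0 : (0 < p)%R by exact: lt_trans p1.
have [c c0 strong] := dual_weight_strong hBB hE bG mv mw v0 w0 y0 s00 p1 P01 A0 Cp0
  hv hw exps PP.
pose s2 := ((1 + s) / 2)%R.
have s21 : (1 < s2)%R by rewrite /s2; lra.
have s2s : (0 < s2 < s)%R by rewrite /s2; lra.
have s20 : (0 < s2)%R by case/andP: s2s.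
have [x [x0 x1 px xs]] := theta_exists p1 s21.
pose th := (1 - x)%R; have th0 : (0 < th)%R by rewrite subr_gt0.
have th1 : (th < 1)%R by rewrite /th; lra.
have thx : (th + x = 1)%R by rewrite /th; lra.
have ex : (1 - th = x)%R by rewrite /th; lra.
have [Cr Cr0 HCr] := A1_power_gmax hBB hE bG hG s2s.
have A10 : (0 < A + 1)%R by rewrite addr_gt0.
have lw0 := product_const_gt0 x y s2 A10 Cr0.
set lw := product_const x y s2 (A + 1)%R Cr in lw0.
pose D : R := (lw^-1 * C0 `^ (1 + x / y))%R.
have D0 : (0 < D)%R by rewrite mulr_gt0 ?invr_gt0// powR_gt0.
have D3 : (0 < 2 * (D ^+ 2 * 3 `^ q))%R.
  by apply: mulr_gt0 => //; apply: mulr_gt0; [exact: exprn_gt0|exact: powR_gt0].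
pose eps : R := ((2 * (D ^+ 2 * 3 `^ q))^-1)%R.
have eps0 : (0 < eps)%R by rewrite invr_gt0.
pose eta : R := ((lw * eps) `^ (1 - x - s2^-1)^-1)%R.
have eta0 : (0 < eta)%R by rewrite powR_gt0// mulr_gt0.
have Deps : (D ^+ 2 * eps * 3 `^ q <= 2^-1)%R.
  apply: eqle; rewrite /eps.
  by field; rewrite !gt_eqF ?powR_gt0.
have dlq : (th * q <= q)%R by rewrite ler_piMl ?ltW.
have [CF CF0 HCF] := dom (ltW D0) (ltW eps0) eta0 Deps (mulr_gt0 th0 q0) dlq.
pose Cz := (C `^ s0^-1)%R; have Cz0 : (0 < Cz)%R by exact: powR_gt0.
have th01 : (0 < th < 1)%R by rewrite th0.
have pth : (p * (1 - th) < 1)%R by rewrite ex.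
have [cw cw0 Hcw] := weak_product Cz0 p0 th01 pth.
pose K1 := ((2 * C0 ^+ 2) `^ s^-1)%R.
have K10 : (0 < K1)%R by rewrite powR_gt0// mulr_gt0// exprn_gt0.
pose K2 := (K1 * (CF * cw))%R.
have K20 : (0 < K2)%R by rewrite !mulr_gt0.
exists ((K2 * c `^ (1 - th)) `^ th^-1)%R.
  by rewrite powR_gt0// mulr_gt0// powR_gt0.
move=> i E Q kap t0 l K oki mE bQ EQ k0 Ekap t00 l0 K0 Et weak.
have mwvE S : measurable_fun S (fun z => (w z * v z)%:E).
  by apply/measurable_EFinP; exact: measurable_funTS.
have [E0|Ene] := eqVneq (mu E) 0.
  rewrite null_set_integral// mule0 lee_fin mulr_ge0 ?powR_ge0//; exact: ltW.
have E0 : 0 < mu E by rewrite lt0e Ene measure_ge0.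
have wk z (Ez : E z) : (w z <= kap)%R by case: (Ekap z Ez).
have vk z (Ez : E z) : (v z <= kap)%R by case: (Ekap z Ez).
pose L := wlift mu G w s E.
have L0 z : (0 < L z)%R by exact: (wlift_gt0 hBB hE bG hG mw w0 s1 k0 mE E0 bQ EQ wk).
have Lk z : (L z <= kap)%R by exact: (wlift_le hBB hE bG hG mw w0 s1 k0 mE E0 bQ EQ wk).
have mL : measurable_fun [set: X] L by exact: (measurable_wlift hBB bG).
have revL : A1_power mu BB L s2 Cr.
  apply: HCr; [exact: measurable_wpow|exact: wpow_ge0|] => z.
  have := gmax_wpow hBB hE bG hG mw w0 s1 k0 mE E0 bQ EQ wk z.
  by move=> /andP[-> /le_lt_trans]; apply; rewrite ltry.
have mvm : measurable_fun [set: X] (fun z => Num.min (v z) kap) by exact: measurable_minr.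
have vm0 z : (0 < Num.min (v z) kap)%R by rewrite lt_min v0.
have muckm := muckenhoupt_min hBB mv v0 y0 k0 hv.
have W0 z : (0 <= (Num.min (v z) kap) `^ x * L z)%R by rewrite mulr_ge0 ?powR_ge0// ltW.
have mW : measurable_fun [set: X] (fun z => (Num.min (v z) kap) `^ x * L z)%R.
  by apply: measurable_funM => //; exact: measurable_powRF.
pose sg : {measure set X -> \bar R} := dens mu W0 mW.
have dsg : doubling BB star sg D :=
  product_doubling hBB hE mvm mL vm0 L0 x0 y0 s20 A10 Cr0 xs muckm revL W0 mW.
have ssg B S (bB : BB B) (mS : measurable S) (SB : S `<=` B) :
  mu S <= eta%:E * mu B -> sg S <= eps%:E * sg B :=
  product_small hBB mvm mL vm0 L0 x0 y0 s20 A10 Cr0 xs muckm revL W0 mW eps0 bB mS SB.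
have bsg : exists b : R, forall S, measurable S -> sg S <= b%:E * mu S.
  exists (kap `^ x * kap)%R => S mS; rewrite -[leRHS]integral_cst//.
  apply: ge0_le_integral => //.
  - by move=> z _; rewrite lee_fin.
  - by apply/measurable_EFinP; exact: measurable_funTS.
  - move=> z _; rewrite lee_fin; apply: ler_pM; rewrite ?powR_ge0 ?(ltW (L0 z))//.
    apply: ge0_ler_powR; rewrite ?nnegrE ?(ltW x0) ?(ltW k0) ?(ltW (vm0 z))//.
    by rewrite ge_min lexx orbT.
have S1 := HCF sg dsg ssg bsg i t0 oki t00.
have SA := @lower_step i E L kap th K1 x mE oki th0 thx K10 W0 mW t0 l l0 vk Et
  (le_wlift hBB hE bG hG mw w0 s1 k0 mE E0 bQ EQ wk).
have LC := wlift_dominated hBB hE bG hG mw w0 s01 Cp0 hw s1 ss0 k0 mE E0 bQ EQ wk.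
have SB := @upper_step i L kap th Cz x mL L0 k0 x0 thx W0 mW Cz0 LC.
have SC := wlift_strong hBB hE bG hG mw w0 s1 k0 mE E0 bQ EQ wk strong P00.
have r0 : 0 < \int[mu]_(z in E) (w z * v z)%:E.
  by apply: integral_gt0 => // z _; rewrite mulr_gt0.
have roo : \int[mu]_(z in E) (w z * v z)%:E < +oo.
  apply: (@le_lt_trans _ _ ((kap * kap)%:E * mu E)).
    rewrite -[leRHS]integral_cst//; apply: ge0_le_integral => //.
    - by move=> z _; rewrite lee_fin.
    - by move=> z Ez; rewrite lee_fin ler_pM ?(ltW (w0 z)) ?(ltW (v0 z)) ?wk ?vk.
  apply: (@le_lt_trans _ _ ((kap * kap)%:E * mu Q)).
    rewrite lee_wpmul2l ?lee_fin ?mulr_ge0 ?(ltW k0)//.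
    by apply: le_measure; rewrite ?inE//; exact: mB.
  have [b b0 ->] := ball_fineE hBB bQ; by rewrite -EFinM ltry.
have rE : \int[mu]_(z in E) (w z * v z)%:E = (fine (\int[mu]_(z in E) (w z * v z)%:E))%:E.
  by rewrite fineK// ge0_fin_numE// ltW.
move: r0 SA SC; rewrite rE; set rr := fine _ => r0 SA SC.
rewrite lte_fin in r0.
pose Z z : R := (Num.min (L z / w z) Cz)%R.
pose g z : \bar R := mm i z `^ q * (v z)^-1%:E.
have mV : measurable_fun [set: X] (fun z => (v z)^-1%R) by exact: measurable_inv.
have mg : measurable_fun [set: X] g.
  apply: emeasurable_funM; first exact: measurable_poweRF.
  exact/measurable_EFinP.
have mZ : measurable_fun [set: X] Z.
  apply: measurable_minr => //; apply: measurable_funM => //.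
  exact: measurable_inv.
have g0 z : 0 <= g z by rewrite mule_ge0 ?poweR_ge0// lee_fin invr_ge0 ltW.
have Z0 z : (0 <= Z z <= Cz)%R.
  by rewrite /Z le_min (ltW Cz0) ge_min lexx orbT !andbT divr_ge0 ?ltW.
have crr0 : (0 <= c * rr)%R by rewrite mulr_ge0 ?ltW.
have weak' a : (0 < a)%R -> rho [set z | a%:E < g z] <= (K / a)%:E.
  move=> a0; rewrite (_ : [set z | _] = [set z | (a * v z)%:E < mm i z `^ q]); first exact: weak.
  by apply/seteqP; split => z /=; rewrite /g lte_pdivlMr// -EFinM.
have dist := @level_step L Cz mL L0 p (c * rr)%R p0 SC.
have SD := Hcw _ _ rho g Z K (c * rr)%R mg g0 mZ Z0 K0 crr0 weak' dist.
rewrite -EFinM lee_fin; apply: absorb => //.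
rewrite -lee_fin EFinM; apply: (le_trans SA).
rewrite /K2 -!mulrA EFinM; apply: lee_wpmul2l; first by rewrite lee_fin ltW.
apply: (le_trans S1); rewrite EFinM; apply: lee_wpmul2l; first by rewrite lee_fin ltW.
apply: (le_trans SB); apply: (le_trans SD).
by rewrite mulrA.
Qed.

End weighted_weak.

(** * From the classes of weights to quantitative conditions *)
Section weight_classes.
Context {d : measure_display} {X : measurableType d} {R : realType}.
Variables (mu : {measure set X -> \bar R}) (BB : set (set X)).
Variables (star : set X -> set X).
Hypothesis hBB : ball_basis mu BB star.
Let mB B : BB B -> measurable B. Proof. exact: (bb_measurable hBB). Qed.

Lemma ae_witness (P : X -> Prop) B : measurable B -> 0 < mu B ->
  {ae mu, forall x, P x} -> exists2 x, B x & P x.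
Proof.
move=> mB' B0 [N [mN N0 PN]]; apply: contrapT => nP.
suff : mu B <= mu N by rewrite N0 leNgt B0.
apply: le_measure; rewrite ?inE// => x Bx; apply: PN => /= Px.
by apply: nP; exists x.
Qed.

Lemma finite_bound (L : \bar R) : L < +oo -> exists2 c : R, (0 < c)%R & L <= c%:E.
Proof.
case: L => [r| |] // _; last by exists 1%R => //; exact: leNye.
exists (Num.max r 1)%R; first by rewrite lt_max ltr01 orbT.
by rewrite lee_fin le_max lexx.
Qed.

(** The value 1 is used on the null set where the weight is not a positive
    real. *)
Lemma real_version (u : X -> \bar R) : weight mu u -> exists ur : X -> R,
  [/\ measurable_fun [set: X] ur, forall x, (0 < ur x)%R &
   {ae mu, forall x, u x = (ur x)%:E}].
Proof.
move=> [mu_ aeu]; pose z x := fine (u x).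
exists (fun x => if (0 < z x)%R then z x else 1%R); split.
- have mz : measurable_fun [set: X] z by exact: measurableT_comp.
  by apply: measurable_fun_ifT => //; exact: measurable_fun_ltr.
- by move=> x; case: ifPn.
- apply: filterS aeu => x /andP[u0 uoo].
  have uf : u x \is a fin_num by rewrite ge0_fin_numE// ltW.
  have z0 : (0 < z x)%R by rewrite /z fine_gt0// u0.
  by rewrite z0 /z fineK.
Qed.

Lemma mean_ae_eq (B : set X) (F F' : X -> \bar R) : measurable B ->
  measurable_fun [set: X] F -> measurable_fun [set: X] F' ->
  {ae mu, forall x, F x = F' x} -> mean mu B F = mean mu B F'.
Proof.
move=> mB' mF mF' FF'; rewrite /mean; congr (_ * _).
apply: ae_eq_integral => //; try exact: measurable_funTS.
by apply: filterS FF' => x ->.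
Qed.

Section real_weight.
Variables (u : X -> \bar R) (ur : X -> R).
Hypotheses (mu_ : measurable_fun [set: X] u) (mur : measurable_fun [set: X] ur).
Hypotheses (ur0 : forall x, (0 < ur x)%R) (uE : {ae mu, forall x, u x = (ur x)%:E}).
Let murE : measurable_fun [set: X] (EFin \o ur). Proof. exact/measurable_EFinP. Qed.

Let mean_pow (a : R) B : BB B ->
  mean mu B (fun x => u x `^ a) = mean mu B (fun x => (ur x `^ a)%:E).
Proof.
move=> bB; apply: mean_ae_eq; first exact: mB.
- exact: measurable_poweRF.
- by apply/measurable_EFinP; exact: measurable_powRF.
- by apply: filterS uE => x ->; rewrite poweR_EFin.
Qed.

Let mean_u B : BB B -> mean mu B u = mean mu B (EFin \o ur).
Proof. by move=> bB; apply: mean_ae_eq => //; exact: mB. Qed.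

(** One null set works for all the balls, because the supremum over the balls
    is inside the essential supremum that defines [A_1]. *)
Definition A1_real (c : R) : Prop := {ae mu, forall x, forall B, BB B -> B x ->
  mean mu B (EFin \o ur) <= (c * ur x)%:E}.

Lemma A1_mean : A1_const mu BB u < +oo -> exists2 c : R, (0 < c)%R & A1_real c.
Proof.
rewrite /A1_const unlock.
case: ifPn => [X0 /finite_bound[c c0 Lc]|X0 _]; last first.
  exists 1%R => //; have T0 : mu [set: X] = 0.
    by apply/eqP; rewrite eq_le measure_ge0 andbT leNgt.
  by exists [set: X]; split.
exists c => //.
have := ess_sup_ge mu (abse \o (fun x => maximal1 mu BB u x / u x)).
apply: filterS2 uE => x ux /= H B bB Bx; rewrite ux in H.
have {H} : maximal1 mu BB u x <= (c * ur x)%:E.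
  move: (le_trans (le_trans (lee_abs _) H) Lc).
  by rewrite inver gt_eqF// lee_pdivrMr// -EFinM.
apply: le_trans; rewrite /maximal1 /maximal asboolT; last by exists B.
apply: ereal_sup_ubound; exists B => //; rewrite big_ord1 /avg invr1 poweRe1; last first.
  by apply: mean_ge0 => z; exact: poweR_ge0.
apply: mean_ae_eq; first exact: mB.
- by apply: measurable_poweRF; exact: measurableT_comp.
- exact: murE.
- apply: filterS uE => z -> /=; rewrite ger0_norm; last exact: ltW.
  by rewrite powRr1// ltW.
Qed.

Lemma A1_integral c B (b : R) : A1_real c -> BB B -> mu B = b%:E -> (0 < b)%R ->
  exists2 n : R, (0 < n)%R & \int[mu]_(x in B) (ur x)%:E = n%:E.
Proof.
move=> Ac bB bE b0; have [x Bx H] := ae_witness (mB bB) (ball_pos hBB bB) Ac.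
have := H B bB Bx; rewrite (meanE _ b0 bE) lee_pdivrMl// -EFinM => up.
have p : 0 < \int[mu]_(x in B) (ur x)%:E.
  apply: integral_gt0 => //; [exact: mB|exact: ball_pos hBB _ bB|].
  by move=> z; exact: ltW.
exists (fine (\int[mu]_(x in B) (ur x)%:E)).
  by rewrite fine_gt0// p (le_lt_trans up)// ltry.
by rewrite fineK// ge0_fin_numE ?(ltW p)// (le_lt_trans up)// ltry.
Qed.

(** The mean of [u ^ s] is at most a multiple of the power [s] of the mean of
    [u], hence of [u ^ s] a.e. on the ball. *)
Lemma RH_A1_power c s : (0 < c)%R -> A1_real c -> (1 < s)%R -> RH mu BB s u ->
  exists2 C : R, (0 < C)%R & A1_power mu BB ur s C.
Proof.
move=> c0 Ac s1 [_ /finite_bound[k k0 Hk]].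
have s0 : (0 < s)%R by exact: lt_trans s1.
exists ((k * c) `^ s)%R; first by rewrite powR_gt0// mulr_gt0.
move=> B b bB bE; have [b' b'0 b'E] := ball_fineE hBB bB.
have b0 : (0 < b)%R by move: b'E; rewrite bE => -[->].
have [n n0 nE] := A1_integral Ac bB bE b0.
have : mean mu B (fun x => u x `^ s) `^ s^-1 / mean mu B u <= k%:E.
  by apply: le_trans Hk; apply: ereal_sup_ubound; exists B.
rewrite mean_pow// mean_u// [X in _ / X](meanE _ b0 bE) nE -EFinM inver.
have nb0 : (0 < b^-1 * n)%R by rewrite mulr_gt0// invr_gt0.
rewrite gt_eqF// lee_pdivrMr// -EFinM => H.
have m0 : 0 <= mean mu B (fun x => (ur x `^ s)%:E).
  by apply: mean_ge0 => z; rewrite lee_fin powR_ge0.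
have {}H : mean mu B (fun x => (ur x `^ s)%:E) <= ((k * (b^-1 * n)) `^ s)%:E.
  have := poweR_le (ltW s0) (poweR_ge0 _ _) H.
  by rewrite -poweRrM mulVf ?gt_eqF// poweRe1// poweR_EFin.
rewrite (meanE _ b0 bE) lee_pdivrMl// -EFinM in H.
have p : 0 < \int[mu]_(x in B) (ur x `^ s)%:E.
  apply: integral_gt0 => //; [exact: mB|exact: ball_pos hBB _ bB| | |].
  - exact: measurable_powRF.
  - by move=> z; exact: powR_ge0.
  - by move=> z _; exact: powR_gt0.
have JE : \int[mu]_(x in B) (ur x `^ s)%:E = (fine (\int[mu]_(x in B) (ur x `^ s)%:E))%:E.
  by rewrite fineK// ge0_fin_numE ?(ltW p)// (le_lt_trans H)// ltry.
exists (fine (\int[mu]_(x in B) (ur x `^ s)%:E)); split => //.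
  by rewrite -lte_fin -JE.
apply: filterS Ac => x Hx Bx; rewrite -lee_fin -JE; apply: (le_trans H).
have := Hx B bB Bx; rewrite (meanE _ b0 bE) nE -EFinM !lee_fin => nc.
rewrite [leRHS](_ : _ = b * (k * (c * ur x)) `^ s)%R; last first.
  have -> : ((k * (c * ur x)) `^ s = (k * c) `^ s * ur x `^ s)%R.
    by rewrite mulrA [LHS]powRM ?mulr_ge0 ?(ltW k0) ?(ltW c0) ?(ltW (ur0 x)).
  by ring.
rewrite ler_wpM2l ?(ltW b0)//; apply: ge0_ler_powR; rewrite ?nnegrE ?(ltW s0)//.
- by rewrite mulr_ge0 ?(ltW k0) ?(ltW nb0).
- by rewrite !mulr_ge0 ?(ltW k0) ?(ltW c0) ?(ltW (ur0 x)).
- by rewrite ler_wpM2l ?(ltW k0).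
Qed.

Lemma A1_muckenhoupt c : (0 < c)%R -> A1_real c -> muckenhoupt mu BB ur 1 c.
Proof.
move=> c0 Ac B b bB bE; have [b' b'0 b'E] := ball_fineE hBB bB.
have b0 : (0 < b)%R by move: b'E; rewrite bE => -[->].
have [n n0 nE] := A1_integral Ac bB bE b0.
have p : 0 < \int[mu]_(x in B) (ur x `^ (- 1))%:E.
  apply: integral_gt0 => //; [exact: mB|exact: ball_pos hBB _ bB| | |].
  - exact: measurable_powRF.
  - by move=> z; exact: powR_ge0.
  - by move=> z _; exact: powR_gt0.
have H : \int[mu]_(x in B) (ur x `^ (- 1))%:E <= (c * b / n * b)%:E.
  rewrite EFinM -bE -[leRHS]integral_cst//; last exact: mB.
  apply: ae_ge0_le_integral => //.
  - exact: mB.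
  - by move=> z _; rewrite lee_fin powR_ge0.
  - by apply/measurable_EFinP; exact: measurable_powRF.
  - by move=> z _; rewrite lee_fin divr_ge0 ?mulr_ge0 ?ltW.
  - apply: filterS Ac => x Hx Bx; have := Hx B bB Bx.
    rewrite (meanE _ b0 bE) nE -EFinM !lee_fin powRN powRr1 ?(ltW (ur0 x))//.
    rewrite ler_pdivrMl// => nc.
    rewrite ler_pdivlMr// mulrC ler_pdivrMr//.
    by apply: (le_trans nc); apply: eqle; ring.
have JE : \int[mu]_(x in B) (ur x `^ (- 1))%:E = (fine (\int[mu]_(x in B) (ur x `^ (- 1))%:E))%:E.
  by rewrite fineK// ge0_fin_numE ?(ltW p)// (le_lt_trans H)// ltry.
exists n, (fine (\int[mu]_(x in B) (ur x `^ (- 1))%:E)); split => //.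
  by split => //; rewrite -lte_fin -JE.
move: H; rewrite JE lee_fin => H.
rewrite powRr1 ?(ltW n0)//; apply: (le_trans (ler_wpM2l (ltW n0) H)).
have -> : (1 + 1 = 2%:R :> R)%R by [].
rewrite powR_mulrn ?(ltW b0)//; apply: eqle.
by field; rewrite gt_eqF.
Qed.

Lemma Ap_muckenhoupt p : (1 < p)%R -> Ap_const mu BB p u < +oo ->
  exists2 A : R, (0 < A)%R & muckenhoupt mu BB ur (p - 1)^-1 A.
Proof.
move=> p1 /finite_bound[k k0 Hk].
have p10 : (0 < p - 1)%R by rewrite subr_gt0.
set y := ((p - 1)^-1)%R; have y0 : (0 < y)%R by rewrite invr_gt0.
exists (k `^ y)%R; first exact: powR_gt0.
move=> B b bB bE; have [b' b'0 b'E] := ball_fineE hBB bB.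
have b0 : (0 < b)%R by move: b'E; rewrite bE => -[->].
have : mean mu B u * mean mu B (fun x => u x `^ (1 - p / (p - 1))) `^ (p - 1) <= k%:E.
  by apply: le_trans Hk; apply: ereal_sup_ubound; exists B.
have -> : (1 - p / (p - 1) = - y)%R.
  by rewrite /y; field; rewrite gt_eqF.
rewrite mean_pow// mean_u// !(meanE _ b0 bE).
have pN : 0 < \int[mu]_(x in B) (EFin \o ur) x.
  apply: integral_gt0 => //; [exact: mB|exact: ball_pos hBB _ bB|].
  by move=> z; exact: ltW.
have pN' : 0 < \int[mu]_(x in B) (ur x `^ (- y))%:E.
  apply: integral_gt0 => //; [exact: mB|exact: ball_pos hBB _ bB| | |].
  - exact: measurable_powRF.
  - by move=> z; exact: powR_ge0.
  - by move=> z _; exact: powR_gt0.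
move: pN pN'.
set NN := \int[mu]_(x in B) (EFin \o ur) x; set NN' := \int[mu]_(x in B) _.
move=> pN pN' H; rewrite -/NN -/NN'.
have bi0 : (0 < b^-1)%R by rewrite invr_gt0.
have q0 : 0 < (b^-1)%:E * NN by rewrite mule_gt0.
have q1 : 0 < ((b^-1)%:E * NN') `^ (p - 1) by rewrite poweR_gt0// mule_gt0.
have NNoo : NN < +oo.
  rewrite ltey; apply/eqP => e; move: H; rewrite e gt0_muley// gt0_mulye//.
have NN'oo : NN' < +oo.
  rewrite ltey; apply/eqP => e; move: H; rewrite e gt0_muley//.
  by rewrite poweRyr ?gt0_muley ?gt_eqF.
have fN : NN \is a fin_num by rewrite ge0_fin_numE ?ltW.
have fN' : NN' \is a fin_num by rewrite ge0_fin_numE ?ltW.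
move: pN pN' H; rewrite -(fineK fN) -(fineK fN') !lte_fin -[X in X `^ _]EFinM poweR_EFin -!EFinM lee_fin.
set N := fine NN; set N' := fine NN'.
move=> N0 N'0 H; exists N, N'; split => //.
have {}H : (((b^-1 * N) * (b^-1 * N') `^ (p - 1)) `^ y <= k `^ y)%R.
  apply: ge0_ler_powR => //; rewrite ?nnegrE ?(ltW y0) ?(ltW k0)//.
  by rewrite !mulr_ge0 ?powR_ge0 ?(ltW bi0) ?(ltW N0).
move: H; have [a ->] := expR_ex N0; have [a' ->] := expR_ex N'0.
have [e ->] := expR_ex b0; have [f ->] := expR_ex k0.
rewrite -expRN -!expRD !powR_expR -!expRD !powR_expR !ler_expR => H.
rewrite -subr_ge0; move: H; rewrite -subr_ge0; congr (0 <= _)%R.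
rewrite /y; field; rewrite gt_eqF//.
Qed.

Lemma Ainf_muckenhoupt : Ainf mu BB u -> exists y A : R, [/\ (0 < y)%R, (0 < A)%R &
  muckenhoupt mu BB ur y A].
Proof.
case=> [[_ /A1_mean[c c0 Ac]]|[p [p1 [_ /(Ap_muckenhoupt p1)[A A0 HA]]]]].
  by exists 1%R, c; split => //; exact: A1_muckenhoupt.
by exists (p - 1)^-1%R, A; split => //; rewrite invr_gt0 subr_gt0.
Qed.

End real_weight.
End weight_classes.

(** * Weak quasi-norms and conclusion *)
Section transfer.
Context {d : measure_display} {X : measurableType d} {R : realType}.
Variables (mu : {measure set X -> \bar R}) (BB : set (set X)).
Variables (star : set X -> set X).
Hypothesis hBB : ball_basis mu BB star.

Lemma enlargement_exists : exists C0, enlargement mu BB star C0.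
Proof. by have [C0 [C01 [h1 h2 h3 h4]]] := bb_B4 hBB; exists C0; split. Qed.

Lemma oscillating_representative (m : nat) (r : R) (V : completeNormedModType R)
  (T : ('I_m -> X -> R) -> X -> R) : bounded_oscillation mu BB r star V T ->
  exists (V' : completeNormedModType R) (cT : ('I_m -> X -> R) -> X -> V') (C1 C2 : R),
  [/\ (0 < C1)%R, (0 < C2)%R, osc_T1 mu BB r star cT C1, osc_T2 mu BB r star cT C2 &
   forall f x, Lr mu r f -> `|T f x|%R = `|cT f x|%R].
Proof.
case=> [V' cT T' _ TE [C1 [C2 [? ? ? ?]]]|T' _ [C1 [C2 [? ? ? ?]]]].
  exists V', cT, C1, C2; split => // f x Lf.
  by rewrite TE// normr_id.
by exists R, T', C1, C2; split.
Qed.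

(** Outer measures see only the values on measurable sets. *)
Lemma mu_ext_eq (nu nu' : set X -> \bar R) :
  (forall A, measurable A -> nu A = nu' A) -> mu_ext nu = mu_ext nu'.
Proof.
move=> e; apply/funext => A; rewrite /mu_ext; congr ereal_inf.
apply/seteqP; split => _ [F [mF AF] <-]; exists F => //.
  by apply: eq_eseriesr => k _; rewrite e.
by apply: eq_eseriesr => k _; rewrite e.
Qed.

Lemma weak_norm_dist (q k l : R) (nu : set X -> \bar R) (F : X -> \bar R) :
  (0 < q)%R -> weak_norm q nu F <= k%:E -> (0 < l)%R ->
  (forall A, 0 <= mu_ext nu A) ->
  mu_ext nu [set x | l%:E < `|F x|] <= ((k / l) `^ q)%:E.
Proof.
move=> q0 H l0 nu0; set a := mu_ext _ _.
have : l%:E * a `^ q^-1 <= k%:E.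
  by apply: le_trans H; apply: ereal_sup_ubound; exists l.
rewrite muleC -lee_pdivlMr// -EFinM => Ha.
have := poweR_le (ltW q0) (poweR_ge0 _ _) Ha.
by rewrite -poweRrM mulVf ?gt_eqF// poweRe1//; exact: nu0.
Qed.

Lemma weak_norm_le (q k : R) (nu : set X -> \bar R) (F : X -> \bar R) :
  (0 < q)%R -> (0 <= k)%R -> (forall A, 0 <= mu_ext nu A) ->
  (forall l, (0 < l)%R ->
    mu_ext nu [set x | l%:E < `|F x|] <= ((k / l) `^ q)%:E) ->
  weak_norm q nu F <= k%:E.
Proof.
move=> q0 k0 nu0 H; apply: ge_ereal_sup => _ [l /= l0 <-].
rewrite muleC -lee_pdivlMr// -EFinM.
have qi : (0 <= q^-1)%R by rewrite invr_ge0 ltW.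
have := poweR_le qi (nu0 _) (H l l0).
rewrite poweR_EFin -powRrM mulfV ?gt_eqF// powRr1//.
by rewrite divr_ge0// ltW.
Qed.

Lemma multimax_le_maximal (G : nat -> set X) (m : nat) (r : R) f x :
  (forall n, BB (G n)) ->
  @multimax _ _ _ mu G m r f x <= maximal mu BB r (fun i => EFin \o f i) x.
Proof.
move=> bG; have [B [bB Bx _]] := bb_B2 hBB x x.
rewrite /maximal asboolT; last by exists B.
apply: ge_ereal_sup => _ [n _ <-].
have [Gx|nGx] := pselect (G n x).
  by rewrite indicE mem_set// mul1e; apply: ereal_sup_ubound; exists (G n).
rewrite indicE memNset// mul0e.
apply: (@le_trans _ _ (\prod_(i < m) avg mu r B (EFin \o f i))).
  by apply: prode_ge0 => i _; exact: avg_ge0.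
by apply: ereal_sup_ubound; exists B.
Qed.

End transfer.

Section main.
Context {d : measure_display} {X : measurableType d} {R : realType}.
Variables (mu : {measure set X -> \bar R}) (BB : set (set X)).
Variables (star : set X -> set X) (C0 : R).
Hypothesis hBB : ball_basis mu BB star.
Hypothesis hE : enlargement mu BB star C0.
Variables (q : R) (w v t : X -> R).
Hypotheses (q0 : (0 < q)%R).
Hypotheses (mw : measurable_fun [set: X] w) (mv : measurable_fun [set: X] v).
Hypotheses (w0 : forall x, (0 < w x)%R) (v0 : forall x, (0 < v x)%R).
Hypothesis mt : measurable_fun [set: X] t.
Let rw x : R := (w x * v x `^ q)%R.
Let rw0 x : (0 <= rw x)%R. Proof. by rewrite mulr_ge0 ?powR_ge0// ltW. Qed.
Let mrw : measurable_fun [set: X] rw.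
Proof. by apply: measurable_funM => //; exact: measurable_powRF. Qed.
Local Notation rho := (dens mu rw0 mrw).

(** The level set is the increasing union of its parts contained in all the
    balls [Q j] with [n <= j], on which [w] and [v ^ q] are at most [n + 1] and [v]
    is at least [1 / (n + 1)]. *)
Lemma truncation (l c : R) : (0 < l)%R ->
  (forall E Q kap t0, measurable E -> BB Q -> E `<=` Q -> (0 < kap)%R ->
    (forall x, E x -> (w x <= kap)%R /\ (v x `^ q <= kap)%R) -> (0 < t0)%R ->
    (forall x, E x -> (t0 < t x)%R /\ (l `^ q * v x `^ q <= t x `^ q)%R) ->
    rho E <= c%:E) ->
  rho [set x | (l * v x < t x)%R] <= c%:E.
Proof.
move=> l0 H; have [Q [bQ exQ]] := exhaustion hBB hE.
pose Sset := [set x | (l * v x < t x)%R].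
have mlt (f g : X -> R) : measurable_fun [set: X] f -> measurable_fun [set: X] g ->
    measurable [set x | (f x < g x)%R].
  move=> mf mg; rewrite (_ : [set x | _] = [set x | 0%:E < (EFin \o (g \- f)%R) x]).
    by apply: measurable_gt; apply/measurable_EFinP; exact: measurable_funB.
  by apply/seteqP; split => x /=; rewrite lte_fin subr_gt0.
have mle (f g : X -> R) : measurable_fun [set: X] f -> measurable_fun [set: X] g ->
    measurable [set x | (f x <= g x)%R].
  move=> mf mg; rewrite (_ : [set x | _] = ~` [set x | (g x < f x)%R]).
    by apply: measurableC; exact: mlt.
  by apply/seteqP; split => x /=; rewrite leNgt => /negP.
have mS : measurable Sset by apply: mlt => //; exact: measurable_funM.
pose k n : R := n.+1%:R.
have kgt n : (0 < k n)%R by rewrite ltr0n.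
pose F n := Sset `&` (\bigcap_(j in [set j | (n <= j)%N]) Q j) `&`
  [set x | (w x <= k n)%R] `&` [set x | (v x `^ q <= k n)%R] `&`
  [set x | ((k n)^-1 <= v x)%R].
have mF n : measurable (F n).
  apply: measurableI; last by apply: mle.
  apply: measurableI; last by apply: mle => //; exact: measurable_powRF.
  apply: measurableI; last by apply: mle.
  apply: measurableI => //; apply: bigcap_measurable; first by exists n => /=.
  by move=> j _; exact: (bb_measurable hBB).
have kle a b : (a <= b)%N -> (k a <= k b)%R by move=> ab; rewrite ler_nat.
have ndF a b : (a <= b)%N -> F a `<=` F b.
  move=> ab x [[[[Sx Qx] /= h1] /= h2] /= h3].
  split; [split; [split; [split => //|]|]|] => /=.
  - by move=> j /= bj; apply: Qx => /=; exact: leq_trans bj.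
  - exact: le_trans h1 (kle _ _ ab).
  - exact: le_trans h2 (kle _ _ ab).
  - by apply: le_trans h3; rewrite lef_pV2 ?posrE// kle.
have FS : Sset = \bigcup_(n in setT) F n.
  apply/seteqP; split => [x Sx|x [n _ [[[[]]]]]//].
  have [N HN] := exQ x.
  have bnd z : exists n, (z <= k n)%R.
    exists (Num.bound `|z|); apply: le_trans (ler_norm _) _.
    apply: ltW; apply: (lt_le_trans (archi_boundP (normr_ge0 z))).
    by rewrite ler_nat.
  have [n1 h1] := bnd (w x); have [n2 h2] := bnd (v x `^ q)%R; have [n3 h3] := bnd (v x)^-1%R.
  exists (maxn N (maxn n1 (maxn n2 n3))) => //; set n := maxn _ _.
  have [e0 e1 e2 e3] : [/\ (N <= n)%N, (n1 <= n)%N, (n2 <= n)%N & (n3 <= n)%N].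
    by rewrite /n !leq_max !leqnn !orbT.
  split; [split; [split; [split => //|]|]|] => /=.
  - by move=> j /= nj; apply: HN; exact: leq_trans nj.
  - exact: le_trans h1 (kle _ _ e1).
  - exact: le_trans h2 (kle _ _ e2).
  - rewrite -[leRHS]invrK lef_pV2 ?posrE ?invr_gt0//.
    exact: le_trans h3 (kle _ _ e3).
have HF n : rho (F n) <= c%:E.
  apply: (H _ (Q n) (k n) (l * (k n)^-1)%R) => //.
  - by move=> x [[[[_ Qx] _] _] _]; apply: Qx => /=.
  - by move=> x [[[_ h1] h2] _].
  - by rewrite divr_gt0.
  - move=> x [[[[Sx _] _] _] /= h3]; split.
      by apply: le_lt_trans Sx; rewrite ler_pM2l.
    rewrite -powRM ?(ltW l0) ?(ltW (v0 x))//.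
    apply: ge0_ler_powR; rewrite ?nnegrE ?(ltW q0)//.
    + by rewrite mulr_ge0 ?(ltW l0) ?(ltW (v0 x)).
    + by apply: le_trans (ltW Sx); rewrite mulr_ge0 ?(ltW l0) ?(ltW (v0 x)).
    + exact: ltW Sx.
rewrite -/Sset FS; apply: measure_bigcup_limit => [n _|N]; first exact: mF.
apply: le_trans (HF N); apply: le_measure; rewrite ?inE//.
  by apply: bigcup_measurable => j _; exact: mF.
by move=> x [j [_ /= jN] Fx]; exact: ndF (ltnW jN) _ Fx.
Qed.

Variables (w' v' : X -> \bar R).
Hypothesis mrho' : measurable_fun [set: X] (fun x => w' x * v' x `^ q).
Hypothesis wvE : {ae mu, forall x, w' x = (w x)%:E /\ v' x = (v x)%:E}.
Local Notation wgt := (weighted mu (fun x => w' x * v' x `^ q)).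

Lemma weighted_ext : mu_ext wgt = mu_ext rho.
Proof.
apply: mu_ext_eq => A mA; rewrite /weighted /dens; apply: ae_eq_integral => //.
- exact: measurable_funTS.
- by apply/measurable_EFinP; exact: measurable_funTS.
by apply: filterS wvE => x [-> ->] _; rewrite poweR_EFin EFinM.
Qed.

Let null_bad : exists N, [/\ measurable N, rho N = 0 &
  forall x, ~ N x -> w' x = (w x)%:E /\ v' x = (v x)%:E].
Proof.
have [N [mN N0 PN]] := wvE; exists N; split => //.
  rewrite /dens null_set_integral//.
  by apply/measurable_EFinP; exact: measurable_funTS.
by move=> x nN; apply: contrapT => nP; apply: nN; apply: PN.
Qed.

Lemma abs_quotient (z : \bar R) (y l : R) : (0 < y)%R ->
  (l%:E < `|z / y%:E|) = ((l * y)%:E < `|z|).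
Proof.
move=> y0; rewrite inver gt_eqF// abseM.
have -> : `|(y^-1)%:E| = (y^-1)%:E by rewrite gee0_abs// lee_fin invr_ge0 ltW.
by rewrite lte_pdivlMr// EFinM.
Qed.

Lemma weak_norm_measurable (k : R) (F : X -> R) : (0 <= k)%R ->
  (forall x, `|F x|%R = t x) ->
  (forall l, (0 < l)%R -> rho [set x | (l * v x < t x)%R] <= ((k / l) `^ q)%:E) ->
  weak_norm q wgt (fun x => (F x)%:E / v' x) <= k%:E.
Proof.
move=> k0 Ft H; have [N [mN N0 PN]] := null_bad.
have mS l : measurable [set x | (l * v x < t x)%R].
  rewrite (_ : [set x | _] = [set x | 0%:E < (EFin \o (fun x => t x - l * v x)%R) x]).
    apply: measurable_gt; apply/measurable_EFinP; apply: measurable_funB => //.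
    exact: measurable_funM.
  by apply/seteqP; split => x /=; rewrite lte_fin subr_gt0.
apply: weak_norm_le => // [A|l l0]; rewrite weighted_ext; first exact: mu_ext_ge0.
apply: le_trans (H l l0).
apply: (@le_trans _ _ (mu_ext rho ([set x | (l * v x < t x)%R] `|` N))).
  apply: le_mu_ext => x /=; have [Nx|nNx] := pselect (N x); first by right.
  have [_ ->] := PN x nNx; rewrite abs_quotient// => h; left.
  by move: h; rewrite /= lte_fin Ft.
rewrite measurable_mu_extE; last exact: measurableU.
apply: le_trans (measureU2 _ (mS l) mN) _.
by rewrite [X in _ + X](_ : _ = 0) ?adde0.
Qed.

(** The measurable set on the left is, up to a null set, contained in the
    level set of [F / v'], whose outer measure is controlled. *)
Lemma weak_norm_lower (k a : R) (F : X -> \bar R) (mm : X -> \bar R) :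
  (0 < a)%R -> measurable_fun [set: X] mm -> (forall x, 0 <= mm x) ->
  (forall x, mm x <= F x) ->
  weak_norm q wgt (fun x => F x / v' x) <= k%:E ->
  rho [set x | (a * v x `^ q)%:E < mm x `^ q] <= ((k / (a `^ q^-1)) `^ q)%:E.
Proof.
move=> a0 mmm mm0 mF H; have [N [mN N0 PN]] := null_bad.
set l := (a `^ q^-1)%R; have l0 : (0 < l)%R by exact: powR_gt0.
have lq : (l `^ q = a)%R by rewrite /l -powRrM mulVf ?gt_eqF// powRr1// ltW.
have -> : [set x | (a * v x `^ q)%:E < mm x `^ q] = [set x | (l * v x)%:E < mm x].
  have lv x : (a * v x `^ q)%:E = (l * v x)%:E `^ q.
    by rewrite poweR_EFin powRM ?lq// ltW.
  apply/seteqP; split => x /=; rewrite lv => h.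
    rewrite ltNge; apply/negP => h'; move: h; rewrite ltNge => /negP; apply.
    by apply: poweR_le => //; exact: ltW.
  rewrite ltNge; apply/negP => h'; move: h; rewrite ltNge => /negP; apply.
  have qi : (0 <= q^-1)%R by rewrite invr_ge0 ltW.
  have lv0 : 0 <= (l * v x)%:E by rewrite lee_fin mulr_ge0 ?(ltW l0) ?(ltW (v0 x)).
  have := poweR_le qi (poweR_ge0 _ _) h'.
  by rewrite -!poweRrM mulfV ?gt_eqF// !poweRe1.
have mS : measurable [set x | (l * v x)%:E < mm x].
  rewrite (_ : [set x | _] = [set x | 1%:E < (fun x => mm x * ((l * v x)^-1)%:E) x]).
    apply: measurable_gt; apply: emeasurable_funM => //.
    apply/measurable_EFinP; apply: measurable_inv; first exact: measurable_funM.
    by move=> x; exact: mulr_gt0.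
  by apply/seteqP; split => x /=; rewrite lte_pdivlMr ?mul1e// mulr_gt0.
apply: (@le_trans _ _ (rho ([set x | (l * v x)%:E < mm x] `\` N))).
  apply: (@le_trans _ _ (rho (([set x | (l * v x)%:E < mm x] `\` N) `|` N))).
    apply: le_measure; rewrite ?inE//.
      by apply: measurableU => //; exact: measurableD.
    by move=> x Sx; have [Nx|nNx] := pselect (N x); [right|left].
  apply: le_trans (measureU2 _ _ mN) _; first exact: measurableD.
  by rewrite [X in _ + X](_ : _ = 0) ?adde0.
have ext0 A : 0 <= mu_ext wgt A by rewrite weighted_ext mu_ext_ge0.
have := weak_norm_dist q0 H l0 ext0.
apply: le_trans; rewrite weighted_ext -measurable_mu_extE; last exact: measurableD.
apply: le_mu_ext => x [/= lx nNx]; have [_ ->] := PN x nNx; rewrite abs_quotient//.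
by apply: (lt_le_trans lx); apply: (le_trans (mF x)); exact: lee_abs.
Qed.

End main.

Theorem theorem1p7 (d : measure_display) (X : measurableType d) (R : realType)
    (mu : {measure set X -> \bar R})
    (BB : set (set X)) (star : set X -> set X)
    (hBB : ball_basis mu BB star)
    (hRH : forall u : X -> \bar R, A1 mu BB u ->
       exists s : R, (1 < s)%R /\ RH mu BB s u)
    (V : completeNormedModType R) (m : nat) (hm : (0 < m)%N)
    (r : R) (hr : (1 <= r)%R)
    (T : ('I_m -> X -> R) -> X -> R)
    (hT : bounded_oscillation mu BB r star V T)
    (hTb : weak_bounded mu r T)
    (w v : X -> \bar R) (hw : A1 mu BB w) (hv : weight mu v)
    (hvA : Ainf mu BB (fun x => v x `^ (r / m%:R)%R)) :
  exists C : R, (0 < C)%R /\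
    forall f : 'I_m -> X -> R, Lr mu r f ->
      weak_norm (r / m%:R)%R
        (weighted mu (fun x => w x * v x `^ (r / m%:R)%R))
        (fun x => (T f x)%:E / v x)
      <= C%:E *
         weak_norm (r / m%:R)%R
           (weighted mu (fun x => w x * v x `^ (r / m%:R)%R))
           (fun x => maximal mu BB r (fun i => EFin \o f i) x / v x).
Proof.
have [C0 hE] := enlargement_exists hBB.
have [G [bG hG]] := grid hBB hE.
set q : R := (r / m%:R)%R.
have r0 : (0 < r)%R by exact: lt_le_trans hr.
have q0 : (0 < q)%R by rewrite divr_gt0// ltr0n.
have [V' [cT [C1 [C2 [C10 C20 hT1 hT2 TcT]]]]] := oscillating_representative hT.
have [Cw [Cw0 hTw]] := hTb.
pose t f x : R := `|cT f x|%R.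
have tE f : Lr mu r f -> t f = (fun x => `|T f x|%R).
  by move=> Lf; apply/funext => x; rewrite /t -TcT.
have mt f : Lr mu r f -> measurable_fun [set: X] (t f).
  by move=> Lf; rewrite tE//; apply: measurableT_comp => //; have [] := hTw f Lf.
have weakT f : Lr mu r f -> forall l : R, (0 < l)%R ->
   mu [set x | (l < t f x)%R] <= ((Cw * (\prod_(i < m) Lrnorm mu r f i) / l) `^ q)%:E.
  move=> Lf l l0; have [mTf] := hTw f Lf.
  under eq_bigr do rewrite (LrnormE hr)//.
  rewrite prodEFin -EFinM => H.
  have := weak_norm_dist q0 H l0 (@mu_ext_ge0 _ _ _ mu (measure_ge0 mu)).
  rewrite measurable_mu_extE; last first.
    by apply: (@measurable_gt _ _ _ (abse \o (EFin \o T f))); apply: measurableT_comp => //; exact/measurable_EFinP.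
  congr (_ <= _); congr (mu _); apply/seteqP; split => x /=; by rewrite tE// lte_fin.
have [mw_ _] := hw.1; have [mv_ _] := hv.
have [wr [mwr wr0 wE]] := real_version hw.1.
have [vr [mvr vr0 vE]] := real_version hv.
have [c c0 Ac] := A1_mean hBB mw_ mwr wr0 wE hw.2.
have [s0 [s01 hs0]] := hRH w hw.
have [C Cp0 revw] := RH_A1_power hBB mw_ mwr wr0 wE c0 Ac s01 hs0.
pose nu x : R := (vr x `^ q)%R.
have mnu : measurable_fun [set: X] nu by exact: measurable_powRF.
have nu0 x : (0 < nu x)%R by exact: powR_gt0.
have nuE : {ae mu, forall x, v x `^ q = (nu x)%:E}.
  by apply: filterS vE => x ->; rewrite poweR_EFin.
have mvq : measurable_fun [set: X] (fun x => v x `^ q) by exact: measurable_poweRF.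
have [y [A [y0 A0 mucknu]]] := Ainf_muckenhoupt hBB mvq mnu nu0 nuE hvA.
have dom : dominated mu BB star (Lr mu r) t (multimax mu G r) q.
  move=> D eps eta dl; exact: (coifman_fefferman hBB hE bG hG hm hr C10 C20 Cw0 hT1 hT2 mt weakT).
have [Cf Cf0 HCf] := weighted_weak hBB hE bG hG q0 mt
  (measurable_multimax hBB bG r) dom mnu mwr nu0 wr0 y0 s01 A0 Cp0 mucknu revw.
exists (Cf `^ q^-1)%R; split; first exact: powR_gt0.
move=> f Lf; set WN := weak_norm q _ (fun x => maximal _ _ _ _ _ / _).
have Cq0 : (0 < Cf `^ q^-1)%R by exact: powR_gt0.
have mrho : measurable_fun [set: X] (fun x => w x * v x `^ q) by exact: emeasurable_funM.
have wvE : {ae mu, forall x, w x = (wr x)%:E /\ v x = (vr x)%:E} by apply: filterS2 wE vE.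
have main k : (0 < k)%R -> WN <= k%:E ->
   weak_norm q (weighted mu (fun x => w x * v x `^ q)) (fun x => (T f x)%:E / v x)
     <= (Cf `^ q^-1 * k)%:E.
  move=> k0 WNk; apply: (@weak_norm_measurable _ _ _ mu q wr vr (t f) q0 mwr mvr wr0 vr0 (mt f Lf)
    w v mrho wvE) => //.
  - by rewrite mulr_ge0 ?powR_ge0// ltW.
  - by move=> x; rewrite tE.
  move=> l l0; apply: (@truncation _ _ _ mu BB star C0 hBB hE q wr vr (t f) q0 mwr mvr wr0 vr0
    (mt f Lf)) => //.
  move=> E Q kap t0 mE bQ EQ kap0 Ekap t00 Et.
  have lq0 : (0 < l `^ q)%R by exact: powR_gt0.
  have kq0 : (0 < k `^ q)%R by exact: powR_gt0.
  have weak a : (0 < a)%R -> \int[mu]_(x in [set x | (a * nu x)%:E < multimax mu G r f x `^ q])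
      (wr x * nu x)%:E <= (k `^ q / a)%:E.
    move=> a0.
    have := weak_norm_lower q0 mwr mvr wr0 vr0 mrho wvE a0 (measurable_multimax hBB bG r f)
      (multimax_ge0 mu G r f) (fun x => multimax_le_maximal hBB r f x bG) WNk.
    congr (_ <= _%:E); have [a1 ->] := expR_ex a0; have [k1 ->] := expR_ex k0.
    rewrite !powR_expR -!expRN -!expRD powR_expR; congr expR.
    by field; rewrite gt_eqF.
  have := HCf f E Q kap t0 (l `^ q)%R (k `^ q)%R Lf mE bQ EQ kap0 Ekap t00 lq0 kq0 Et weak.
  rewrite -lee_pdivlMl// => H; apply: (le_trans H); rewrite -EFinM lee_fin.
  apply: eqle.
  have [a1 ->] := expR_ex Cf0; have [k1 ->] := expR_ex k0; have [l1 ->] := expR_ex l0.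
  rewrite !powR_expR -!expRN -!expRD powR_expR; congr expR.
  by field; rewrite gt_eqF.
have WN0 : 0 <= WN.
  apply: (@le_trans _ _ (1%:E * mu_ext (weighted mu (fun x => w x * v x `^ q))
    [set x | 1%:E < `|maximal mu BB r (fun i => EFin \o f i) x / v x|] `^ q^-1)).
    by rewrite mul1e poweR_ge0.
  by apply: ereal_sup_ubound; exists 1%R => //=.
have [->|WNne] := eqVneq WN +oo; first by rewrite gt0_muley ?leey// lte_fin.
have WNf : WN = (fine WN)%:E by rewrite fineK// ge0_fin_numE// ltey.
apply/lee_addgt0Pr => e e0.
have f0 : (0 <= fine WN)%R by exact: fine_ge0.
have ec0 : (0 < e / Cf `^ q^-1)%R by rewrite divr_gt0.
apply: (le_trans (main (fine WN + e / Cf `^ q^-1)%R _ _)).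
- by rewrite ltr_wpDl.
- by rewrite {1}WNf lee_fin lerDl ltW.
- rewrite {2}WNf -EFinM -EFinD lee_fin mulrDr.
  by rewrite mulrC [(_ * (e / _))%R]mulrC divfK ?gt_eqF// [(fine _ * _)%R]mulrC.
Qed.
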